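(* Let $\mu_0\in\mathcal{N}_n$ be a nilpotent Lie bracket on $\mathbb{R}^n$. Let $g(t)$ be the solution to the Ricci flow $\frac{\partial}{\partial t}g(t)=-2\operatorname{Rc}(g(t))$ with $g(0)=g_{\mu_0}$, and let $\mu(t)$ be the solution to the bracket flow $\frac{d}{dt}\mu=\delta_\mu(\operatorname{Ric}_\mu)$ with $\mu(0)=\mu_0$. Then there exists a one-parameter family $\{h(t)\}\subset\mathrm{GL}_n(\mathbb{R})$ such that $$g(t)=h(t)^*g_{\mu(t)}\qquad\text{for all } t.$$ Furthermore, the following conditions hold for $h=h(t)$ for all $t$: (i) $\frac{d}{dt}h=-h\operatorname{Ric}(g(t))(0)=-\operatorname{Ric}_{\mu(t)}h$, with $h(0)=I$. (ii) $\langle\cdot,\cdot\rangle_t=\langle h\cdot,h\cdot\rangle$ is the solution to the ODE $\frac{d}{dt}\langle\cdot,\cdot\rangle_t=-2\operatorname{Rc}(\langle\cdot,\cdot\rangle_t)$, $\langle\cdot,\cdot\rangle_0=\langle\cdot,\cdot\rangle$. (iii) $\mu(t)=h\mu_0(h^{-1}\cdot,h^{-1}\cdot)$.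
   Context: $V_n$ is the vector space of skew-symmetric bilinear maps $\mathbb{R}^n\times\mathbb{R}^n\to\mathbb{R}^n$, and $\mathcal{N}_n\subset V_n$ is the set of those that satisfy the Jacobi identity and are nilpotent (nilpotent Lie brackets on $\mathbb{R}^n$). For $\mu\in\mathcal{N}_n$, $(\mathbb{R}^n,\cdot_\mu)$ is the simply connected nilpotent Lie group with Lie algebra $(\mathbb{R}^n,\mu)$, identified with $\mathbb{R}^n$ via its exponential map (a diffeomorphism), so the product $x\cdot_\mu y$ is given by the Baker-Campbell-Hausdorff formula; $L_\mu(x)y=x\cdot_\mu y$. $\langle\cdot,\cdot\rangle$ is the canonical inner product on $\mathbb{R}^n$ and $\{e_i\}$ the canonical basis. The Riemannian metric $g_\mu$ on $\mathbb{R}^n$ is the left-invariant metric on $(\mathbb{R}^n,\cdot_\mu)$ whose value at $0$ is $\langle\cdot,\cdot\rangle$: $g_\mu(x)(dL_\mu(x)|_0v,dL_\mu(x)|_0w)=\langle v,w\rangle$. $\operatorname{Rc}$ denotes the Ricci tensor and $\operatorname{Ric}$ the Ricci operator of a metric. For $\mu\in\mathcal{N}_n$, $\operatorname{Ric}_\mu:=\operatorname{Ric}(g_\mu)(0):\mathbb{R}^n\to\mathbb{R}^n$, which is given by $\operatorname{Ric}_\mu=-\frac12\sum_i(\operatorname{ad}_\mu e_i)^t\operatorname{ad}_\mu e_i+\frac14\sum_i\operatorname{ad}_\mu e_i(\operatorname{ad}_\mu e_i)^t$; this formula defines $\operatorname{Ric}_\mu$ for every $\mu\in V_n$. For $\alpha\in\mathfrak{gl}_n(\mathbb{R})$,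 $\mu\in V_n$: $\delta_\mu(\alpha)=\mu(\alpha\cdot,\cdot)+\mu(\cdot,\alpha\cdot)-\alpha\mu(\cdot,\cdot)$. The solution $\mu(t)$ of the bracket flow starting at $\mu_0\in\mathcal{N}_n$ stays in $\mathcal{N}_n$. The Ricci flow solution $g(t)$ is the one that is $(\mathbb{R}^n,\cdot_{\mu_0})$-invariant for all $t$ (equivalently the unique solution that is complete with bounded curvature), so it is determined by the inner product $\langle\cdot,\cdot\rangle_t:=g(t)(0)$ on $\mathbb{R}^n\equiv T_0\mathbb{R}^n$. For an inner product on $\mathbb{R}^n$, $\operatorname{Rc}$ of it means the value at $0$ of the Ricci tensor of the corresponding $(\mathbb{R}^n,\cdot_{\mu_0})$-left-invariant metric; thus $\operatorname{Rc}(\langle\cdot,\cdot\rangle_t)=\operatorname{Rc}(g(t))(0)$. ''For all $t$'' means for all $t$ in the maximal interval of existence. *)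

(* Defs.v *)
From HB Require Import structures.
From mathcomp Require Import all_boot all_order all_algebra.
From mathcomp Require Import all_classical all_reals all_analysis.

Set Implicit Arguments.
Unset Strict Implicit.
Unset Printing Implicit Defensive.

Import Order.TTheory GRing.Theory Num.Theory.
Import numFieldNormedType.Exports.

Local Open Scope classical_set_scope.
Local Open Scope ring_scope.

(** Vectors of R^n are columns; a bilinear form on R^n is identified with its
    Gram matrix [B], i.e. [B(v, w) = v^T B w], and linear maps with matrices
    acting on the left.  All spaces are finite-dimensional, so their norm
    topology does not depend on the norm chosen by the library. *)

Section Vectors.
Variables (R : realType) (n : nat).

Definition basis_vec (i : 'I_n) : 'cV[R]_n := delta_mx i 0.

Definition inner_product (P : 'M[R]_n) : Prop :=
  P^T = P /\ forall v : 'cV[R]_n, v != 0 -> 0 < (v^T *m P *m v) 0 0.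

Definition pderiv (i : 'I_n) (f : 'cV[R]_n -> R) : 'cV[R]_n -> R :=
  fun x => 'D_(basis_vec i) f x.

(** C^infinity: every iterated partial derivative is differentiable. *)
Definition smooth (f : 'cV[R]_n -> R) : Prop :=
  forall (s : seq 'I_n) (x : 'cV[R]_n), differentiable (foldr pderiv f s) x.

Definition jacobian_mx (f : 'cV[R]_n -> 'cV[R]_n) (x : 'cV[R]_n) : 'M[R]_n :=
  \matrix_(i, j) pderiv j (fun y => f y i 0) x.

End Vectors.

Section Brackets.
Variables (R : realType) (n : nat).
Local Notation V := 'cV[R]_n.
Implicit Types (mu : V -> V -> V).

Definition skew_bilinear mu : Prop :=
  [/\ forall x, linear (mu x),
      forall y, linear (mu^~ y)
    & forall x y, mu y x = - mu x y].

Definition jacobi mu : Prop :=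
  forall x y z, mu x (mu y z) + mu y (mu z x) + mu z (mu x y) = 0.

(** Some term of the lower central series vanishes: all brackets
    [mu x1 (mu x2 (... (mu xk y)))] are zero for some [k]. *)
Definition nilpotent_bracket mu : Prop :=
  exists k, forall (s : seq V) (y : V), size s = k -> foldr mu y s = 0.

Definition nilpotent_lie_bracket mu : Prop :=
  [/\ skew_bilinear mu, jacobi mu & nilpotent_bracket mu].

Definition ad mu (x : V) : 'M[R]_n :=
  \matrix_(i, j) mu x (basis_vec R j) i 0.

Definition bracket_delta mu (a : 'M[R]_n) : V -> V -> V :=
  fun x y => mu (a *m x) y + mu x (a *m y) - a *m mu x y.

Definition bracket_ric mu : 'M[R]_n :=
  - 2^-1 *: (\sum_i (ad mu (basis_vec R i))^T *m ad mu (basis_vec R i))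
  + 4^-1 *: (\sum_i ad mu (basis_vec R i) *m (ad mu (basis_vec R i))^T).

Definition bracket_act (h : 'M[R]_n) mu : V -> V -> V :=
  fun x y => h *m mu (invmx h *m x) (invmx h *m y).

(** [mu x1 (mu x2 (... (mu x(m-1) xm)))] *)
Definition nested_bracket mu (s : seq V) : V :=
  if s is x :: s' then foldr mu (last x s') (belast x s') else 0.

(** [x^r1 y^s1 x^r2 y^s2 ... x^rk y^sk], where [f i = (r_(i+1), s_(i+1))] *)
Definition dynkin_word (x y : V) (k : nat)
    (f : {ffun 'I_k -> 'I_n.+1 * 'I_n.+1}) : seq V :=
  flatten [seq nseq (f i).1 x ++ nseq (f i).2 y | i <- enum 'I_k].

(** Baker-Campbell-Hausdorff product in Dynkin's form
      sum_(k >= 1) (-1)^(k-1)/k sum_(r_i + s_i > 0)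
        [x^r1 y^s1 ... x^rk y^sk]
          / (sum_i (r_i + s_i) * prod_i r_i! s_i!).
    The truncation to [k <= n] and [r_i, s_i <= n] is harmless: a nilpotent Lie
    algebra of dimension [n] has nilpotency class at most [n], so every omitted
    bracket, which has more than [n] entries, vanishes. *)
Definition bch mu (x y : V) : V :=
  \sum_(k < n) \sum_(f : {ffun 'I_k.+1 -> 'I_n.+1 * 'I_n.+1}
                       | [forall i, 0 < (f i).1 + (f i).2]%N)
    ((-1) ^+ k / (k.+1%:R * (\sum_i ((f i).1 + (f i).2))%N%:R
                  * (\prod_i ((f i).1`! * (f i).2`!))%N%:R))
    *: nested_bracket mu (dynkin_word x y f).

End Brackets.

Section Metrics.
Variables (R : realType) (n : nat).
Local Notation V := 'cV[R]_n.
Implicit Types (g : V -> 'M[R]_n) (x : V) (i j k l m : 'I_n).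

Definition riemannian_metric g : Prop :=
  (forall i j, smooth (fun x => g x i j)) /\ (forall x, inner_product (g x)).

Definition pullback (f : V -> V) g : V -> 'M[R]_n :=
  fun x => (jacobian_mx f x)^T *m g (f x) *m jacobian_mx f x.

(** Christoffel symbol Gamma^k_ij *)
Definition christoffel g k i j x : R :=
  2^-1 * \sum_l invmx (g x) k l *
    (pderiv i (fun y => g y j l) x + pderiv j (fun y => g y i l) x
     - pderiv l (fun y => g y i j) x).

(** [riemann g l i j k] is the l-th component of
    R(d_i, d_j) d_k = (nabla_i nabla_j - nabla_j nabla_i) d_k. *)
Definition riemann g l i j k x : R :=
  pderiv i (christoffel g l j k) x - pderiv j (christoffel g l i k) x
  + \sum_m (christoffel g l i m x * christoffel g m j k x
            - christoffel g l j m x * christoffel g m i k x).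

(** Rc(v, w) = tr (u |-> R(u, v) w) *)
Definition ricci_tensor g x : 'M[R]_n :=
  \matrix_(j, k) \sum_i riemann g i i j k x.

(** g(Ric v, w) = Rc(v, w) *)
Definition ricci_operator g x : 'M[R]_n := invmx (g x) *m ricci_tensor g x.

Definition left_invariant (mu : V -> V -> V) g : Prop :=
  forall x, pullback (bch mu x) g = g.

(** The left-invariant metric with value [P] at [0]:
    g(x)(dL(x)|_0 v, dL(x)|_0 w) = P(v, w). *)
Definition left_metric (mu : V -> V -> V) (P : 'M[R]_n) : V -> 'M[R]_n :=
  fun x => let dLinv := invmx (jacobian_mx (bch mu x) 0) in
           dLinv^T *m P *m dLinv.

Definition bracket_metric (mu : V -> V -> V) : V -> 'M[R]_n :=
  left_metric mu 1%:M.

Definition left_ricci (mu : V -> V -> V) (P : 'M[R]_n) : 'M[R]_n :=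
  ricci_tensor (left_metric mu P) 0.

End Metrics.

Section Flows.
Variables (R : realType) (n : nat).
Local Notation V := 'cV[R]_n.

Definition time_interval (I : set R) : Prop :=
  [/\ open I, is_interval I & I 0].

Definition maximal_solution (X : Type) (Sol : set R -> (R -> X) -> Prop)
    (I : set R) (u : R -> X) : Prop :=
  Sol I u /\
  forall (J : set R) (v : R -> X), Sol J v -> I `<=` J ->
    (forall t, I t -> v t = u t) -> J `<=` I.

(** [u] on [I] is the unique maximal solution: every solution is a restriction
    of it. *)
Definition the_solution (X : Type) (Sol : set R -> (R -> X) -> Prop)
    (I : set R) (u : R -> X) : Prop :=
  Sol I u /\
  forall (J : set R) (v : R -> X), Sol J v ->
    J `<=` I /\ forall t, J t -> v t = u t.

(** A curve in the finite-dimensional space of skew-symmetric bilinear maps is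
    differentiable iff all its evaluations are. *)
Definition bracket_flow (mu0 : V -> V -> V) (I : set R)
    (mu : R -> V -> V -> V) : Prop :=
  [/\ time_interval I,
      mu 0 = mu0,
      forall t, I t -> skew_bilinear (mu t)
    & forall t, I t -> forall x y : V,
        is_derive t 1 (fun s => mu s x y)
          (bracket_delta (mu t) (bracket_ric (mu t)) x y)].

Definition invariant_ricci_flow (mu0 : V -> V -> V) (I : set R)
    (g : R -> V -> 'M[R]_n) : Prop :=
  [/\ time_interval I,
      g 0 = bracket_metric mu0,
      forall t, I t -> riemannian_metric (g t) /\ left_invariant mu0 (g t)
    & forall t, I t -> forall x : V,
        is_derive t 1 (fun s => g s x) (- 2 *: ricci_tensor (g t) x)].

Definition inner_product_flow (mu0 : V -> V -> V) (I : set R)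
    (P : R -> 'M[R]_n) : Prop :=
  [/\ time_interval I,
      P 0 = 1%:M,
      forall t, I t -> inner_product (P t)
    & forall t, I t -> is_derive t 1 P (- 2 *: left_ricci mu0 (P t))].

End Flows.

(* Main.v *)
(** Left-invariant metrics for [mu0] correspond to inner products [P], and in the
    left-invariant frame [frame mu0] the Ricci tensor becomes an algebraic function
    of [P]; for [P = h^T *m h] it is [h^T *m bracket_ric (bracket_act h mu0) *m h],
    since the frame [frame mu0 x *m invmx h] is orthonormal with structure constants
    those of [bracket_act h mu0], and the trace and Killing forms of a nilpotent
    bracket vanish.  An invariant Ricci flow is thus an ODE for [P].  The linear
    equation [h' = - h *m (invmx P *m Rc P)] gives [P = h^T *m h], so that it reads
    [h' = - Ric *m h] for the bracket [bracket_act h mu0], which therefore solves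
    the bracket flow; conversely, along a bracket flow the solution of
    [k' = - Ric *m k] satisfies [mu = bracket_act k mu0], and [k^T *m k] solves the
    equation for [P].  Uniqueness for the bracket flow (a polynomial ODE) transfers
    to [P], and maximality together with glueing of solutions identifies the two
    intervals of existence. *)

Require Import Defs.
From mathcomp Require Import all_boot all_order all_fingroup all_algebra.
From mathcomp Require Import all_classical all_reals all_analysis.
From mathcomp Require Import ring lra zify.

Set Implicit Arguments.
Unset Strict Implicit.
Unset Printing Implicit Defensive.

Import Order.TTheory GRing.Theory Num.Theory.
Import numFieldNormedType.Exports.

Local Open Scope classical_set_scope.
Local Open Scope ring_scope.

(** * Derivatives of matrix-valued and polynomial maps *)

Section MatrixDerivatives.
Variables (R : realType) (V : normedModType R).
Implicit Types (x v : V).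

(** The obstacle is that Ricci tensors are defined by coordinate derivatives of metrics built from
    the Dynkin series, so second derivatives of the frame must be controlled. Nilpotency makes this
    algebraic: the frame differs from the identity by a matrix shifting the upper central series, so
    its inverse is a finite geometric sum, frame and coframe are polynomial, and second derivatives
    commute by induction on polynomials. The group law enters through the fact that left
    translations preserve [bracket_metric mu0], read off from the Ricci flow at time 0. As a
    unipotent orthogonal matrix is the identity, this isometry property forces left translations to
    preserve the frame, and symmetry of the second derivatives of [bch] then gives the Maurer-Cartan
    equation. As for the flows, the only equations solved are linear: along a given solution of
    either flow the gauge equation has known continuous coefficients, so [h] or [k] exists on the
    whole interval of that solution, and intervals can be compared. *)

Lemma is_derive_mxP m n (M : V -> 'M[R]_(m, n)) x v (dM : 'M[R]_(m, n)) :
  is_derive x v M dM <->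
  forall i j, is_derive x v (fun y => M y i j) (dM i j).
Proof.
split=> [[dMx <-] i j|dMij].
  have /derivable_mxP dMxij := dMx.
  by apply: DeriveDef; [exact: dMxij | rewrite derive_mx// mxE].
have dMx : derivable M x v by apply/derivable_mxP => i j; case: (dMij i j).
apply: DeriveDef => //; rewrite derive_mx//.
by apply/matrixP => i j; rewrite mxE; case: (dMij i j).
Qed.

Lemma is_derive_bigsum (W : normedModType R) (I : Type) (r : seq I)
    (P : pred I) (F : I -> V -> W) (dF : I -> W) x v :
  (forall i, P i -> is_derive x v (F i) (dF i)) ->
  is_derive x v (fun y => \sum_(i <- r | P i) F i y) (\sum_(i <- r | P i) dF i).
Proof.
move=> dFi; rewrite (_ : (fun _ => _) = \sum_(i <- r | P i) F i); last first.
  by apply/funext => y; rewrite fct_sumE.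
by elim/big_ind2 : _ => // [|] *; [exact: is_derive_cst|exact: is_deriveD].
Qed.

(** Pointwise form of the rules for [f + g], [- f] and [k *: f]; it matches the goals produced by
    rewriting under binders. *)
Lemma is_derive_add (W : normedModType R) (f g : V -> W) x v df dg :
  is_derive x v f df -> is_derive x v g dg ->
  is_derive x v (fun y => f y + g y) (df + dg).
Proof. exact: is_deriveD. Qed.

Lemma is_derive_opp (W : normedModType R) (f : V -> W) x v df :
  is_derive x v f df -> is_derive x v (fun y => - f y) (- df).
Proof. exact: is_deriveN. Qed.

Lemma is_derive_scale (W : normedModType R) (f : V -> W) (k : R) x v df :
  is_derive x v f df -> is_derive x v (fun y => k *: f y) (k *: df).
Proof. exact: is_deriveZ. Qed.

Lemma is_derive_mulmx m n p (M : V -> 'M[R]_(m, n)) (N : V -> 'M[R]_(n, p))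
    x v dM dN :
  is_derive x v M dM -> is_derive x v N dN ->
  is_derive x v (fun y => M y *m N y) (dM *m N x + M x *m dN).
Proof.
move=> /is_derive_mxP dMx /is_derive_mxP dNx; apply/is_derive_mxP => i j.
rewrite !mxE -big_split/=.
under [in X in is_derive _ _ X _]eq_fun do rewrite mxE.
apply: is_derive_bigsum => k _.
have dM1 := dMx i k; have dN1 := dNx k j.
have := is_deriveM dM1 dN1; rewrite /GRing.scale/=.
by rewrite addrC [N x k j * _]mulrC; apply.
Qed.

Lemma is_derive_scalel m n (f : V -> R) (M : 'M[R]_(m, n)) x v df :
  is_derive x v f df -> is_derive x v (fun y => f y *: M) (df *: M).
Proof.
move=> dfx; apply/is_derive_mxP => i j; rewrite mxE mulrC.
by under eq_fun do rewrite mxE mulrC; exact: (is_derive_scale (M i j) dfx).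
Qed.

Lemma is_derive_trmx m n (M : V -> 'M[R]_(m, n)) x v dM :
  is_derive x v M dM -> is_derive x v (fun y => (M y)^T) dM^T.
Proof.
move=> /is_derive_mxP dMx; apply/is_derive_mxP => i j; rewrite mxE.
by under eq_fun do rewrite mxE.
Qed.

Lemma is_derive_mulmxl m n p (A : 'M[R]_(m, n)) (N : V -> 'M[R]_(n, p)) x v dN :
  is_derive x v N dN -> is_derive x v (fun y => A *m N y) (A *m dN).
Proof.
move=> dNx; have := is_derive_mulmx (is_derive_cst A x v) dNx.
by rewrite mul0mx add0r.
Qed.

Lemma is_derive_mulmxr m n p (M : V -> 'M[R]_(m, n)) (B : 'M[R]_(n, p)) x v dM :
  is_derive x v M dM -> is_derive x v (fun y => M y *m B) (dM *m B).
Proof.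
move=> dMx; have := is_derive_mulmx dMx (is_derive_cst B x v).
by rewrite mulmx0 addr0.
Qed.

Lemma is_derive_uniq (W : normedModType R) (f : V -> W) x v d1 d2 :
  is_derive x v f d1 -> is_derive x v f d2 -> d1 = d2.
Proof. by move=> [_ <-] [_ <-]. Qed.

(** Differentiate [G *m F = 1] and solve for the derivative of [G]. *)
Lemma derive_inverse n (F G : V -> 'M[R]_n) x u dF dG :
  (forall y, G y *m F y = 1%:M) -> is_derive x u F dF -> is_derive x u G dG ->
  dG = - (G x *m dF *m G x).
Proof.
move=> GF dFx dGx; have FG y : F y *m G y = 1%:M by apply/mulmx1C/GF.
have := is_derive_mulmx dGx dFx; under eq_fun do rewrite GF.
move=> /(is_derive_uniq (is_derive_cst (1%:M : 'M[R]_n) x u)) /eqP.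
rewrite eq_sym addr_eq0 => /eqP dG0.
by rewrite -[LHS]mulmx1 -(FG x) mulmxA dG0 mulNmx.
Qed.

Lemma differentiable_mx m n (M : V -> 'M[R]_(m, n)) x :
  (forall i j, differentiable (fun y => M y i j) x) -> differentiable M x.
Proof.
move=> dMij.
rewrite (_ : M = \sum_i \sum_j ((fun y => M y i j *: delta_mx i j))); last first.
  apply/funext => y; rewrite fct_sumE [LHS]matrix_sum_delta.
  by apply: eq_bigr => i _; rewrite fct_sumE.
apply: differentiable_sum => i; apply: differentiable_sum => j.
exact: differentiableZl.
Qed.

End MatrixDerivatives.

(** * Polynomial maps and the symmetry of their second derivatives *)

Section PolynomialFunctions.
Variables (R : realType) (n : nat).
Local Notation V := 'cV[R]_n.
Implicit Types (f g : V -> R).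

(** An inductive class, so that differentiability, closure under directional derivatives and
    symmetry of second derivatives become inductions over sums and products. All entries of frame
    and coframe belong to it. *)
Inductive polyfun : (V -> R) -> Prop :=
| polyfun_cst c : polyfun (fun=> c)
| polyfun_coord i : polyfun (fun x => x i 0)
| polyfunD f g : polyfun f -> polyfun g -> polyfun (fun x => f x + g x)
| polyfunM f g : polyfun f -> polyfun g -> polyfun (fun x => f x * g x).

Lemma polyfun_sum (I : Type) (r : seq I) (P : pred I) (F : I -> V -> R) :
  (forall i, P i -> polyfun (F i)) -> polyfun (fun x => \sum_(i <- r | P i) F i x).
Proof.
move=> pF; elim: r => [|i r IHr].
  by under eq_fun do rewrite big_nil; exact: polyfun_cst.
under eq_fun do rewrite big_cons; case Pi: (P i) => //.
by apply: polyfunD => //; exact: pF.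
Qed.

Lemma polyfun_differentiable f x : polyfun f -> differentiable f x.
Proof.
elim=> [c|i|{}f g _ df _ dg|{}f g _ df _ dg].
- exact: differentiable_cst.
- exact: differentiable_coord.
- exact: (differentiableD df dg).
- exact: (differentiableM df dg).
Qed.

Lemma is_derive_coord (v x : V) i : is_derive x v (fun y : V => y i 0) (v i 0).
Proof. by have /is_derive_mxP := is_derive_id x v; exact. Qed.

Lemma polyfun_derivable f x v : polyfun f -> derivable f x v.
Proof. by move=> pf; apply/diff_derivable/polyfun_differentiable. Qed.

Lemma polyfun_derivableP f x v : polyfun f -> is_derive x v f ('D_v f x).
Proof. by move=> pf; apply/derivableP/polyfun_derivable. Qed.

Lemma derive_polyfunD f g v : polyfun f -> polyfun g ->
  'D_v (fun x => f x + g x) = (fun x => 'D_v f x + 'D_v g x).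
Proof.
move=> pf pg; apply/funext => x.
by have [_ <-] := is_deriveD (polyfun_derivableP x v pf) (polyfun_derivableP x v pg).
Qed.

Lemma derive_polyfunM f g v : polyfun f -> polyfun g ->
  'D_v (fun x => f x * g x) = (fun x => f x * 'D_v g x + g x * 'D_v f x).
Proof.
move=> pf pg; apply/funext => x.
by have [_ <-] := is_deriveM (polyfun_derivableP x v pf) (polyfun_derivableP x v pg).
Qed.

Lemma derive_coord v i : 'D_v (fun y : V => y i 0) = (fun=> v i 0).
Proof. by apply/funext => x; case: (is_derive_coord v x i). Qed.

Lemma derive_cstE (c : R) v : 'D_v (fun=> c : R) = (fun=> 0) :> (V -> R).
Proof. by apply/funext => x; exact: derive_cst. Qed.

Lemma polyfun_derive f v : polyfun f -> polyfun ('D_v f).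
Proof.
elim=> [c|i|{}f g pf df pg dg|{}f g pf df pg dg].
- by rewrite (derive_cstE c); exact: polyfun_cst.
- by rewrite derive_coord; exact: polyfun_cst.
- by rewrite derive_polyfunD//; exact: polyfunD.
- by rewrite derive_polyfunM//; apply: polyfunD; exact: polyfunM.
Qed.

Lemma polyfun_deriveC f v w : polyfun f -> 'D_v ('D_w f) = 'D_w ('D_v f).
Proof.
(* [D] abstracts the directional derivative: after [clearbody] only the derivation rules proved next
   remain, and the induction is pure algebra. *)
pose D u (F : V -> R) := 'D_u F.
have DD u F G : polyfun F -> polyfun G ->
    D u (fun x => F x + G x) = (fun x => D u F x + D u G x).
  exact: derive_polyfunD.
have DM u F G : polyfun F -> polyfun G ->
    D u (fun x => F x * G x) = (fun x => F x * D u G x + G x * D u F x).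
  exact: derive_polyfunM.
have Dp u F : polyfun F -> polyfun (D u F) by exact: polyfun_derive.
have Dcst u c : D u (fun=> c) = (fun=> 0) by exact: derive_cstE.
have Dcoord u i : D u (fun y => y i 0) = (fun=> u i 0) by exact: derive_coord.
change (polyfun f -> D v (D w f) = D w (D v f)).
clearbody D; elim=> [c|i|{}f g pf df pg dg|{}f g pf df pg dg].
- by rewrite !Dcst.
- by rewrite !Dcoord !Dcst.
- by rewrite !DD ?df ?dg//; exact: Dp.
- rewrite !DM// !DD; try (by apply: polyfunM; auto).
  rewrite !DM; auto; rewrite df dg.
  by apply/funext => x; ring.
Qed.

Lemma polyfun_smooth f : polyfun f -> smooth f.
Proof.
move=> pf s x; apply: polyfun_differentiable.
by elim: s => //= i s ps; exact: polyfun_derive.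
Qed.

Definition polymx p q (M : V -> 'M[R]_(p, q)) :=
  forall i j, polyfun (fun x => M x i j).

Lemma polymx_cst p q (A : 'M[R]_(p, q)) : polymx (fun=> A).
Proof. by move=> i j; exact: polyfun_cst. Qed.

Lemma polymx_id : polymx (fun x : V => x).
Proof. by move=> i j; rewrite (ord1 j); exact: polyfun_coord. Qed.

Lemma polymxD p q (M N : V -> 'M[R]_(p, q)) :
  polymx M -> polymx N -> polymx (fun x => M x + N x).
Proof.
by move=> pM pN i j; under eq_fun do rewrite mxE; exact: polyfunD.
Qed.

Lemma polymx_sum p q (I : Type) (r : seq I) (P : pred I)
    (F : I -> V -> 'M[R]_(p, q)) :
  (forall i, P i -> polymx (F i)) -> polymx (fun x => \sum_(i <- r | P i) F i x).
Proof.
move=> pF i j; under eq_fun do rewrite summxE.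
by apply: polyfun_sum => k Pk; exact: pF.
Qed.

Lemma polymxM p q r (M : V -> 'M[R]_(p, q)) (N : V -> 'M[R]_(q, r)) :
  polymx M -> polymx N -> polymx (fun x => M x *m N x).
Proof.
move=> pM pN i j; under eq_fun do rewrite mxE.
by apply: polyfun_sum => k _; exact: polyfunM.
Qed.

Lemma polymxT p q (M : V -> 'M[R]_(p, q)) : polymx M -> polymx (fun x => (M x)^T).
Proof. by move=> pM i j; under eq_fun do rewrite mxE; exact: pM. Qed.

Lemma polymxZ p q (c : V -> R) (M : V -> 'M[R]_(p, q)) :
  polyfun c -> polymx M -> polymx (fun x => c x *: M x).
Proof. by move=> pc pM i j; under eq_fun do rewrite mxE; exact: polyfunM. Qed.

Lemma polymx_exp (M : V -> 'M[R]_n) k : polymx M -> polymx (fun x => M x ^+ k).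
Proof.
move=> pM; elim: k => [|k IHk]; first exact: polymx_cst.
by under eq_fun do rewrite exprS; exact: polymxM.
Qed.

Lemma polymx_differentiable p q (M : V -> 'M[R]_(p, q)) x :
  polymx M -> differentiable M x.
Proof.
by move=> pM; apply: differentiable_mx => i j; exact: polyfun_differentiable.
Qed.

Lemma polymx_derivableP p q (M : V -> 'M[R]_(p, q)) x v :
  polymx M -> is_derive x v M ('D_v M x).
Proof.
by move=> pM; apply/derivableP/diff_derivable/polymx_differentiable.
Qed.

Lemma derive_polymxE p q (M : V -> 'M[R]_(p, q)) x v i j :
  polymx M -> ('D_v M x) i j = 'D_v (fun y => M y i j) x.
Proof. by move=> /(polymx_derivableP x v)/is_derive_mxP/(_ i j) [_ <-]. Qed.

Lemma polymx_derive p q (M : V -> 'M[R]_(p, q)) v : polymx M -> polymx ('D_v M).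
Proof.
move=> pM i j; rewrite (_ : (fun _ => _) = 'D_v (fun y => M y i j)).
  exact: polyfun_derive.
by apply/funext => x; rewrite derive_polymxE.
Qed.

Lemma polymx_deriveC p q (M : V -> 'M[R]_(p, q)) v w :
  polymx M -> 'D_v ('D_w M) = 'D_w ('D_v M).
Proof.
move=> pM; apply/funext => x; apply/matrixP => i j.
have E u : (fun y => ('D_u M y) i j) = 'D_u (fun y => M y i j).
  by apply/funext => y; exact: derive_polymxE.
have E2 u u' : ('D_u ('D_u' M) x) i j = 'D_u ('D_u' (fun y => M y i j)) x.
  apply: etrans (congr1 (fun F => 'D_u F x) (E u')).
  exact: (derive_polymxE _ _ _ _ (polymx_derive u' pM)).
apply: (etrans (E2 v w)); apply: etrans (esym (E2 w v)).
exact: (congr1 (fun F => F x) (polyfun_deriveC v w (pM i j))).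
Qed.

Lemma derive_linear (W : normedModType R) (F : V -> W) x v :
  differentiable F x -> 'D_v F x = \sum_i v i 0 *: 'D_(basis_vec R i) F x.
Proof.
move=> dF; rewrite deriveE// [v in LHS]matrix_sum_delta linear_sum.
apply: eq_bigr => i _; rewrite big_ord1 linearZ/= deriveE//.
Qed.

Lemma jacobian_mxE (f : V -> V) x v :
  differentiable f x -> jacobian_mx f x *m v = 'D_v f x.
Proof.
move=> df; rewrite derive_linear//; apply/matrixP => i j; rewrite !mxE summxE.
apply: eq_bigr => k _; rewrite !mxE (ord1 j) mulrC; congr (_ * _).
have /is_derive_mxP/(_ i 0) [_] := derivableP (diff_derivable (v := basis_vec R k) df).
by [].
Qed.

Lemma is_derive_diff_comp (W : normedModType R) (F : V -> W) (f : V -> V) x v :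
  differentiable F (f x) -> differentiable f x ->
  is_derive x v (F \o f) ('D_('D_v f x) F (f x)).
Proof.
move=> dF df; have dFf : differentiable (F \o f) x by exact: differentiable_comp.
apply: DeriveDef; first exact: diff_derivable.
apply: (etrans (deriveE v dFf)).
apply: (etrans (congr1 (fun h => h v) (diff_comp df dF))) => /=.
exact: esym (etrans (deriveE _ dF) (congr1 _ (deriveE v df))).
Qed.

End PolynomialFunctions.

(** * Nilpotent brackets and unipotent matrices *)

Section BracketAlgebra.
Variables (R : realType) (n : nat) (mu : 'cV[R]_n -> 'cV[R]_n -> 'cV[R]_n).
Local Notation V := 'cV[R]_n.
Hypothesis skew_mu : skew_bilinear mu.
Implicit Types (x y v w : V) (M : 'M[R]_n).

Lemma bracket_linearr x a u v : mu x (a *: u + v) = a *: mu x u + mu x v.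
Proof. by have [lr _ _] := skew_mu; exact: lr. Qed.

Lemma bracket_linearl y a u v : mu (a *: u + v) y = a *: mu u y + mu v y.
Proof. by have [_ ll _] := skew_mu; exact: ll. Qed.

Lemma bracketC x y : mu y x = - mu x y.
Proof. by have [_ _ sk] := skew_mu. Qed.

Lemma bracket0r x : mu x 0 = 0.
Proof.
have := bracket_linearr x (-1) 0 0.
by rewrite !scaleN1r oppr0 addr0 addNr.
Qed.

Lemma bracket0l x : mu 0 x = 0.
Proof. by rewrite bracketC bracket0r oppr0. Qed.

Lemma bracketDr x u v : mu x (u + v) = mu x u + mu x v.
Proof. by have := bracket_linearr x 1 u v; rewrite !scale1r. Qed.

Lemma bracketDl x u v : mu (u + v) x = mu u x + mu v x.
Proof. by have := bracket_linearl x 1 u v; rewrite !scale1r. Qed.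

Lemma bracketZr x a u : mu x (a *: u) = a *: mu x u.
Proof. by have := bracket_linearr x a u 0; rewrite !addr0 bracket0r addr0. Qed.

Lemma bracketZl x a u : mu (a *: u) x = a *: mu u x.
Proof. by have := bracket_linearl x a u 0; rewrite !addr0 bracket0l addr0. Qed.

Lemma bracketxx x : mu x x = 0.
Proof.
have /eqP := bracketC x x; rewrite -addr_eq0 -mulr2n => /eqP E.
apply/matrixP => i j; have /matrixP/(_ i j) := E; rewrite !mxE => E'.
by lra.
Qed.

Lemma bracket_sumr x (I : Type) (r : seq I) (P : pred I) (F : I -> V) :
  mu x (\sum_(i <- r | P i) F i) = \sum_(i <- r | P i) mu x (F i).
Proof.
by elim/big_rec2 : _ => [|i u v _ <-]; [exact: bracket0r|rewrite bracketDr].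
Qed.

Lemma bracket_suml y (I : Type) (r : seq I) (P : pred I) (F : I -> V) :
  mu (\sum_(i <- r | P i) F i) y = \sum_(i <- r | P i) mu (F i) y.
Proof.
by elim/big_rec2 : _ => [|i u v _ <-]; [exact: bracket0l|rewrite bracketDl].
Qed.

Lemma col_sum_basis v : v = \sum_i v i 0 *: basis_vec R i.
Proof.
by rewrite [LHS]matrix_sum_delta; apply: eq_bigr => i _; rewrite big_ord1.
Qed.

Lemma ad_mul x v : ad mu x *m v = mu x v.
Proof.
rewrite [v in RHS]col_sum_basis bracket_sumr; apply/matrixP => i j.
rewrite !mxE summxE; apply: eq_bigr => k _.
by rewrite bracketZr !mxE (ord1 j) mulrC.
Qed.

Lemma bracket_expand x y :
  mu x y = \sum_i \sum_j (x i 0 * y j 0) *: mu (basis_vec R i) (basis_vec R j).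
Proof.
rewrite {1}(col_sum_basis x) bracket_suml; apply: eq_bigr => i _.
rewrite bracketZl {1}(col_sum_basis y) bracket_sumr scaler_sumr.
by apply: eq_bigr => j _; rewrite bracketZr scalerA.
Qed.

Lemma polymx_bracket (F G : V -> V) :
  polymx F -> polymx G -> polymx (fun z => mu (F z) (G z)).
Proof.
move=> pF pG; under eq_fun do rewrite bracket_expand.
apply: polymx_sum => i _; apply: polymx_sum => j _.
by apply: polymxZ; [exact: polyfunM|exact: polymx_cst].
Qed.

Lemma is_derive_bracket (U : normedModType R) (F G : U -> V) (z e : U) dF dG :
  is_derive z e F dF -> is_derive z e G dG ->
  is_derive z e (fun t => mu (F t) (G t)) (mu dF (G z) + mu (F z) dG).
Proof.
move=> dFz dGz; rewrite (_ : (fun _ => _) =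
    fun t => \sum_i F t i 0 *: mu (basis_vec R i) (G t)); last first.
  apply/funext => t; rewrite {1}(col_sum_basis (F t)) bracket_suml.
  by apply: eq_bigr => i _; rewrite bracketZl.
rewrite {1}(col_sum_basis dF) [X in _ + mu X dG]col_sum_basis !bracket_suml -big_split/=.
apply: is_derive_bigsum => i _; rewrite !bracketZl.
(* With the bracket written as [ad] times a vector and the coordinate as a scalar matrix, each
   summand is a matrix product and the product rule applies. *)
under eq_fun do rewrite -ad_mul -mul_scalar_mx.
rewrite -!ad_mul -!mul_scalar_mx.
apply: is_derive_mulmx; last exact: is_derive_mulmxl.
apply/is_derive_mxP => k l.
under eq_fun do rewrite mxE; rewrite mxE.
have [_|_] := eqVneq k l; last by under eq_fun do rewrite mulr0n; exact: is_derive_cst.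
under eq_fun do rewrite mulr1n; rewrite mulr1n.
by move/is_derive_mxP : dFz.
Qed.

Lemma foldr_bracket_linear s a u v :
  foldr mu (a *: u + v) s = a *: foldr mu u s + foldr mu v s.
Proof. by elim: s => //= x s ->; rewrite bracket_linearr. Qed.

Lemma foldr_bracket0 s : foldr mu 0 s = 0.
Proof. by elim: s => //= x s ->; rewrite bracket0r. Qed.

(** [kills j] is the [j]-th term of the upper central series. *)
Definition kills j v := forall s, size s = j -> foldr mu v s = 0.

Lemma kills_lin j a u v : kills j u -> kills j v -> kills j (a *: u + v).
Proof.
by move=> ku kv s sj; rewrite foldr_bracket_linear ku// kv// scaler0 addr0.
Qed.

Lemma kills0 j : kills j 0.
Proof. by move=> s _; exact: foldr_bracket0. Qed.

Lemma killsD j u v : kills j u -> kills j v -> kills j (u + v).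
Proof. by move=> ku kv; have := kills_lin 1 ku kv; rewrite scale1r. Qed.

Lemma killsZ j a u : kills j u -> kills j (a *: u).
Proof. by move=> ku; have := kills_lin a ku (@kills0 j); rewrite addr0. Qed.

Lemma kills_sum j (I : Type) (r : seq I) (P : pred I) (F : I -> V) :
  (forall i, P i -> kills j (F i)) -> kills j (\sum_(i <- r | P i) F i).
Proof.
by move=> kF; apply: (big_ind (kills j)); [exact: kills0|exact: killsD|].
Qed.

Lemma killsS j v : kills j v -> kills j.+1 v.
Proof. by move=> kv [|x s]//= [sj]; rewrite kv// bracket0r. Qed.

Lemma kills_bracketr j x v : kills j.+1 v -> kills j (mu x v).
Proof.
by move=> kv s sj; have := kv (rcons s x); rewrite size_rcons sj foldr_rcons; apply.
Qed.

Lemma kills_bracketl j x v : kills j.+1 v -> kills j (mu v x).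
Proof. by move=> /(kills_bracketr x); rewrite [mu v x]bracketC -scaleN1r; exact: killsZ. Qed.

(** Endomorphisms pushing the upper central series down by one step. They are closed under sums and
    products, and for a nilpotent bracket they are nilpotent; trace identities and unipotency
    statements below all come from this class. *)
Definition lowers M := forall j v, kills j.+1 v -> kills j (M *m v).

Lemma lowersD M N : lowers M -> lowers N -> lowers (M + N).
Proof.
by move=> lM lN j v kv; rewrite mulmxDl; apply: killsD; [exact: lM|exact: lN].
Qed.

Lemma lowers0 : lowers 0.
Proof. by move=> j v _; rewrite mul0mx; exact: kills0. Qed.

Lemma lowersN M : lowers M -> lowers (- M).
Proof. by move=> lM j v kv; rewrite mulNmx -scaleN1r; apply/killsZ/lM. Qed.

Lemma lowersM M N : lowers M -> lowers N -> lowers (M *m N).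
Proof. by move=> lM lN j v kv; rewrite -mulmxA; apply/lM/killsS/lN. Qed.

Lemma lowers_ad x : lowers (ad mu x).
Proof. by move=> j v kv; rewrite ad_mul; exact: kills_bracketr. Qed.

Lemma lowers_nilpotent M k :
  (forall v, kills k v) -> lowers M -> M ^+ k = 0.
Proof.
move=> kk lM; suff Mv v : M ^+ k *m v = 0.
  by apply/matrixP => i j; have /matrixP/(_ i 0) := Mv (basis_vec R j);
    rewrite -colE !mxE.
(* [kills 0 w] says [w = 0] (take the empty word), so the case [i = k], [j = 0] is the claim. *)
suff /(_ k 0%N) : forall i j w, kills (i + j) w -> kills j (M ^+ i *m w).
  by move=> /(_ v); rewrite addn0 => /(_ (kk v))/(_ [::])/=; apply.
elim=> [|i IHi] j w kw; first by rewrite expr0 mul1mx.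
rewrite exprS -mulmxE -mulmxA; apply: lM; apply: IHi.
by rewrite addnS -addSn.
Qed.

End BracketAlgebra.

(** * Nilpotent matrices: trace, orthogonal unipotents, geometric sums *)

Section NilpotentMatrices.
Variables (R : realType) (n : nat).
Implicit Types (Z : 'M[R]_n).

(** Over polynomials [X - Z] divides [X^k - Z^k = X^k]. By determinants the characteristic
    polynomial divides [X^(k n)], so it is [X^n], whose coefficient of degree [n - 1] is minus the
    trace. *)
Lemma nilpotent_trace0 Z k : Z ^+ k = 0 -> \tr Z = 0.
Proof.
move=> Zk0; have [n0|n_gt0] := posnP n.
  by rewrite /mxtrace big1// => -[i lti]; exfalso; rewrite n0 in lti.
pose f : 'M[R]_n -> 'M[{poly R}]_n := map_mx (@polyC R).
have fX m : f (Z ^+ m) = f Z ^+ m.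
  elim: m => [|m IHm]; first by rewrite !expr0 /f map_mx1.
  by rewrite !exprS -!mulmxE -IHm; exact: map_mxM.
have cXZ : GRing.comm ('X%:M) (f Z) by rewrite /GRing.comm -!mulmxE scalar_mxC.
have fac := subrXX_comm k cXZ; rewrite -fX Zk0 /f map_mx0 subr0 in fac.
have XkM : ('X%:M : 'M[{poly R}]_n) ^+ k = ('X ^+ k)%:M.
  elim: k {Zk0 fac} => // m IHm; rewrite !exprS IHm -mulmxE -scalar_mxM//.
have dvd : char_poly Z %| 'X ^+ (k * n).
  apply/dvdpP; exists (\det (\sum_(i < k) 'X%:M ^+ (k.-1 - i) * f Z ^+ i)).
  by rewrite mulrC -det_mulmx mulmxE -fac XkM det_scalar exprM.
move: dvd; rewrite -['X]subr0 -polyC0 => /dvdp_exp_XsubCP[m _].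
rewrite polyC0 subr0 eqp_monic ?char_poly_monic ?monicXn// => /eqP cE.
have := size_char_poly Z; rewrite cE size_polyXn => -[mn].
have := char_poly_trace Z n_gt0; rewrite cE mn coefXn ltn_eqF ?prednK//.
by move/eqP; rewrite eq_sym oppr_eq0 => /eqP.
Qed.

Lemma gram_eq0 m p (M : 'M[R]_(m, p)) : M^T *m M = 0 -> M = 0.
Proof.
move=> M0; apply/matrixP => i j; have /matrixP/(_ j j) := M0; rewrite !mxE.
under eq_bigr do rewrite mxE -expr2.
move/eqP; rewrite psumr_eq0 => [/allP/(_ i)|? _]; last exact: sqr_ge0.
by rewrite mem_index_enum sqrf_eq0 => /(_ isT)/eqP.
Qed.

(** As [(1 + Z)^T] is the inverse of [1 + Z], it commutes with [Z] and
    [Z^T = - (1 + Z)^T *m Z], so [(Z ^+ m)^T *m Z ^+ m] is a multiple of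
    [Z ^+ (m + m)]. *)
Lemma unipotent_orthogonal Z k :
  Z ^+ k = 0 -> (1%:M + Z)^T *m (1%:M + Z) = 1%:M -> Z = 0.
Proof.
move=> Zk0 QQ; set Q := 1%:M + Z in QQ.
have QQ' := mulmx1C QQ.
have QZ : Q *m Z = Z *m Q by rewrite mulmxDl mulmxDr mul1mx mulmx1.
have ZQ : GRing.comm (- Q^T) Z.
  rewrite /GRing.comm -!mulmxE mulNmx mulmxN; congr (- _).
  by rewrite -[LHS]mulmx1 -QQ' !mulmxA -[_ *m Z *m Q]mulmxA -QZ mulmxA QQ mul1mx.
have ZT : Z^T = - Q^T * Z.
  apply/eqP; rewrite -mulmxE mulNmx -addr_eq0; apply/eqP.
  have -> : Z^T = Q^T - 1%:M by rewrite [Q^T]linearD/= trmx1 addrC addKr.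
  have -> : Z = Q - 1%:M by rewrite addrC addKr.
  by rewrite mulmxBr QQ mulmx1 -[1%:M - Q^T]opprB subrr.
have ZTX m : (Z ^+ m)^T = Z^T ^+ m.
  elim: m => [|m IHm]; first by rewrite !expr0 trmx1.
  by rewrite exprSr -mulmxE trmx_mul IHm exprS mulmxE.
(* For [m > 0] one has [m + m >= m.+1], so [Z ^+ m] has zero Gram matrix; the exponent descends from
   [k] to 1. *)
have step m : (0 < m)%N -> Z ^+ m.+1 = 0 -> Z ^+ m = 0.
  move=> m_gt0 Zm; apply: gram_eq0; rewrite ZTX ZT exprMn_comm// mulmxE -mulrA.
  rewrite -exprD; have -> : (m + m = m.+1 + m.-1)%N.
    by case: m m_gt0 {Zm} => // m _; rewrite addSn addnS.
  by rewrite exprD Zm mul0r mulr0.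
case: k Zk0 => [/(congr1 (mulmx Z))|k]; first by rewrite expr0 mulmx1 mulmx0.
by elim: k => [|k IHk]; [rewrite expr1|move=> /step -/(_ isT)].
Qed.

Lemma geometric_inverse Z k : Z ^+ k = 0 ->
  (1%:M - Z) *m (\sum_(i < k) Z ^+ i) = 1%:M.
Proof.
move=> Zk; have := subrX1 Z k; rewrite Zk sub0r => E; rewrite mulmxE.
by rewrite -opprB mulNr -E opprK.
Qed.

End NilpotentMatrices.

(** * Dynkin words *)

Section HomogeneousDerivative.
Variables (R : realType) (U W : normedModType R).

(** The difference quotient at 0 along [w] is that of [t |-> t ^+ s *: c], so only degree one
    survives. This extracts the words linear in one letter. *)
Lemma derive_homogeneous (F : U -> W) (w : U) (c : W) s :
  (forall t : R, F (t *: w) = t ^+ s *: c) -> 'D_w F 0 = (s == 1)%N%:R *: c.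
Proof.
move=> Fw; have -> : 'D_w F 0 = 'D_1 (fun t : R => t ^+ s *: c) 0.
  have E : (fun h : R => h^-1 *: (F (h *: w + 0) - F 0)) =
      (fun h => h^-1 *: ((h * 1 + 0 : R) ^+ s *: c - (0 : R) ^+ s *: c)).
    apply/funext => h; rewrite !addr0 Fw -[X in F X](scale0r w) Fw.
    by rewrite mulr1.
  exact: (congr1 (fun g : R -> W => lim (g @ 0^')) E).
have dX : is_derive (0 : R) 1 (fun t : R => t ^+ s : R) (s == 1)%N%:R.
  have := derivableP (@exprn_derivable R s 0 1); rewrite exp_derive.
  case: s {Fw} => [|[|s]]; rewrite /GRing.scale/= mulr1 ?mul0r ?expr0 ?mulr1//.
  by rewrite expr0n mulr0.
have d0 : differentiable (fun t : R => t ^+ s : R) 0.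
  by apply/derivable1_diffP; case: dX.
rewrite (deriveE _ (differentiableZl c d0)).
apply: (etrans (congr1 (fun h => h 1) (diffZl c d0))) => /=.
by rewrite -(deriveE (1 : R^o) d0); case: dX => _ ->.
Qed.

End HomogeneousDerivative.

(** * Splitting the Dynkin series by degree *)

Section BCH.
Variables (R : realType) (n : nat) (mu : 'cV[R]_n -> 'cV[R]_n -> 'cV[R]_n).
Local Notation V := 'cV[R]_n.
Implicit Types (x y v w : V) (W : seq bool).
Local Notation expo k := {ffun 'I_k -> 'I_n.+1 * 'I_n.+1}.

(** Words over two letters, [false] for x and [true] for y, so that lengths and letter counts do not
    depend on the vectors substituted. *)
Definition bword k (f : expo k) : seq bool :=
  flatten [seq nseq (f i).1 false ++ nseq (f i).2 true | i <- enum 'I_k].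

Definition bracket_word x y W : V :=
  nested_bracket mu [seq if b then y else x | b <- W].

Definition blocks k (f : expo k) : bool := [forall i, 0 < (f i).1 + (f i).2]%N.

Definition dynkin_coef k (f : expo k.+1) : R :=
  (-1) ^+ k / (k.+1%:R * (\sum_i ((f i).1 + (f i).2))%N%:R
               * (\prod_i ((f i).1`! * (f i).2`!))%N%:R).

(** The terms with [k.+1] blocks whose word length satisfies [P]; [pred1 d] isolates total degree
    [d] in x and y. *)
Definition dynkin_part (P : pred nat) k x y : V :=
  \sum_(f : expo k.+1 | blocks f && P (size (bword f)))
    dynkin_coef f *: bracket_word x y (bword f).

Lemma bch_words x y : bch mu x y = \sum_(k < n) dynkin_part xpredT k x y.
Proof.
apply: eq_bigr => k _; apply: eq_big => [f|f _]; first by rewrite andbT.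
congr (_ *: nested_bracket mu _).
rewrite map_flatten -map_comp; congr flatten; apply: eq_map => i /=.
by rewrite map_cat !map_nseq.
Qed.

Lemma size_bword k (f : expo k) :
  size (bword f) = (\sum_i ((f i).1 + (f i).2))%N.
Proof.
rewrite size_flatten /shape -map_comp sumnE big_map big_enum/=.
by apply: eq_bigr => i _; rewrite size_cat !size_nseq.
Qed.

Lemma blocks_size k (f : expo k) : blocks f -> (k <= size (bword f))%N.
Proof.
move=> /forallP bf; rewrite size_bword -[X in (X <= _)%N]card_ord -sum1_card.
by apply: leq_sum => i _; exact: bf.
Qed.

Lemma dynkin_part0 (P : pred nat) k x y :
  (forall s, P s -> (s <= k)%N) -> dynkin_part P k x y = 0.
Proof.
move=> Pk; rewrite /dynkin_part big_pred0// => f.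
apply/negbTE/negP => /andP[/blocks_size kf /Pk fk].
by have := leq_trans kf fk; rewrite ltnn.
Qed.

Lemma bword1 (f : expo 1) :
  bword f = nseq (f ord0).1 false ++ nseq (f ord0).2 true.
Proof. by rewrite /bword enum_ordSl enum_ord0/= cats0. Qed.

Hypothesis skew_mu : skew_bilinear mu.

Lemma bracket_wordZ a b x y W : W != [::] ->
  bracket_word (a *: x) (b *: y) W =
  (a ^+ count negb W * b ^+ count id W) *: bracket_word x y W.
Proof.
rewrite /bracket_word; case: W => //= c W _; elim: W c => [|d W IHW] c /=.
  by case: c; rewrite /= ?addn0 ?add0n ?expr0 ?expr1 ?mul1r ?mulr1.
rewrite IHW bracketZr//; case: c; rewrite /= ?bracketZl// scalerA; congr (_ *: _).
  by rewrite !exprD expr1; ring.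
by rewrite !exprD expr1; ring.
Qed.

(** The innermost bracket has two proportional entries. *)
Lemma bracket_word_const z W x y : (1 < size W)%N ->
  (forall b, exists a : R, (if b then y else x) = a *: z) ->
  bracket_word x y W = 0.
Proof.
rewrite /bracket_word; case: W => [|b [|c W]]//= _ xyz.
elim: W b c => [|d W IHW] b c /=; last first.
  by rewrite IHW bracket0r.
have [a1 ->] := xyz b; have [a2 ->] := xyz c.
by rewrite bracketZl// bracketZr// bracketxx// !scaler0.
Qed.

Lemma sum_expo1 (P : pred (expo 1)) (F : expo 1 -> V) :
  \sum_(f | P f) F f = \sum_(p | P [ffun=> p]) F [ffun=> p].
Proof.
rewrite (reindex (fun p => [ffun=> p]))//=.
exists (fun f : expo 1 => f ord0) => [p _|f _]; first by rewrite ffunE.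
by apply/ffunP => i; rewrite ffunE (ord1 i).
Qed.

Lemma blocks1 p : blocks ([ffun=> p] : expo 1) = (0 < p.1 + p.2)%N.
Proof.
apply/forallP/idP => [/(_ ord0)|p0 i]; first by rewrite ffunE.
by rewrite ffunE.
Qed.

Lemma dynkin_part_linear x y : (0 < n)%N -> dynkin_part (pred1 1%N) 0 x y = x + y.
Proof.
move=> n_gt0; rewrite /dynkin_part sum_expo1.
(* The exponents of the words x and y; [inord 1] has value 1 because [0 < n]. *)
pose a : 'I_n.+1 * 'I_n.+1 := (inord 1, ord0).
pose b : 'I_n.+1 * 'I_n.+1 := (ord0, inord 1).
have ab : b != a.
  by apply/eqP => -[/(congr1 val)]; rewrite /= inordK.
rewrite (eq_bigl (fun p => (p == a) || (p == b))); last first.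
  move=> p; rewrite blocks1 bword1 !ffunE size_cat !size_nseq /=.
  apply/andP/orP => [[_ /eqP]|[|] /eqP ->]; last 2 first.
  - by rewrite /= inordK.
  - by rewrite /= inordK.
  case: p => [[[|[|r]] lr] [[|[|s]] ls]]//= _; [right|left];
    by apply/eqP; congr pair; apply/val_inj; rewrite /= ?inordK.
rewrite (bigD1 a) ?eqxx//= (big_pred1 b); last first.
  move=> p /=; case: (eqVneq p a) => [->|_] /=; rewrite ?andbF ?andbT//.
  by rewrite eq_sym (negbTE ab).
rewrite /dynkin_coef !big_ord1 !bword1 !ffunE /= inordK//= /bracket_word/=.
by rewrite !expr0 !mul1r invr1 !scale1r.
Qed.

(** A single block of length two is xx, xy or yy; the brackets of xx and yy vanish, and xy has
    coefficient 1 over 1 * 2 * 1. *)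
Lemma dynkin_part_quadratic0 x y : (0 < n)%N ->
  dynkin_part (pred1 2%N) 0 x y = 2^-1 *: mu x y.
Proof.
move=> n_gt0; rewrite /dynkin_part sum_expo1.
pose c : 'I_n.+1 * 'I_n.+1 := (inord 1, inord 1).
rewrite (bigD1 c)/=; last first.
  by rewrite blocks1 bword1 !ffunE size_cat !size_nseq /= inordK.
rewrite big1 => [|p]; last first.
  rewrite blocks1 bword1 !ffunE size_cat !size_nseq => /andP[/andP[_ /eqP p2]] pc.
  apply/eqP; rewrite scaler_eq0; apply/orP; right.
  case: p pc p2 => [[[|[|[|r]]] lr] [[|[|[|s]]] ls]] //= /eqP pc _.
  - by rewrite /bracket_word/= bracketxx.
  - by case: pc; congr pair; apply/val_inj; rewrite /= inordK.
  - by rewrite /bracket_word/= bracketxx.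
rewrite /dynkin_coef !big_ord1 !bword1 !ffunE /= inordK//= /bracket_word/= addr0.
by rewrite expr0 !mul1r mulr1.
Qed.

(** Reversing a two-letter word changes the sign of its bracket. *)
Lemma dynkin_part_quadratic1 x y : dynkin_part (pred1 2%N) 1 x y = 0.
Proof.
pose i1 : 'I_2 := lift ord0 ord0.
pose swap (f : expo 2) : expo 2 := [ffun i => if i == ord0 then f i1 else f ord0].
have swapK : involutive swap.
  move=> f; apply/ffunP => i; rewrite !ffunE.
  by case: (unliftP ord0 i) => [j ->|->]; rewrite ?(ord1 j).
have sw0 f : swap f ord0 = f i1 by rewrite ffunE.
have sw1 f : swap f i1 = f ord0 by rewrite ffunE.
pose w (p : 'I_n.+1 * 'I_n.+1) := nseq p.1 false ++ nseq p.2 true.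
have wE f : bword f = w (f ord0) ++ w (f i1).
  by rewrite /bword !enum_ordSl enum_ord0/= cats0.
have bE (f : expo 2) : blocks f = (0 < size (w (f ord0)))%N && (0 < size (w (f i1)))%N.
  have sE p : size (w p) = (p.1 + p.2)%N by rewrite size_cat !size_nseq.
  rewrite !sE; apply/forallP/andP => [bf|[b0 b1] i]; first by split; exact: bf.
  by case: (unliftP ord0 i) => [j ->|->]; rewrite ?(ord1 j).
have cE f : dynkin_coef (swap f) = dynkin_coef f.
  rewrite /dynkin_coef !big_ord_recl !big_ord0 !sw0 !sw1 !addn0 !muln1.
  by rewrite addnC [in X in _ * X%:R]mulnC.
clearbody w; suff E : dynkin_part (pred1 2%N) 1 x y = - dynkin_part (pred1 2%N) 1 x y.
  move/eqP: E; rewrite -addr_eq0 -mulr2n -scaler_nat scaler_eq0 pnatr_eq0 /=.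
  by move=> /eqP.
rewrite {1}/dynkin_part (reindex_inj (inv_inj swapK)) /= -sumrN.
apply: eq_big => f; rewrite !bE !wE sw0 sw1 !size_cat; first by rewrite /= addnC [X in X && _]andbC.
move=> /andP[/andP[p0 q0] /eqP pq].
rewrite cE -scalerN; congr (_ *: _).
have [p1 q1] : size (w (f ord0)) = 1%N /\ size (w (f i1)) = 1%N by lia.
case: (w (f ord0)) p1 => [|a [|? ?]]// _; case: (w (f i1)) q1 => [|b [|? ?]]// _.
by rewrite /bracket_word/= bracketC.
Qed.

Lemma dynkin_part_quadratic k x y : (0 < k)%N -> dynkin_part (pred1 2%N) k x y = 0.
Proof.
case: k => [|[|k]]// _; first exact: dynkin_part_quadratic1.
by apply: dynkin_part0 => s /eqP ->.
Qed.

Definition bch_high x y : V := \sum_(k < n) dynkin_part (fun s => 2 < s)%N k x y.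

(** Order two is where the bracket appears, and it is the order that the structure equation sees;
    the remainder has only words of length at least three. *)
Lemma bchE x y : bch mu x y = x + y + 2^-1 *: mu x y + bch_high x y.
Proof.
(* In dimension zero the sum over [k < n] is empty, and any two vectors agree. *)
have [n0|n_gt0] := posnP n.
  by apply/matrixP => -[i lti]; exfalso; rewrite n0 in lti.
rewrite bch_words /bch_high.
have dE k : dynkin_part xpredT k x y = dynkin_part (pred1 1%N) k x y +
    dynkin_part (pred1 2%N) k x y + dynkin_part (fun s => 2 < s)%N k x y.
  rewrite /dynkin_part (bigID (fun f => size (bword f) == 1)%N) /= -addrA; congr (_ + _).
    by apply: eq_bigl => f; rewrite andbT.
  rewrite (bigID (fun f => size (bword f) == 2)%N) /=; congr (_ + _).
    by apply: eq_bigl => f; rewrite andbT -andbA; case: eqP => //= ->; rewrite ?andbT.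
  apply: eq_bigl => f; rewrite andbT -andbA; case bf: (blocks f) => //=.
  by have := blocks_size bf; case: (size _) => [|[|[|s]]].
under eq_bigr do rewrite dE.
rewrite !big_split /=; congr (_ + _ + _).
  rewrite (bigD1 (Ordinal n_gt0))//= dynkin_part_linear// big1 ?addr0// => i i0.
  apply: dynkin_part0 => s /eqP ->; rewrite lt0n; apply: contra i0 => /eqP i0.
  by apply/eqP/val_inj.
rewrite (bigD1 (Ordinal n_gt0))//= dynkin_part_quadratic0// big1 ?addr0// => i i0.
apply: dynkin_part_quadratic; rewrite lt0n; apply: contra i0 => /eqP i0.
by apply/eqP/val_inj.
Qed.

End BCH.

(** * The left-invariant frame *)

Section Frame.
Variables (R : realType) (n : nat) (mu : 'cV[R]_n -> 'cV[R]_n -> 'cV[R]_n).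
Local Notation V := 'cV[R]_n.
Hypothesis skew_mu : skew_bilinear mu.
Implicit Types (x y v w : V) (W : seq bool).

Lemma polymx_bracket_word (F G : V -> V) W :
  polymx F -> polymx G -> polymx (fun z => bracket_word mu (F z) (G z) W).
Proof.
move=> pF pG; case: W => [|b W]; first exact: polymx_cst.
elim: W b => [|c W IHW] b; first by case: b.
apply: polymx_bracket => //; last exact: IHW.
by case: b.
Qed.

Lemma polymx_bch_high (F G : V -> V) :
  polymx F -> polymx G -> polymx (fun z => bch_high mu (F z) (G z)).
Proof.
move=> pF pG; apply: polymx_sum => k _; apply: polymx_sum => f _.
by apply: polymxZ; [exact: polyfun_cst|exact: polymx_bracket_word].
Qed.

Lemma polymx_bch x : polymx (bch mu x).
Proof.
rewrite (funext (bchE skew_mu x)).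
have pid := @polymx_id R n; have px := @polymx_cst R n _ _ x.
apply: polymxD; [apply: polymxD; [exact: polymxD|]|exact: polymx_bch_high].
by apply: polymxZ; [exact: polyfun_cst|exact: polymx_bracket].
Qed.

Lemma bch_high_const z x y :
  (forall b : bool, exists a : R, (if b then y else x) = a *: z) ->
  bch_high mu x y = 0.
Proof.
move=> xyz; apply: big1 => k _; apply: big1 => f /andP[_ f2].
by rewrite (bracket_word_const _ (ltnW f2) xyz)// scaler0.
Qed.

Lemma bch0r x : bch mu x 0 = x.
Proof.
rewrite bchE// (bracket0r skew_mu) scaler0 !addr0 (@bch_high_const x) ?addr0// => -[].
  by exists 0; rewrite scale0r.
by exists 1; rewrite scale1r.
Qed.

Lemma bch0l y : bch mu 0 y = y.
Proof.
rewrite bchE// (bracket0l skew_mu) scaler0 addr0 add0r (@bch_high_const y) ?addr0// => -[].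
  by exists 1; rewrite scale1r.
by exists 0; rewrite scale0r.
Qed.

(** The derivative replaces one letter y by [v], and each bracket around [v] lowers its level in the
    upper central series. A one-letter word merely preserves the level, so the induction carries
    both statements. *)
Lemma derive_bracket_word_kills x y v W :
  (forall j, kills mu j v -> kills mu j ('D_v (bracket_word mu x ^~ W) y)) /\
  ((1 < size W)%N -> forall j, kills mu j.+1 v ->
    kills mu j ('D_v (bracket_word mu x ^~ W) y)).
Proof.
have pid := @polymx_id R n; have px := @polymx_cst R n _ _ x.
case: W => [|b W].
  split=> // j _; have -> : 'D_v (bracket_word mu x ^~ [::]) y = 0.
    exact: (derive_cst (0 : V)).
  exact: kills0.
elim: W b => [|c W IHW] b.
  split=> // j kv; case: b.
    by have -> : 'D_v (bracket_word mu x ^~ [:: true]) y = v by exact: (derive_id y).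
  have -> : 'D_v (bracket_word mu x ^~ [:: false]) y = 0 by exact: (derive_cst x).
  exact: kills0.
suff low j : kills mu j.+1 v ->
    kills mu j ('D_v (bracket_word mu x ^~ [:: b, c & W]) y).
  by split=> [j kv|_ j kv]; apply: low => //; exact: killsS.
move=> kv.
have pl : polymx (fun y => if b then y else x) by case: b {IHW}.
have dl := polymx_derivableP y v pl.
have dW := polymx_derivableP y v (polymx_bracket_word (c :: W) px pid).
have [_ ->] := is_derive_bracket skew_mu dl dW.
apply: killsD => //; last by apply: kills_bracketr => //; exact: (IHW c).1.
apply: kills_bracketl => //; case: b {IHW pl dl}.
  by rewrite derive_id.
by rewrite derive_cst; exact: kills0.
Qed.

Lemma is_derive_bch x y v : is_derive y v (bch mu x)
  (v + 2^-1 *: mu x v + 'D_v (bch_high mu x) y).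
Proof.
rewrite (funext (bchE skew_mu x)).
have pid := @polymx_id R n; have px := @polymx_cst R n _ _ x.
have dh := polymx_derivableP y v (polymx_bch_high px pid).
have d1 := is_deriveD (is_derive_cst x y v) (is_derive_id y v).
have d2 := is_deriveZ 2^-1 (is_derive_bracket skew_mu (is_derive_cst x y v) (is_derive_id y v)).
by have := is_deriveD (is_deriveD d1 d2) dh; rewrite add0r (bracket0l skew_mu) add0r.
Qed.

Lemma is_derive_bch_high x y v : is_derive y v (bch_high mu x)
  (\sum_(k < n) \sum_(f : {ffun 'I_k.+1 -> 'I_n.+1 * 'I_n.+1} |
      blocks f && (2 < size (bword f))%N)
    dynkin_coef R f *: 'D_v (bracket_word mu x ^~ (bword f)) y).
Proof.
have pid := @polymx_id R n; have px := @polymx_cst R n _ _ x.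
apply: is_derive_bigsum => k _; apply: is_derive_bigsum => f _.
apply: is_deriveZ; exact: (polymx_derivableP _ _ (polymx_bracket_word _ px pid)).
Qed.

Lemma jacobian_bch x y v : jacobian_mx (bch mu x) y *m v =
  v + 2^-1 *: mu x v + 'D_v (bch_high mu x) y.
Proof.
rewrite jacobian_mxE; last exact/polymx_differentiable/polymx_bch.
by case: (is_derive_bch x y v).
Qed.

(** Apart from [v] itself, every term of the derivative along [v] contains [v] inside at least one
    bracket. *)
Lemma jacobian_bch_lowers x y : lowers mu (jacobian_mx (bch mu x) y - 1%:M).
Proof.
move=> j v kv; rewrite mulmxBl mul1mx jacobian_bch.
have E a b : v + a + b - v = a + b by rewrite addrAC [v + a]addrC addrK.
rewrite E.
apply: killsD => //; first by apply: killsZ => //; exact: kills_bracketr.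
case: (is_derive_bch_high x y v) => _ ->.
apply: kills_sum => // k _; apply: kills_sum => // f /andP[_ f2].
apply: killsZ => //; have [_ low] := derive_bracket_word_kills x y v (bword f).
exact: low (ltnW f2) _ kv.
Qed.

(** The columns of [frame x] are the values at [x] of the left-invariant vector
    fields extending the canonical basis. *)
Definition frame x : 'M[R]_n := jacobian_mx (bch mu x) 0.

(** At [y = 0] a word contributes to the derivative exactly when it contains y once, by
    [derive_homogeneous]; its derivative along [w] is the word with [w] for y. *)
Lemma frame_mul x w : frame x *m w = w + 2^-1 *: mu x w +
  \sum_(k < n) \sum_(f : {ffun 'I_k.+1 -> 'I_n.+1 * 'I_n.+1} |
      blocks f && (2 < size (bword f))%N)
    (dynkin_coef R f * (count id (bword f) == 1)%N%:R) *: bracket_word mu x w (bword f).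
Proof.
rewrite /frame jacobian_bch; congr (_ + _).
case: (is_derive_bch_high x 0 w) => _ ->.
apply: eq_bigr => k _; apply: eq_bigr => f /andP[_ f2].
rewrite -scalerA; congr (_ *: _); apply: derive_homogeneous => t.
rewrite -[X in bracket_word mu X](scale1r x) bracket_wordZ//.
  by rewrite expr1n mul1r scale1r.
by case: (bword f) f2.
Qed.

Lemma polymx_frame : polymx frame.
Proof.
have pid := @polymx_id R n.
suff pe j : polymx (fun x => frame x *m basis_vec R j).
  by move=> i j; have := pe j i 0; under eq_fun do rewrite -colE mxE.
have pj := @polymx_cst R n _ _ (basis_vec R j).
under eq_fun do rewrite frame_mul.
apply: polymxD; first apply: polymxD => //.
  by apply: polymxZ; [exact: polyfun_cst|exact: polymx_bracket].
apply: polymx_sum => k _; apply: polymx_sum => f _.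
by apply: polymxZ; [exact: polyfun_cst|exact: polymx_bracket_word].
Qed.

Lemma frame_lowers x : lowers mu (frame x - 1%:M).
Proof. exact: jacobian_bch_lowers. Qed.

Lemma mx_ext (M N : 'M[R]_n) : (forall v, M *m v = N *m v) -> M = N.
Proof.
move=> MN; apply/matrixP => i j; have /matrixP/(_ i 0) := MN (basis_vec R j).
by rewrite -!colE !mxE.
Qed.

Lemma frame0 : frame 0 = 1%:M.
Proof.
apply: mx_ext => v; rewrite /frame jacobian_mxE.
  by rewrite (funext bch0l) derive_id mul1mx.
exact/polymx_differentiable/polymx_bch.
Qed.

(** Only words of length at least three contribute to the sum in [frame_mul];
    those linear in [w] are at least quadratic in [x]. *)
Lemma derive_frame0 v w : 'D_v frame 0 *m w = 2^-1 *: mu v w.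
Proof.
have pid := @polymx_id R n; have pw := @polymx_cst R n _ _ w.
have dA := is_derive_mulmxr w (polymx_derivableP 0 v polymx_frame).
apply: (is_derive_uniq dA); under eq_fun do rewrite frame_mul.
have d2 := is_derive_scale 2^-1
  (is_derive_bracket skew_mu (is_derive_id 0 v) (is_derive_cst w (0 : V) v)).
rewrite (bracket0r skew_mu) addr0 in d2.
have d3 := is_derive_add (is_derive_cst w (0 : V) v) d2.
rewrite add0r in d3.
rewrite -[2^-1 *: mu v w]addr0; apply: (is_derive_add d3).
rewrite -[X in is_derive _ _ _ X](@big1 V 0 +%R 'I_n (index_enum _) xpredT (fun=> 0))//.
apply: is_derive_bigsum => k _.
rewrite -[X in is_derive _ _ _ X](@big1 V 0 +%R _ (index_enum _)
  (fun f : {ffun 'I_k.+1 -> 'I_n.+1 * 'I_n.+1} => blocks f && (2 < size (bword f))%N) (fun=> 0))//.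
apply: is_derive_bigsum => f /andP[_ f2].
have pW := polymx_bracket_word (bword f) pid pw.
have := is_derive_scale (dynkin_coef R f * (count id (bword f) == 1)%N%:R)
  (polymx_derivableP 0 v pW).
case: eqP => f1; last by rewrite mulr0 scale0r.
suff -> : 'D_v (fun x => bracket_word mu x w (bword f)) 0 = 0 by rewrite scaler0.
rewrite (@derive_homogeneous _ _ _ _ _ (bracket_word mu v w (bword f)) (count negb (bword f))).
  have /eqP := count_predC id (bword f); rewrite f1 => /eqP fs.
  suff -> : (count negb (bword f) == 1)%N = false by rewrite scale0r.
  by apply/eqP => f1'; rewrite -fs (_ : count _ _ = 1%N) in f2.
move=> t; rewrite -[w in LHS](scale1r w) bracket_wordZ//; last by case: (bword f) f2.
by rewrite expr1n mulr1.
Qed.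

Lemma invmx_unitl (h : 'M[R]_n) x : h \in unitmx -> invmx h *m (h *m x) = x.
Proof. by move=> hu; rewrite mulmxA mulVmx// mul1mx. Qed.

(** [h] is an isomorphism from [mu] onto [bracket_act h mu], so it carries each nested bracket to
    the corresponding one. *)
Lemma bch_act (h : 'M[R]_n) x y : h \in unitmx ->
  bch (bracket_act h mu) (h *m x) (h *m y) = h *m bch mu x y.
Proof.
move=> hu; rewrite mulmx_sumr; apply: eq_bigr => k _.
rewrite mulmx_sumr; apply: eq_bigr => f _; rewrite -scalemxAr; congr (_ *: _).
rewrite (_ : dynkin_word (h *m x) (h *m y) f = map (mulmx h) (dynkin_word x y f)).
  case: dynkin_word => [|a s]/=; first by rewrite mulmx0.
  elim: s a => [//|b s IHs] a /=.
  by rewrite IHs /bracket_act !invmx_unitl.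
rewrite map_flatten -map_comp; congr flatten; apply: eq_map => i /=.
by rewrite map_cat !map_nseq.
Qed.

Lemma skew_bilinear_act (h : 'M[R]_n) : skew_bilinear (bracket_act h mu).
Proof.
split=> [x a u v|y a u v|x y]; rewrite /bracket_act.
- by rewrite mulmxDr -scalemxAr (bracket_linearr skew_mu) mulmxDr -scalemxAr.
- by rewrite mulmxDr -scalemxAr (bracket_linearl skew_mu) mulmxDr -scalemxAr.
- by rewrite (bracketC skew_mu) mulmxN.
Qed.

End Frame.

(** The differential at 0 of [bch_act]: left translations of the two brackets are conjugate under
    [h]. *)
Lemma frame_act (R : realType) (n : nat) (mu : 'cV[R]_n -> 'cV[R]_n -> 'cV[R]_n)
    (h : 'M[R]_n) (x : 'cV[R]_n) :
  skew_bilinear mu -> h \in unitmx ->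
  frame (bracket_act h mu) (h *m x) = h *m frame mu x *m invmx h.
Proof.
move=> skew_mu hu; have skew_h := skew_bilinear_act skew_mu h.
apply: mx_ext => v; rewrite -!mulmxA.
have pb x' : polymx (bch mu x') by exact: polymx_bch.
have db : differentiable (bch mu x) 0 by exact/polymx_differentiable/pb.
rewrite !jacobian_mxE//; last exact/polymx_differentiable/polymx_bch.
have -> : bch (bracket_act h mu) (h *m x) =
    (fun z => h *m bch mu x z) \o mulmx (invmx h).
  by apply/funext => y /=; rewrite -bch_act// mulmxA mulmxV// mul1mx.
have pF : polymx (fun z => h *m bch mu x z) by apply: polymxM => //; exact: polymx_cst.
have pf : polymx (mulmx (invmx h) : 'cV[R]_n -> 'cV[R]_n).
  by apply: polymxM; [exact: polymx_cst|exact: polymx_id].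
have [_ ->] := @is_derive_diff_comp _ _ _ (fun z => h *m bch mu x z) (mulmx (invmx h)) 0 v
   (polymx_differentiable _ pF) (polymx_differentiable _ pf).
have [_ ->] := is_derive_mulmxl (invmx h) (is_derive_id (0 : 'cV[R]_n) v).
rewrite mulmx0.
by have [_ ->] := is_derive_mulmxl h (polymx_derivableP 0 (invmx h *m v) (pb x)).
Qed.

(** * Products and inverses of unipotent matrices *)

Section UnipotentMatrices.
Variables (R : realType) (n : nat) (mu : 'cV[R]_n -> 'cV[R]_n -> 'cV[R]_n).
Hypothesis skew_mu : skew_bilinear mu.
Implicit Types (M N : 'M[R]_n).

Lemma unip_mul M N : lowers mu (M - 1%:M) -> lowers mu (N - 1%:M) ->
  lowers mu (M *m N - 1%:M).
Proof.
move=> lM lN; rewrite (_ : _ - _ = (M - 1%:M) *m (N - 1%:M) + (M - 1%:M) + (N - 1%:M)).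
  by apply: lowersD => //; apply: lowersD => //; exact: lowersM.
by rewrite mulmxBr mulmx1 mulmxBl mul1mx; apply/matrixP => i j; rewrite !mxE; ring.
Qed.

Lemma lowers_geometric M k : lowers mu M -> lowers mu (\sum_(i < k.+1) M ^+ i - 1%:M).
Proof.
move=> lM; rewrite big_ord_recl expr0 addrC addKr.
apply: (big_ind (lowers mu)) => [|? ?|i _]; [exact: lowers0|exact: lowersD|].
rewrite lift0; elim: (i : nat) => [|j IHj]; first by rewrite expr1.
by rewrite exprS -mulmxE; exact: lowersM.
Qed.

End UnipotentMatrices.

(** * The Maurer-Cartan equation *)

Section StructureEquation.
Variables (R : realType) (n : nat) (mu : 'cV[R]_n -> 'cV[R]_n -> 'cV[R]_n).
Local Notation V := 'cV[R]_n.
Hypothesis skew_mu : skew_bilinear mu.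
Hypothesis nilp_mu : nilpotent_bracket mu.
Implicit Types (x y v w : V).
Local Notation A := (frame mu).

(** The Maurer-Cartan form in coordinates: [coframe x *m v] is the value at 0 of the left-invariant
    field equal to [v] at [x]. *)
Definition coframe x : 'M[R]_n := invmx (A x).
Local Notation theta := coframe.

Lemma nilp_kills : exists k, forall v, kills mu k v.
Proof. by have [k km] := nilp_mu; exists k => v s sk; exact: km. Qed.

Lemma lowers_nilp M : lowers mu M -> exists k, M ^+ k = 0.
Proof. by move=> lM; have [k kk] := nilp_kills; exists k; exact: lowers_nilpotent. Qed.

Lemma mxtrace_lowers M : lowers mu M -> \tr M = 0.
Proof. by move=> /lowers_nilp[k]; exact: nilpotent_trace0. Qed.

(** One nilpotency index serves all [x], so the inverse of the frame is a fixed polynomial in the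
    frame, which is why the coframe is polynomial in [x]. *)
Lemma frame_geometric : exists k, forall x,
  A x *m (\sum_(i < k.+1) (1%:M - A x) ^+ i) = 1%:M.
Proof.
have [k kk] := nilp_kills; exists k => x.
have lx : lowers mu (1%:M - A x).
  by rewrite -opprB; apply: lowersN => //; exact: frame_lowers.
rewrite -{1}[A x](subKr 1%:M); apply: geometric_inverse.
by rewrite exprS (lowers_nilpotent kk lx) mulr0.
Qed.

Lemma frame_unit x : A x \in unitmx.
Proof. by have [k /(_ x)/mulmx1_unit[]] := frame_geometric. Qed.

Lemma coframeE : exists k, forall x, theta x = \sum_(i < k.+1) (1%:M - A x) ^+ i.
Proof.
have [k Ak] := frame_geometric; exists k => x; apply: (can_inj (mulKmx (frame_unit x))).
by rewrite Ak mulmxV// frame_unit.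
Qed.

Lemma mul_frame_coframe x : A x *m theta x = 1%:M.
Proof. by rewrite mulmxV// frame_unit. Qed.

Lemma mul_coframe_frame x : theta x *m A x = 1%:M.
Proof. by rewrite mulVmx// frame_unit. Qed.

Lemma coframe0 : theta 0 = 1%:M.
Proof. by rewrite /coframe frame0// invmx1. Qed.

Lemma coframe_lowers x : lowers mu (theta x - 1%:M).
Proof.
have [k ->] := coframeE; apply: lowers_geometric => //.
by rewrite -opprB; apply: lowersN => //; exact: frame_lowers.
Qed.

Lemma polymx_coframe : polymx theta.
Proof.
have [k /funext ->] := coframeE; apply: polymx_sum => i _; apply: polymx_exp.
apply: polymxD; first exact: polymx_cst.
under eq_fun do rewrite -scaleN1r.
by apply: polymxZ; [exact: polyfun_cst|exact: polymx_frame].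
Qed.

Lemma polymx_jacobian (f : V -> V) : polymx f -> polymx (jacobian_mx f).
Proof.
move=> pf i j; under eq_fun do rewrite mxE.
exact: (polyfun_derive _ (pf i 0)).
Qed.

Hypothesis inv_mu : left_invariant mu (bracket_metric mu).

(** The comparison matrix [Q] below is unipotent for every nilpotent bracket, and
    orthogonal because left translations preserve [bracket_metric mu]; hence it is
    the identity, and no associativity of [bch] is needed. *)
Lemma frame_invariant x y : jacobian_mx (bch mu x) y *m A y = A (bch mu x y).
Proof.
set J := jacobian_mx _ _; set z := bch mu x y.
pose Q := theta z *m J *m A y.
have lQ : lowers mu (Q - 1%:M).
  apply: unip_mul => //; last exact: frame_lowers.
  by apply: unip_mul => //; [exact: coframe_lowers|exact: jacobian_bch_lowers].
have [k Qk] := lowers_nilp lQ.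
have QQ : (1%:M + (Q - 1%:M))^T *m (1%:M + (Q - 1%:M)) = 1%:M.
  rewrite addrC subrK; have := congr1 (fun g : V -> 'M[R]_n => g y) (inv_mu x).
  have gE u : bracket_metric mu u = (theta u)^T *m theta u.
    by rewrite /bracket_metric /left_metric mulmx1.
  rewrite /pullback !gE -/J -/z => inv.
  rewrite /Q !trmx_mul -!mulmxA; rewrite -!mulmxA in inv.
  have := congr1 (fun M => (A y)^T *m (M *m A y)) inv; rewrite -!mulmxA => ->.
  by rewrite mul_coframe_frame mulmx1 -trmx_mul mul_coframe_frame trmx1.
have /eqP := unipotent_orthogonal Qk QQ; rewrite subr_eq0 => /eqP Q1.
by rewrite -[A z]mulmx1 -Q1 /Q !mulmxA mul_frame_coframe mul1mx.
Qed.

(** Differentiating [frame_invariant] at [y = 0] produces the second derivative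
    of [bch mu x], which is symmetric. *)
Lemma frame_structure x v w :
  'D_(A x *m v) A x *m w - 'D_(A x *m w) A x *m v = A x *m mu v w.
Proof.
have pL := polymx_bch skew_mu x; have pJ := polymx_jacobian pL.
have pA := polymx_frame skew_mu.
have dL y u : 'D_u (bch mu x) y = jacobian_mx (bch mu x) y *m u.
  by rewrite jacobian_mxE//; exact: polymx_differentiable.
pose D u u' : V := 'D_u ('D_u' (bch mu x)) 0.
have Dsym u u' : D u u' = D u' u.
  exact: (congr1 (fun F : V -> V => F 0) (polymx_deriveC u u' pL)).
(* Both sides of [frame_invariant], applied to [u'] and differentiated at [y = 0] along [u]: the
   chain rule gives the left member, the product rule a second derivative of [bch mu x] plus the
   term from [derive_frame0]. *)
have key u u' : 'D_(A x *m u) A x *m u' = D u u' + A x *m (2^-1 *: mu u u').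
  have L : is_derive (0 : V) u (fun y => A (bch mu x y) *m u')
      ('D_(A x *m u) A x *m u').
    have := is_derive_diff_comp u (polymx_differentiable (bch mu x 0) pA)
      (polymx_differentiable 0 pL).
    by rewrite dL bch0r// => /(is_derive_mulmxr u').
  apply: (is_derive_uniq L).
  rewrite (_ : (fun y => _) = fun y => jacobian_mx (bch mu x) y *m (A y *m u')); last first.
    by apply/funext => y; rewrite mulmxA frame_invariant.
  have dA : is_derive (0 : V) u (fun y => A y *m u') (2^-1 *: mu u u').
    by rewrite -(derive_frame0 skew_mu); exact: is_derive_mulmxr (polymx_derivableP 0 u pA).
  have JA := is_derive_mulmx (polymx_derivableP 0 u pJ) dA.
  have dJ : D u u' = 'D_u (jacobian_mx (bch mu x)) 0 *m (A 0 *m u').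
    rewrite (frame0 skew_mu) mul1mx.
    have [_ <-] := is_derive_mulmxr u' (polymx_derivableP 0 u pJ).
    by apply: (congr1 (fun F => 'D_u F 0)); apply/funext => y; exact: dL.
  by rewrite dJ; exact: JA.
apply: (etrans (congr2 (fun a b => a - b) (key v w) (key w v))) => /=.
rewrite (bracketC skew_mu v w) scalerN mulmxN.
move: (D v w) (D w v) (Dsym v w) => D1 _ <-; set M := A x *m (_ *: _).
rewrite (_ : D1 + M - (D1 - M) = M + M); last by apply/matrixP => i j; rewrite !mxE; ring.
rewrite /M -mulmxDr -scalerDl; congr (_ *m _).
by rewrite -[RHS]scale1r; congr (_ *: _); lra.
Qed.

(** The Maurer-Cartan equation, dual to [frame_structure] through the derivative of an inverse
    matrix. *)
Lemma coframe_structure x v w :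
  'D_v theta x *m w - 'D_w theta x *m v = - mu (theta x *m v) (theta x *m w).
Proof.
have dt u : 'D_u theta x = - (theta x *m 'D_u A x *m theta x).
  by apply: derive_inverse mul_coframe_frame _ _; exact/polymx_derivableP/polymx_coframe
   || exact/polymx_derivableP/polymx_frame.
apply: (etrans (congr2 (fun M N => M *m w - N *m v) (dt v) (dt w))).
have := frame_structure x (theta x *m v) (theta x *m w).
have AT u : A x *m (theta x *m u) = u by rewrite mulmxA mul_frame_coframe mul1mx.
rewrite !AT; move: ('D_v A x) ('D_w A x) => Dv Dw E.
rewrite !mulNmx -opprD -!mulmxA -mulmxN -mulmxDr E; congr (- _).
by rewrite mulmxA mul_coframe_frame mul1mx.
Qed.

End StructureEquation.

(** * Curvature of left-invariant metrics *)

Section InnerProducts.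
Variables (R : realType) (n : nat).

Lemma inner_product_unit (P : 'M[R]_n) : inner_product P -> P \in unitmx.
Proof.
move=> [PT P0]; rewrite -row_free_unit -kermx_eq0; apply/rowV0P => u /sub_kermxP uP.
apply/eqP; rewrite -trmx_eq0; apply/negP => /negP /P0.
by rewrite trmxK uP mul0mx mxE ltxx.
Qed.

Lemma inner_product_gram (h : 'M[R]_n) : h \in unitmx -> inner_product (h^T *m h).
Proof.
move=> hu; split=> [|v v0]; first by rewrite trmx_mul trmxK.
rewrite mulmxA -trmx_mul -mulmxA mxE lt_def psumr_eq0 => [|i _]; last first.
  by rewrite mxE -expr2 sqr_ge0.
rewrite sumr_ge0 ?andbT => [|i _]; last by rewrite mxE -expr2 sqr_ge0.
apply/negP => /allP hv0; move/negP: v0; apply; apply/eqP.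
rewrite -(mulKmx hu v) (_ : h *m v = 0) ?mulmx0//; apply/matrixP => i j.
have := hv0 i; rewrite mem_index_enum (ord1 j) => /(_ isT).
by rewrite [X in X * _]mxE -expr2 sqrf_eq0 => /eqP ->; rewrite mxE.
Qed.

Lemma inner_product1 : inner_product (1%:M : 'M[R]_n).
Proof. by have := inner_product_gram (unitmx1 R n); rewrite trmx1 mulmx1. Qed.

Lemma inner_product_congr (P M : 'M[R]_n) :
  inner_product P -> M \in unitmx -> inner_product (M^T *m P *m M).
Proof.
move=> [PT P0] Mu; split=> [|v v0]; first by rewrite !trmx_mul trmxK PT mulmxA.
rewrite !mulmxA -trmx_mul -mulmxA; apply: P0; apply: contra v0 => /eqP Mv.
by rewrite -(mulKmx Mu v) Mv mulmx0.
Qed.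

End InnerProducts.

(** * The Levi-Civita connection in the left-invariant frame *)

Section LeviCivita.
Variables (R : realType) (n : nat) (mu : 'cV[R]_n -> 'cV[R]_n -> 'cV[R]_n).
Local Notation V := 'cV[R]_n.
Hypothesis skew_mu : skew_bilinear mu.
Variable P : 'M[R]_n.
Implicit Types (u v w : V).

Lemma ad_linear a u v : ad mu (a *: u + v) = a *: ad mu u + ad mu v.
Proof.
apply: mx_ext => w; rewrite mulmxDl -scalemxAl !ad_mul//.
exact: bracket_linearl.
Qed.

Lemma trmx_ad_linear a u v : (ad mu (a *: u + v))^T = a *: (ad mu u)^T + (ad mu v)^T.
Proof. by rewrite ad_linear; exact: linearP. Qed.

(** Koszul's formula for left-invariant vector fields. *)
Definition nabla u v : V := 2^-1 *:
  (mu u v - invmx P *m ((ad mu u)^T *m P *m v + (ad mu v)^T *m P *m u)).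

Definition conn u : 'M[R]_n := \matrix_(i, j) nabla u (basis_vec R j) i 0.

Definition curv u v : 'M[R]_n :=
  conn u *m conn v - conn v *m conn u - conn (mu u v).

Definition frame_ricci : 'M[R]_n :=
  \matrix_(b, d) \sum_a curv (basis_vec R a) (basis_vec R b) a d.

Lemma nabla_linearr u a v w : nabla u (a *: v + w) = a *: nabla u v + nabla u w.
Proof.
rewrite /nabla bracket_linearr// trmx_ad_linear !mulmxDl -!scalemxAl.
rewrite !mulmxDr -!scalemxAr; apply/matrixP => i j; rewrite !mxE; ring.
Qed.

Lemma nabla_linearl v a u w : nabla (a *: u + w) v = a *: nabla u v + nabla w v.
Proof.
rewrite /nabla bracket_linearl// trmx_ad_linear !mulmxDl -!scalemxAl.
rewrite !mulmxDr -!scalemxAr; apply/matrixP => i j; rewrite !mxE; ring.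
Qed.

Lemma conn_mul u v : conn u *m v = nabla u v.
Proof.
have n0 w : nabla w 0 = 0.
  by have := nabla_linearr w (-1) 0 0; rewrite scaleN1r oppr0 addr0 scaleN1r addNr.
have nD w : {morph nabla w : x y / x + y}.
  by move=> x y; have := nabla_linearr w 1 x y; rewrite !scale1r.
rewrite [v in RHS]col_sum_basis (big_morph _ (nD u) (n0 u)).
apply/matrixP => i j; rewrite !mxE summxE; apply: eq_bigr => k _.
have := nabla_linearr u (v k 0) (basis_vec R k) 0; rewrite !addr0 n0 addr0 => ->.
by rewrite !mxE (ord1 j) mulrC.
Qed.

Lemma conn_linear a u v : conn (a *: u + v) = a *: conn u + conn v.
Proof.
by apply: mx_ext => w; rewrite mulmxDl -scalemxAl !conn_mul nabla_linearl.
Qed.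

Lemma conn0 : conn 0 = 0.
Proof.
by have := conn_linear (-1) 0 0; rewrite scaleN1r oppr0 addr0 scaleN1r addNr.
Qed.

Lemma connD u v : conn (u + v) = conn u + conn v.
Proof. by have := conn_linear 1 u v; rewrite !scale1r. Qed.

Lemma connZ a u : conn (a *: u) = a *: conn u.
Proof. by have := conn_linear a u 0; rewrite !addr0 conn0 addr0. Qed.

Lemma connN u : conn (- u) = - conn u.
Proof. by rewrite -scaleN1r connZ scaleN1r. Qed.

Lemma conn_expand u : conn u = \sum_a u a 0 *: conn (basis_vec R a).
Proof.
rewrite {1}(col_sum_basis u) (big_morph _ connD conn0).
by apply: eq_bigr => a _; rewrite connZ.
Qed.

Lemma curv_linearl v a u w : curv (a *: u + w) v = a *: curv u v + curv w v.
Proof.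
rewrite /curv bracket_linearl// !conn_linear mulmxDl mulmxDr -scalemxAl -scalemxAr.
move: (_ *m _) (_ *m _) (_ *m _) (_ *m _) (conn (mu u v)) (conn (mu w v)).
move=> M1 M2 M3 M4 M5 M6.
by apply/matrixP => i j; rewrite ![in LHS]mxE ![in RHS]mxE; ring.
Qed.

Lemma curvC u v : curv v u = - curv u v.
Proof.
rewrite /curv (bracketC skew_mu u v) connN.
move: (_ *m _) (_ *m _) (conn (mu u v)) => M1 M2 M3.
by apply/matrixP => i j; rewrite ![in LHS]mxE ![in RHS]mxE; ring.
Qed.

Lemma curv_expandl u v : curv u v = \sum_a u a 0 *: curv (basis_vec R a) v.
Proof.
have c0 : curv 0 v = 0.
  by have := curv_linearl v (-1) 0 0; rewrite scaleN1r oppr0 addr0 scaleN1r addNr.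
have cD : {morph curv^~ v : x y / x + y}.
  by move=> x y; have := curv_linearl v 1 x y; rewrite !scale1r.
rewrite {1}(col_sum_basis u) (big_morph _ cD c0); apply: eq_bigr => a _.
by have := curv_linearl v (u a 0) (basis_vec R a) 0; rewrite !addr0 c0 addr0.
Qed.

Lemma curv_expandr u v : curv u v = \sum_b v b 0 *: curv u (basis_vec R b).
Proof.
rewrite curvC curv_expandl -sumrN; apply: eq_bigr => b _.
by rewrite [in RHS]curvC scalerN.
Qed.

Lemma conn_torsion u v : conn u *m v - conn v *m u = mu u v.
Proof.
rewrite !conn_mul /nabla (bracketC skew_mu u v) [X in _ - 2^-1 *: (_ - _ *m X)]addrC.
by apply/matrixP => i j; rewrite !mxE; lra.
Qed.

Hypothesis inner_P : inner_product P.

(** Compatibility with the metric: [P] is constant in the left-invariant frame, so its covariant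
    derivative vanishes exactly when [conn u] is skew for [P]. Koszul's formula exhibits this
    skewness. *)
Lemma conn_metric u : P *m conn u = - (P *m conn u)^T.
Proof.
have [PT _] := inner_P; have Pu := inner_product_unit inner_P.
pose B v w := (v^T *m P *m w) 0 0.
have Bsym v w : B v w = B w v.
  by rewrite /B -[in LHS](trmxK (v^T *m P *m w)) mxE !trmx_mul trmxK PT mulmxA.
have Bad v w z : (v^T *m ((ad mu w)^T *m P *m z)) 0 0 = B (mu w v) z.
  by rewrite /B -(ad_mul skew_mu) trmx_mul !mulmxA.
have E v w : B w (nabla u v) = 2^-1 * (B w (mu u v) - B (mu u w) v - B (mu v w) u).
  rewrite {1}/B /nabla -scalemxAr mulmxBr.
  rewrite [w^T *m P *m (invmx P *m _)]mulmxA mulmxK// mulmxDr.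
  rewrite [LHS]mxE [X in _ * X]mxE [X in _ * (_ + X)]mxE [X in _ * (_ - X)]mxE.
  by rewrite !Bad opprD addrA.
apply/matrixP => i j; rewrite [in RHS]mxE [in RHS]mxE.
have entry k l : (P *m conn u) k l = B (basis_vec R k) (nabla u (basis_vec R l)).
  rewrite /B -conn_mul mulmxA -[_ *m P *m conn u]mulmxA /basis_vec trmx_delta.
  by rewrite -rowE -colE [RHS]mxE [RHS]mxE.
rewrite !entry !E; set ei := basis_vec R i; set ej := basis_vec R j.
have -> : B (mu ei ej) u = - B (mu ej ei) u.
  by rewrite (bracketC skew_mu ej) /B linearN !mulNmx mxE.
by rewrite (Bsym ei) (Bsym ej); ring.
Qed.

End LeviCivita.

(** * Curvature in coordinates from curvature in a frame *)

Section FrameCurvature.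
Variables (R : realType) (n : nat) (mu : 'cV[R]_n -> 'cV[R]_n -> 'cV[R]_n).
Local Notation V := 'cV[R]_n.
Local Notation e := (basis_vec R).
Hypothesis skew_mu : skew_bilinear mu.
Variable P : 'M[R]_n.
Hypothesis inner_P : inner_product P.
(** The frame is abstract because the section is applied twice: to [frame mu] with any inner product
    [P], and to [frame mu x *m invmx h] with the identity. *)
Variables (A theta : V -> 'M[R]_n) (dA dth : 'I_n -> V -> 'M[R]_n)
  (ddth : 'I_n -> 'I_n -> V -> 'M[R]_n).
Hypothesis thetaA : forall x, theta x *m A x = 1%:M.
Hypothesis is_dA : forall i x, is_derive x (e i) A (dA i x).
Hypothesis is_dth : forall i x, is_derive x (e i) theta (dth i x).
Hypothesis is_ddth : forall i j x, is_derive x (e i) (dth j) (ddth i j x).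
Hypothesis ddthC : forall i j x, ddth i j x = ddth j i x.
Hypothesis structure_eq : forall i j x,
  dth i x *m e j - dth j x *m e i = - mu (theta x *m e i) (theta x *m e j).
Variables (Gam : V -> 'M[R]_n) (gauge : 'I_n -> V -> 'M[R]_n).
Hypothesis GamE : Gam = conn mu P.
(** The connection matrices of the coordinate frame, obtained by gauge
    transformation from those of the left-invariant frame. *)
Hypothesis gaugeE : forall i x,
  gauge i x = A x *m (dth i x + Gam (theta x *m e i) *m theta x).
Local Notation g := (fun x => (theta x)^T *m P *m theta x).

Let Atheta x : A x *m theta x = 1%:M. Proof. exact/mulmx1C/thetaA. Qed.

Let dAE i x : dA i x = - (A x *m dth i x *m A x).
Proof. exact: derive_inverse Atheta (is_dth i x) (is_dA i x). Qed.

(** The lower indices of the Christoffel symbols commute: the torsion of the frame connection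
    cancels the Maurer-Cartan term. *)
Lemma gauge_sym i j x : gauge i x *m e j = gauge j x *m e i.
Proof.
have E a b : gauge a x *m e b =
    A x *m (dth a x *m e b + Gam (theta x *m e a) *m (theta x *m e b)).
  by rewrite gaugeE -[LHS]mulmxA mulmxDl -[Gam _ *m _ *m _]mulmxA.
rewrite (E i j) (E j i); apply: (congr1 (mulmx (A x))).
apply/eqP; rewrite -subr_eq0; apply/eqP.
have S := structure_eq i j x.
have T : Gam (theta x *m e i) *m (theta x *m e j) - Gam (theta x *m e j) *m (theta x *m e i) =
    mu (theta x *m e i) (theta x *m e j) by rewrite GamE conn_torsion.
rewrite (_ : _ - _ = (dth i x *m e j - dth j x *m e i) +
   (Gam (theta x *m e i) *m (theta x *m e j) - Gam (theta x *m e j) *m (theta x *m e i))).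
  by rewrite S T addNr.
by apply/matrixP => k l; rewrite ![in LHS]mxE ![in RHS]mxE; ring.
Qed.

Lemma entry_mul (M : 'M[R]_n) k j : M k j = (M *m e j) k 0.
Proof. by rewrite -colE mxE. Qed.

(** Metric compatibility in coordinates: the contributions of the connection matrix to the two
    summands are opposite by [conn_metric]. *)
Lemma derive_metric i x : is_derive x (e i) g
  (g x *m gauge i x + (g x *m gauge i x)^T).
Proof.
have [PT _] := inner_P.
have d := is_derive_mulmx (is_derive_mulmxr P (is_derive_trmx (is_dth i x))) (is_dth i x).
suff <- : (dth i x)^T *m P *m theta x + (theta x)^T *m P *m dth i x =
  g x *m gauge i x + (g x *m gauge i x)^T by exact: d.
have gE : g x *m gauge i x = (theta x)^T *m P *m dth i x +
    (theta x)^T *m (P *m Gam (theta x *m e i)) *m theta x.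
  rewrite gaugeE mulmxA -[_ *m theta x *m A x]mulmxA thetaA mulmx1 mulmxDr.
  by rewrite !mulmxA.
have := conn_metric skew_mu inner_P (theta x *m e i); rewrite -GamE gE.
set M := P *m Gam _ => MT; clearbody M.
have -> : ((theta x)^T *m P *m dth i x + (theta x)^T *m M *m theta x)^T =
    (dth i x)^T *m P *m theta x - (theta x)^T *m M *m theta x.
  rewrite [LHS]linearD/= !trmx_mul trmxK PT !mulmxA; congr (_ + _).
  by rewrite [in RHS]MT mulmxN mulNmx opprK.
by rewrite addrC addrACA subrr addr0.
Qed.

Lemma pderiv_metric i x j l : pderiv i (fun y => g y j l) x =
  (g x *m gauge i x) j l + (g x *m gauge i x) l j.
Proof.
have /is_derive_mxP/(_ j l)[_] := derive_metric i x.
by rewrite [in RHS]mxE [in X in _ = _ + X -> _]mxE.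
Qed.

(** Uniqueness of the Levi-Civita connection: [S a l b] is symmetric in [a] and [b], so the
    combination of three derivatives of the metric collapses to twice one value of [S]. *)
Lemma christoffel_gauge k i j x : christoffel g k i j x = gauge i x k j.
Proof.
have gu : g x \in unitmx.
  have [tu _] := mulmx1_unit (thetaA x).
  by rewrite !unitmx_mul unitmx_tr tu inner_product_unit.
pose S a := g x *m gauge a x.
have Ssym a b l : S a l b = S b l a.
  by rewrite entry_mul [RHS]entry_mul -!mulmxA gauge_sym.
rewrite /christoffel -[gauge i x](mulKmx gu) mxE mulr_sumr; apply: eq_bigr => l _.
rewrite !pderiv_metric -/(S i) -/(S j) -/(S l) (Ssym l i j) (Ssym l j i) (Ssym j i l).
rewrite mulrCA; congr (_ * _).
by rewrite (Ssym j l i); lra.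
Qed.

Lemma is_derive_gauge i j x : is_derive x (e i) (gauge j)
  (dA i x *m (dth j x + Gam (theta x *m e j) *m theta x) +
   A x *m (ddth i j x + (Gam (dth i x *m e j) *m theta x +
                         Gam (theta x *m e j) *m dth i x))).
Proof.
rewrite (funext (gaugeE j)); apply: is_derive_mulmx => //; apply: is_derive_add => //.
apply: is_derive_mulmx => //.
have GamX u : Gam u = \sum_a u a 0 *: Gam (e a) by rewrite GamE -conn_expand.
under eq_fun do rewrite GamX.
rewrite [Gam (_ *m _)]GamX; apply: is_derive_bigsum => a _.
apply: is_derive_scalel.
by have /is_derive_mxP/(_ a 0) := is_derive_mulmxr (e j) (is_dth i x).
Qed.

(** Curvature is tensorial: the gauge transformation acts on it by conjugation, its inhomogeneous
    part cancelling. *)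
Lemma riemann_gauge l i j k x : riemann g l i j k x =
  (A x *m curv mu P (theta x *m e i) (theta x *m e j) *m theta x) l k.
Proof.
have cE b a c : christoffel g b a c = fun y => gauge a y b c.
  by apply/funext => y; exact: christoffel_gauge.
rewrite /riemann !cE.
have pd a b m c : pderiv a (fun y => gauge b y m c) x =
    (dA a x *m (dth b x + Gam (theta x *m e b) *m theta x) +
     A x *m (ddth a b x + (Gam (dth a x *m e b) *m theta x +
                           Gam (theta x *m e b) *m dth a x))) m c.
  by have /is_derive_mxP/(_ m c)[_] := is_derive_gauge a b x.
rewrite !pd.
under eq_bigr do rewrite !cE.
rewrite sumrB.
have prod a b : \sum_m gauge a x l m * gauge b x m k = (gauge a x *m gauge b x) l k.
  by rewrite [RHS]mxE.
rewrite !prod.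
(* The first summand on the right is symmetric in [a] and [b], given [ddthC], and disappears on
   antisymmetrizing. In the second, the terms [Gam (dth a x *m e b)] antisymmetrize by the structure
   equation to the term [conn (mu u v)] of [curv]. *)
have half a b : dA a x *m (dth b x + Gam (theta x *m e b) *m theta x) +
     A x *m (ddth a b x + (Gam (dth a x *m e b) *m theta x +
                           Gam (theta x *m e b) *m dth a x)) +
     gauge a x *m gauge b x =
   A x *m (ddth a b x + Gam (theta x *m e b) *m dth a x +
           Gam (theta x *m e a) *m dth b x) +
   A x *m (Gam (dth a x *m e b) +
           Gam (theta x *m e a) *m Gam (theta x *m e b)) *m theta x.
  rewrite dAE !gaugeE; set Ga := Gam (theta x *m e a); set Gb := Gam (theta x *m e b).
  set X := dth b x + _; set T := theta x; set AA := A x.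
  have -> : AA *m (dth a x + Ga *m T) *m (AA *m X) =
      AA *m dth a x *m AA *m X + AA *m Ga *m X.
    rewrite mulmxDr mulmxDl; congr (_ + _); first by rewrite !mulmxA.
    by rewrite !mulmxA -[AA *m Ga *m T *m AA]mulmxA thetaA mulmx1.
  rewrite mulNmx /X !(mulmxDr, mulmxDl) !mulmxA.
  by apply/matrixP => r s; rewrite ![in LHS]mxE ![in RHS]mxE; ring.
have main : (dA i x *m (dth j x + Gam (theta x *m e j) *m theta x) +
     A x *m (ddth i j x + (Gam (dth i x *m e j) *m theta x +
                           Gam (theta x *m e j) *m dth i x)) +
     gauge i x *m gauge j x) -
   (dA j x *m (dth i x + Gam (theta x *m e i) *m theta x) +
     A x *m (ddth j i x + (Gam (dth j x *m e i) *m theta x +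
                           Gam (theta x *m e i) *m dth j x)) +
     gauge j x *m gauge i x) =
   A x *m curv mu P (theta x *m e i) (theta x *m e j) *m theta x.
  have GamB u v : Gam (u - v) = Gam u - Gam v by rewrite GamE connD// connN.
  rewrite (half i j) (half j i) (ddthC j i) /curv -GamE.
  rewrite -[mu _ _]opprK -structure_eq [in Gam (- _)]opprB GamB.
  set Ga := Gam (theta x *m e i); set Gb := Gam (theta x *m e j).
  rewrite !(mulmxDr, mulmxDl, mulmxN, mulNmx) !mulmxA.
  by apply/matrixP => r s; rewrite ![in LHS]mxE ![in RHS]mxE; ring.
rewrite -main; move: (dA i x *m _ + _) (dA j x *m _ + _) (gauge i x *m _) (gauge j x *m _).
by move=> M1 M2 M3 M4; rewrite ![in RHS]mxE; ring.
Qed.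

(** Expanding the curvature in the frame, the contraction of the upper index with the first lower
    one pairs [A] with [theta] and leaves a trace in the frame. *)
Lemma ricci_tensor_frame x :
  ricci_tensor g x = (theta x)^T *m frame_ricci mu P *m theta x.
Proof.
apply/matrixP => j k; rewrite mxE.
pose K a b := curv mu P (e a) (e b).
have thE i a : (theta x *m e i) a 0 = theta x a i by rewrite -colE mxE.
have E i : riemann g i i j k x =
    \sum_b theta x b j * \sum_a theta x a i * (A x *m (K a b *m theta x)) i k.
  rewrite riemann_gauge curv_expandr// mulmx_sumr mulmx_suml summxE.
  apply: eq_bigr => b _; rewrite -scalemxAr -scalemxAl mxE thE; congr (_ * _).
  rewrite curv_expandl// mulmx_sumr mulmx_suml summxE.
  by apply: eq_bigr => a _; rewrite -scalemxAr -scalemxAl mxE thE mulmxA.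
rewrite (eq_bigr _ (fun i _ => E i)) exchange_big -mulmxA mxE; apply: eq_bigr => b _.
rewrite -mulr_sumr mxE; congr (_ * _).
rewrite exchange_big mxE.
transitivity (\sum_a (K a b *m theta x) a k).
  apply: eq_bigr => a _.
  by rewrite -[K a b *m theta x in RHS]mul1mx -(thetaA x) -mulmxA mxE.
under eq_bigr do rewrite mxE.
rewrite exchange_big; apply: eq_bigr => d _; rewrite -mulr_suml; congr (_ * _).
by rewrite mxE.
Qed.

End FrameCurvature.

(** * The Ricci tensor in an orthonormal frame of a nilpotent bracket *)

Section NilpotentRicci.
Variables (R : realType) (n : nat) (mu : 'cV[R]_n -> 'cV[R]_n -> 'cV[R]_n).
Local Notation e := (basis_vec R).
Hypothesis skew_mu : skew_bilinear mu.
Hypothesis nilp_mu : nilpotent_bracket mu.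

Let c (a b m : 'I_n) : R := mu (e a) (e b) m 0.

Let cC a b m : c b a m = - c a b m.
Proof. by rewrite /c (bracketC skew_mu) mxE. Qed.

Let adE a m b : ad mu (e a) m b = c a b m. Proof. by rewrite mxE. Qed.

Let connE a m b :
  conn mu 1%:M (e a) m b = 2^-1 * (c a b m - c a m b - c b m a).
Proof.
rewrite mxE /nabla invmx1 mul1mx !mulmx1 -!colE !mxE /c; ring.
Qed.

Let trace_ad a : \sum_m c a m m = 0.
Proof.
have := mxtrace_lowers nilp_mu (lowers_ad skew_mu (e a)).
by rewrite /mxtrace; under eq_bigr do rewrite adE.
Qed.

Let killing b d : \sum_a \sum_m c b m a * c d a m = 0.
Proof.
apply: etrans (mxtrace_lowers nilp_mu
  (lowersM skew_mu (lowers_ad skew_mu (e b)) (lowers_ad skew_mu (e d)))).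
apply: eq_bigr => a _; rewrite mxE.
by apply: eq_bigr => m _; rewrite !adE.
Qed.

Lemma sum_antisym (F : 'I_n -> 'I_n -> R) :
  (forall a m, F a m + F m a = 0) -> \sum_a \sum_m F a m = 0.
Proof.
move=> FC; have : \sum_a \sum_m F a m + \sum_a \sum_m F a m = 0.
  rewrite [X in _ + X]exchange_big -big_split big1// => a _.
  by rewrite -big_split big1// => m _; exact: FC.
lra.
Qed.

Lemma frame_ricci_bracket : frame_ricci mu 1%:M = bracket_ric mu.
Proof.
apply/matrixP => b d; rewrite [LHS]mxE.
have lhs a : curv mu 1%:M (e a) (e b) a d =
   \sum_m conn mu 1%:M (e a) a m * conn mu 1%:M (e b) m d
   - \sum_m (conn mu 1%:M (e b) a m * conn mu 1%:M (e a) m d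
             + c a b m * conn mu 1%:M (e m) a d).
  rewrite /curv [conn _ _ (mu _ _)](conn_expand skew_mu) [LHS]mxE [X in X + _ = _]mxE.
  rewrite [X in _ - X]big_split.
  rewrite opprD addrA; congr (_ + _ + _).
  - by rewrite mxE.
  - by rewrite [LHS]mxE mxE.
  - by rewrite mxE summxE; congr (- _); apply: eq_bigr => m _; rewrite [LHS]mxE.
under eq_bigr do rewrite lhs.
(* For each [m], the sum of [conn (e a) a m] over [a] is minus the trace of [ad (e m)], so the whole
   first double sum vanishes. *)
rewrite sumrB exchange_big [X in X - _]big1 ?sub0r => [|m _]; last first.
  rewrite -mulr_suml; under eq_bigr do rewrite connE.
  rewrite -mulr_sumr (_ : \sum_a (_ - _) = 0) ?mulr0 ?mul0r//.
  transitivity (- 2 * \sum_a c m a a); last by rewrite trace_ad mulr0.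
  rewrite mulr_sumr; apply: eq_bigr => a _.
  by rewrite (cC m a a) (_ : c a a m = 0); [ring|have := cC a a m; lra].
pose Y a m := conn mu 1%:M (e b) a m * conn mu 1%:M (e a) m d
             + c a b m * conn mu 1%:M (e m) a d.
pose S1 a m := c a b m * c a d m; pose S2 a m := c a m b * c a m d.
pose K a m := c b m a * c d a m.
have S1E : (\sum_i (ad mu (e i))^T *m ad mu (e i)) b d = \sum_a \sum_m S1 a m.
  rewrite summxE; apply: eq_bigr => a _; rewrite mxE; apply: eq_bigr => m _.
  by rewrite [X in X * _]mxE !adE.
have S2E : (\sum_i ad mu (e i) *m (ad mu (e i))^T) b d = \sum_a \sum_m S2 a m.
  rewrite summxE; apply: eq_bigr => a _; rewrite mxE; apply: eq_bigr => m _.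
  by rewrite [X in _ * X]mxE !adE.
rewrite [RHS]mxE [X in _ = X + _]mxE [X in _ = _ + X]mxE S1E S2E.
(* The weights make the summand antisymmetric in [a] and [m], so the double sum is zero. Since the
   sum of [K] is a value of the Killing form, what remains expresses the sum of [- Y] with the
   coefficients [-1/2] and [1/4] of [bracket_ric]. *)
have lin : \sum_a \sum_m (- 1 * Y a m + 2^-1 * S1 a m + - 4^-1 * S2 a m + 2^-1 * K a m) =
    - 1 * (\sum_a \sum_m Y a m) + 2^-1 * (\sum_a \sum_m S1 a m)
    + - 4^-1 * (\sum_a \sum_m S2 a m) + 2^-1 * (\sum_a \sum_m K a m).
  rewrite !mulr_sumr -!big_split; apply: eq_bigr => a _.
  by rewrite !mulr_sumr -!big_split.
have : \sum_a \sum_m (- 1 * Y a m + 2^-1 * S1 a m + - 4^-1 * S2 a m + 2^-1 * K a m) = 0.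
  apply: sum_antisym => a m; rewrite /Y /S1 /S2 /K !connE.
  rewrite (cC b a m) (cC b m a) (cC d a m) (cC d m a) (cC a m b) (cC a m d).
  move: (c b m a) (c b a m) (c d m a) (c d a m) (c a m b) (c a m d) => p q r s t u.
  by field.
rewrite lin (killing b d) mulr0 addr0 => H.
by rewrite -/(\sum_a \sum_m Y a m); lra.
Qed.

End NilpotentRicci.

(** * Left-invariant metrics and their Ricci tensors *)

Section LeftInvariantMetrics.
Variables (R : realType) (n : nat) (mu : 'cV[R]_n -> 'cV[R]_n -> 'cV[R]_n).
Local Notation V := 'cV[R]_n.
Local Notation e := (basis_vec R).
Local Notation A := (frame mu).
Local Notation theta := (coframe mu).
Hypothesis skew_mu : skew_bilinear mu.
Hypothesis nilp_mu : nilpotent_bracket mu.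
Implicit Types (P h : 'M[R]_n) (x y : V).

Lemma nilpotent_act h : h \in unitmx -> nilpotent_bracket (bracket_act h mu).
Proof.
move=> hu; have [k km] := nilp_mu; exists k => s y sk.
have -> : foldr (bracket_act h mu) y s =
    h *m foldr mu (invmx h *m y) [seq invmx h *m x | x <- s].
  elim: s {sk} => [|x s IHs] /=; first by rewrite mulKVmx.
  by rewrite IHs /bracket_act mulKmx.
by rewrite km ?mulmx0// size_map.
Qed.

Lemma left_metricE P x : left_metric mu P x = (theta x)^T *m P *m theta x.
Proof. by []. Qed.

Lemma left_metric0 P : left_metric mu P 0 = P.
Proof. by rewrite left_metricE coframe0// trmx1 mul1mx mulmx1. Qed.

(** Invariance under translation by [x], evaluated at 0, reads [A^T g(x) A = g(0)] with [A] the
    frame at [x], because [bch mu x 0 = x]. *)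
Lemma left_invariantE (g : V -> 'M[R]_n) :
  left_invariant mu g -> g = left_metric mu (g 0).
Proof.
move=> inv_g; apply/funext => x.
rewrite left_metricE -{2}(inv_g x) /pullback bch0r// -/(A x).
rewrite !mulmxA -trmx_mul -mulmxA mul_frame_coframe// trmx1 mul1mx.
by rewrite mulmx1.
Qed.

Lemma riemannian_left_metric P : inner_product P -> riemannian_metric (left_metric mu P).
Proof.
move=> iP; have pt := polymx_coframe skew_mu nilp_mu; split=> [i j|x].
  apply: polyfun_smooth.
  have pT := polymxM (polymxM (polymxT pt) (polymx_cst n P)) pt.
  exact: pT i j.
apply: inner_product_congr => //.
by have /mulmx1_unit[] := mul_coframe_frame skew_mu nilp_mu x.
Qed.

Hypothesis inv_mu : left_invariant mu (bracket_metric mu).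

Lemma left_invariant_left_metric P : left_invariant mu (left_metric mu P).
Proof.
move=> x; apply/funext => y; rewrite /pullback !left_metricE.
(* Left translations preserve the Maurer-Cartan form, by [frame_invariant]. *)
have <- : theta (bch mu x y) *m jacobian_mx (bch mu x) y = theta y.
  rewrite -[LHS]mulmx1 -(mul_frame_coframe skew_mu nilp_mu y) mulmxA.
  rewrite -[X in X *m _]mulmxA frame_invariant// mul_coframe_frame// mul1mx//.
by rewrite trmx_mul !mulmxA.
Qed.

Lemma ricci_left_metric P x : inner_product P ->
  ricci_tensor (left_metric mu P) x = (theta x)^T *m frame_ricci mu P *m theta x.
Proof.
move=> iP; have pA := polymx_frame skew_mu; have pt := polymx_coframe skew_mu nilp_mu.
refine (@ricci_tensor_frame R n mu skew_mu P iP A theta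
  (fun i => 'D_(e i) A) (fun i => 'D_(e i) theta)
  (fun i j => 'D_(e i) ('D_(e j) theta)) _ _ _ _ _ _ (conn mu P) _ erefl (fun i x => erefl) x).
- exact: mul_coframe_frame.
- by move=> i y; exact: polymx_derivableP.
- by move=> i y; exact: polymx_derivableP.
- by move=> i j y; exact/polymx_derivableP/polymx_derive.
- move=> i j y; exact: (congr1 (fun F => F y) (polymx_deriveC (e i) (e j) pt)).
- by move=> i j y; exact: coframe_structure.
Qed.

Lemma left_ricciE P : inner_product P -> left_ricci mu P = frame_ricci mu P.
Proof.
move=> iP; apply: (etrans (ricci_left_metric 0 iP)).
by rewrite coframe0// trmx1 mul1mx mulmx1.
Qed.

(** In the frame [A *m invmx h], which is orthonormal for the left-invariant
    metric [h^T *m h], the structure constants are those of [bracket_act h mu]. *)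
Lemma left_ricci_gram h : h \in unitmx ->
  left_ricci mu (h^T *m h) = h^T *m bracket_ric (bracket_act h mu) *m h.
Proof.
move=> hu; have pA := polymx_frame skew_mu; have pt := polymx_coframe skew_mu nilp_mu.
have skew_h := skew_bilinear_act skew_mu h.
have E : ricci_tensor (fun x => (h *m theta x)^T *m 1%:M *m (h *m theta x)) 0 =
    (h *m theta 0)^T *m frame_ricci (bracket_act h mu) 1%:M *m (h *m theta 0).
  refine (@ricci_tensor_frame R n _ skew_h 1%:M (inner_product1 R n)
    (fun x => A x *m invmx h) (fun x => h *m theta x)
    (fun i x => 'D_(e i) A x *m invmx h) (fun i x => h *m 'D_(e i) theta x)
    (fun i j x => h *m 'D_(e i) ('D_(e j) theta) x) _ _ _ _ _ _ _ _ erefl (fun i x => erefl) 0).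
  - by move=> x; rewrite mulmxA -[h *m _ *m _]mulmxA mul_coframe_frame// mulmx1 mulmxV.
  - by move=> i x; exact/is_derive_mulmxr/polymx_derivableP.
  - by move=> i x; exact/is_derive_mulmxl/polymx_derivableP.
  - by move=> i j x; exact/is_derive_mulmxl/polymx_derivableP/polymx_derive.
  - move=> i j x.
    exact: (congr1 (fun F : V -> 'M[R]_n => h *m F x) (polymx_deriveC (e i) (e j) pt)).
  - move=> i j x; have := coframe_structure skew_mu nilp_mu inv_mu x (e i) (e j).
    move: ('D_(e i) theta x) ('D_(e j) theta x) (theta x) => D1 D2 T D12.
    by rewrite /bracket_act -!mulmxA !mulKmx// -mulmxBr D12 mulmxN.
rewrite /left_ricci.
have -> : left_metric mu (h^T *m h) =
    (fun x => (h *m theta x)^T *m 1%:M *m (h *m theta x)).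
  by apply/funext => x; rewrite left_metricE mulmx1 trmx_mul !mulmxA.
apply: (etrans E); rewrite coframe0// !mulmx1.
by rewrite frame_ricci_bracket//; exact: nilpotent_act.
Qed.

End LeftInvariantMetrics.

(** * Linear differential equations *)

Section TimeInterval.
Variables (R : realType) (K : set R).
Hypothesis timeK : time_interval K.
Implicit Types (f F : R -> R) (a b t : R).

Lemma time_interval0 : K 0. Proof. by case: timeK. Qed.

Lemma time_interval_itv a b t : K a -> K b -> a <= t <= b -> K t.
Proof. by have [_ iK _] := timeK; move=> Ka Kb; exact: iK. Qed.

Lemma time_interval_nbhs t : K t -> nbhs t K.
Proof. by have [oK _ _] := timeK => Kt; exact: open_nbhs_nbhs. Qed.

Lemma time_interval_lt t : K t -> exists2 a, K a & a < t.
Proof.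
move=> /time_interval_nbhs/nbhs_ballP[r /= r0 rK]; exists (t - r / 2); last first.
  by rewrite ltrBlDr ltrDl divr_gt0.
apply: rK; rewrite /ball/= opprB addrC subrK gtr0_norm ?divr_gt0//.
by rewrite ltr_pdivrMr// ltr_pMr// ltr1n.
Qed.

Lemma time_interval_gt t : K t -> exists2 b, K b & t < b.
Proof.
move=> /time_interval_nbhs/nbhs_ballP[r /= r0 rK]; exists (t + r / 2); last first.
  by rewrite ltrDl divr_gt0.
apply: rK; rewrite /ball/= opprD addNKr normrN gtr0_norm ?divr_gt0//.
by rewrite ltr_pdivrMr// ltr_pMr// ltr1n.
Qed.

Definition contK f := forall t, K t -> {for t, continuous f}.

Lemma is_derive_continuous f t df : is_derive t 1 f df -> {for t, continuous f}.
Proof. by move=> [dft _]; exact/differentiable_continuous/derivable1_diffP. Qed.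

Lemma contK_within f a b : contK f -> K a -> K b -> {within `[a, b], continuous f}.
Proof.
move=> fK Ka Kb; apply: continuous_in_subspaceT => t.
by rewrite inE/= in_itv/= => tab; exact/fK/(time_interval_itv Ka Kb).
Qed.

Lemma contK_bounded f a b : contK f -> K a -> K b -> a <= b ->
  exists C, forall t, a <= t <= b -> `|f t| <= C.
Proof.
move=> fK Ka Kb ab.
have nfK : contK (fun t => `|f t|).
  by move=> t Kt; apply: continuous_comp; [exact: fK|exact: norm_continuous].
have [c _ fc] := EVT_max ab (contK_within nfK Ka Kb).
by exists `|f c| => t tab; apply: fc; rewrite in_itv.
Qed.

(** The primitive is the signed integral from 0, so that it is defined on both sides of 0. *)
Lemma primitive f : contK f ->
  exists F, F 0 = 0 /\ forall t, K t -> is_derive t 1 F (f t).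
Proof.
move=> fK; have K0 := time_interval0.
pose I (a b : R) := (\int[lebesgue_measure]_(x in [set` `[a, b]]) f x)%R.
have intf a b : K a -> K b -> lebesgue_measure.-integrable `[a, b] (EFin \o f).
  move=> Ka Kb; apply: continuous_compact_integrable; first exact: segment_compact.
  exact: contK_within.
have addI a b c : K a -> K c -> a <= b <= c -> I a c - I a b = I b c.
  move=> Ka Kc /andP[ab bc]; rewrite /I.
  rewrite (Rintegral_itvB (intf _ _ Ka Kc)) ?bnd_simp//.
  apply: Rintegral_itv_obnd_cbnd.
  apply: integrableS (intf _ _ Ka Kc) => //.
  by apply: subset_itvr; rewrite bnd_simp.
exists (fun t => if 0 <= t then I 0 t else - I t 0); split.
  by rewrite lexx /I set_itv1 Rintegral_set1.
move=> t Kt.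
(* With a base point [a] below both [t] and 0, the signed integral near [t] is [I a s - I a 0], to
   which the fundamental theorem applies. *)
have [a Ka] : exists2 a, K a & a < Num.min t 0.
  by apply: time_interval_lt; rewrite /Num.min; case: ifP.
rewrite lt_min => /andP[at_ a0].
have [u Ku tu] := time_interval_gt Kt.
have [dI I'] := continuous_FTC1_closed tu (intf _ _ Ka Ku) at_ (fK t Kt).
have dIt : is_derive t 1 (fun s => I a s - I a 0) (f t).
  have d1 : is_derive t 1 (I a) (f t) by exact: (DeriveDef dI (etrans (esym (derive1E _ _)) I')).
  have := is_deriveB d1 (is_derive_cst (I a 0) t 1); rewrite subr0; exact.
apply: near_eq_is_derive dIt; near=> s.
have Ks : K s by near: s; exact: time_interval_nbhs.
have as_ : a < s by near: s; exact: lt_nbhsr.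
case: ifPn => [s0|]; first by apply: addI => //; rewrite s0 ltW.
rewrite -ltNge => s0; rewrite -(addI a s 0)// ?opprB//.
by rewrite (ltW as_) ltW.
Unshelve. all: by end_near. Qed.

Lemma is_derive_expRM (k t : R) :
  is_derive t 1 (fun s => expR (k * s)) (k * expR (k * t)).
Proof.
have dk : is_derive t 1 (fun s : R => k * s) k.
  by have := is_deriveZ k (is_derive_id t 1); rewrite /GRing.scale/= mulr1.
by rewrite mulrC; exact: (is_derive1_comp (is_derive_expR (k * t)) dk).
Qed.

Lemma derive_nondecreasing F f a b : a <= b ->
  (forall t, a <= t <= b -> is_derive t 1 F (f t)) ->
  (forall t, a <= t <= b -> 0 <= f t) -> F a <= F b.
Proof.
move=> ab dF f0; have dF' x : x \in `]a, b[%R -> is_derive x 1 F (f x).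
  rewrite in_itv/= => /andP[/ltW ax /ltW xb].
  by apply: dF; rewrite ax.
have cF : {within `[a, b], continuous F}.
  apply: derivable_within_continuous => x; rewrite in_itv/= => xab.
  by case: (dF x xab).
have [c cab E] := MVT_segment ab dF' cF; rewrite -subr_ge0 E mulr_ge0 ?subr_ge0//.
by rewrite f0//.
Qed.

Lemma derive_bound F f (Phi phi : R -> R) a b : a <= b ->
  (forall t, a <= t <= b -> is_derive t 1 F (f t)) ->
  (forall t, a <= t <= b -> is_derive t 1 Phi (phi t)) ->
  (forall t, a <= t <= b -> `|f t| <= phi t) ->
  `|F b - F a| <= Phi b - Phi a.
Proof.
move=> ab dF dPhi fphi; rewrite ler_norml; apply/andP; split.
  rewrite -subr_ge0 opprK.
  have := derive_nondecreasing ab (fun t tab => is_derive_add (dF t tab) (dPhi t tab)).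
  have H : forall t, a <= t <= b -> 0 <= f t + phi t.
    by move=> t /fphi; rewrite ler_norml => /andP[? _]; lra.
  by move=> /(_ H); lra.
have := derive_nondecreasing ab
  (fun t tab => is_derive_add (dPhi t tab) (is_derive_opp (dF t tab))).
have H : forall t, a <= t <= b -> 0 <= phi t - f t.
  by move=> t /fphi; rewrite ler_norml => /andP[_ ?]; lra.
by move=> /(_ H); lra.
Qed.

(** The conditions [|s| <= |t|] and [0 <= s * t] describe the segment from 0 to [t] on either side
    of 0; negative [t] is treated by reflection. *)
Lemma derive_bound0 F f (Psi psi : R -> R) t : F 0 = 0 ->
  (forall s : R, `|s| <= `|t| -> 0 <= s * t -> is_derive s 1 F (f s)) ->
  (forall s : R, is_derive s 1 Psi (psi s)) ->
  (forall s, `|s| <= `|t| -> 0 <= s * t -> `|f s| <= psi `|s|) ->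
  `|F t| <= Psi `|t| - Psi 0.
Proof.
move=> F0 dF dPsi fpsi; have [t0|t0] := leP 0 t.
  rewrite -[F t]subr0 -[X in F t - X]F0 [in leRHS]ger0_norm//.
  have N s : 0 <= s <= t -> `|s| <= `|t| /\ 0 <= s * t.
    by move=> /andP[s0 st]; rewrite !ger0_norm// mulr_ge0.
  apply: (derive_bound (f := f) (phi := psi)) => // s /[dup] st /N[s1 s2].
    exact: dF.
  by have := fpsi s s1 s2; rewrite [X in psi X]ger0_norm//; case/andP: st.
pose G s := F (- s).
have N s : 0 <= s <= - t -> `|- s| <= `|t| /\ 0 <= - s * t.
  move=> /andP[s0 st]; rewrite normrN ger0_norm// ltr0_norm//; split=> //.
  by rewrite mulNr -mulrN mulr_ge0// oppr_ge0 ltW.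
have -> : F t = G (- t) by rewrite /G opprK.
rewrite -[G _]subr0 -[X in _ - X]F0 -[X in _ - F X]oppr0 -/(G 0) [in leRHS]ltr0_norm//.
apply: (derive_bound (f := fun s => f (- s) * - 1) (phi := psi)) => //.
- by rewrite oppr_ge0 ltW.
- move=> s /N[s1 s2].
  exact: (@is_derive1_comp _ F -%R _ _ _ (dF _ s1 s2) (is_deriveNid s 1)).
- move=> s /[dup] st /N[s1 s2]; rewrite mulrN1 normrN.
  by have := fpsi _ s1 s2; rewrite normrN [X in psi X]ger0_norm//; case/andP: st.
Qed.

(** Gronwall's argument for [u = sum_i (D i) ^+ 2]: both [u * exp (c t)] and
    [u * exp (- c t)] are monotone for large [c]. *)
Lemma gronwall_zero (J : finType) (D dD : J -> R -> R) :
  (forall i t, K t -> is_derive t 1 (D i) (dD i t)) ->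
  (forall i, D i 0 = 0) ->
  (forall a b, K a -> K b -> a <= b -> exists C, forall t, a <= t <= b ->
     forall i, `|dD i t| <= C * \sum_j `|D j t|) ->
  forall t, K t -> forall i, D i t = 0.
Proof.
move=> dDD D0 lip t Kt; have K0 := time_interval0.
pose u s := \sum_i D i s ^+ 2; pose du s := \sum_i (D i s * dD i s) *+ 2.
have du_u s : K s -> is_derive s 1 u (du s).
  move=> Ks; apply: is_derive_bigsum => i _.
  have := is_deriveM (dDD i s Ks) (dDD i s Ks); rewrite /GRing.scale/= -mulr2n.
  by under [in X in _ -> X]eq_fun do rewrite expr2.
have u0 : u 0 = 0 by apply: big1 => i _; rewrite D0 expr0n.
have u_ge0 s : 0 <= u s by apply: sumr_ge0 => i _; exact: sqr_ge0.
have cs s : (\sum_i `|D i s|) ^+ 2 <= #|J|%:R * u s.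
  rewrite expr2 mulr_suml.
  apply: (@le_trans _ _ (\sum_i \sum_j (D i s ^+ 2 + D j s ^+ 2) / 2)).
    apply: ler_sum => i _; rewrite mulr_sumr; apply: ler_sum => j _.
    rewrite -(real_normK (num_real (D i s))) -(real_normK (num_real (D j s))).
    have := sqr_ge0 (`|D i s| - `|D j s|); rewrite sqrrB; lra.
  under eq_bigr do rewrite -mulr_suml big_split /= sumr_const.
  rewrite -mulr_suml big_split /= sumr_const.
  under eq_bigr do rewrite -mulr_natl.
  by rewrite -mulr_sumr -/(u s) -mulr_natl; lra.
(* [du] is bounded by [2 |C|] times the square of the sum of the [|D i|], and [cs] replaces this
   square by [#|J| * u]. *)
have [c c0 duc] : exists2 c, 0 <= c & forall s, Num.min 0 t <= s <= Num.max 0 t ->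
    `|du s| <= c * u s.
  have Km : K (Num.min 0 t) by rewrite /Num.min; case: ifP.
  have KM : K (Num.max 0 t) by rewrite /Num.max; case: ifP.
  have mM : Num.min 0 t <= Num.max 0 t by rewrite ge_min le_max lexx.
  have [C lipC] := lip _ _ Km KM mM; exists (2 * (`|C| * #|J|%:R)).
    by rewrite !mulr_ge0.
  move=> s /lipC dDC; apply: (le_trans (ler_norm_sum _ _ _)).
  apply: (@le_trans _ _ (\sum_i 2 * (`|D i s| * (`|C| * \sum_j `|D j s|)))).
    apply: ler_sum => i _; rewrite normrMn normrM -[leLHS]mulr_natl.
    do 2 apply: ler_wpM2l => //.
    by apply: (le_trans (dDC i)); rewrite ler_wpM2r ?ler_norm// sumr_ge0.
  rewrite -mulr_sumr -!mulrA ler_pM2l// -mulr_suml mulrCA ler_wpM2l// -expr2.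
  exact: cs.
suff ut : u t <= 0.
  move=> i; apply/eqP; rewrite -sqrf_eq0; apply/eqP/le_anti.
  rewrite sqr_ge0 andbT; apply: le_trans ut.
  by rewrite /u (bigD1 i)//= lerDl sumr_ge0// => j _; rewrite sqr_ge0.
have dprod (k s : R) : K s ->
    is_derive s 1 (fun s => u s * expR (k * s)) ((du s + k * u s) * expR (k * s)).
  move=> Ks; have := is_deriveM (du_u s Ks) (is_derive_expRM k s); rewrite /GRing.scale/=.
  by congr is_derive; ring.
have [t0|/ltW t0] := leP 0 t.
- have Ks s : 0 <= s <= t -> K s by exact: time_interval_itv.
  have := derive_nondecreasing t0 (fun s st => is_derive_opp (dprod (- c) s (Ks s st))).
  move=> /(_ _)/wrap[s st|].
    rewrite -mulNr mulr_ge0 ?expR_ge0// opprD mulNr opprK addrC subr_ge0.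
    by apply: (le_trans (ler_norm _)); apply: duc; rewrite min_l// max_r.
  rewrite u0 mul0r oppr0 oppr_ge0 pmulr_lle0// expR_gt0//.
- have Ks s : t <= s <= 0 -> K s by exact: time_interval_itv.
  have := derive_nondecreasing t0 (fun s st => dprod c s (Ks s st)).
  move=> /(_ _)/wrap[s st|].
    rewrite mulr_ge0 ?expR_ge0// -[X in 0 <= X]opprK oppr_ge0 opprD subr_le0.
    rewrite (le_trans (ler_norm _))// normrN; apply: duc; rewrite min_r// max_l//.
  by rewrite u0 mul0r pmulr_lle0// expR_gt0.
Qed.

End TimeInterval.

(** * Existence by iterated integrals, uniqueness and invertibility for linear matrix equations *)

Section LinearODE.
Variables (R : realType) (n : nat) (K : set R).
Hypothesis timeK : time_interval K.
Local Notation M := 'M[R]_n.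
Implicit Types (H : R -> M) (t : R).

Lemma contK_cst (c : R) : contK K (fun=> c).
Proof. by move=> t _; exact: cst_continuous. Qed.

Lemma contK_add (f g : R -> R) : contK K f -> contK K g -> contK K (fun t => f t + g t).
Proof. by move=> cf cg t Kt; apply: continuousD; [exact: cf|exact: cg]. Qed.

Lemma contK_mul (f g : R -> R) : contK K f -> contK K g -> contK K (fun t => f t * g t).
Proof. by move=> cf cg t Kt; apply: continuousM; [exact: cf|exact: cg]. Qed.

Lemma contK_sum (J : Type) (r : seq J) (P : pred J) (F : J -> R -> R) :
  (forall i, P i -> contK K (F i)) -> contK K (fun t => \sum_(i <- r | P i) F i t).
Proof.
move=> cF; elim: r => [|i r IHr].
  by under eq_fun do rewrite big_nil; exact: contK_cst.
under eq_fun do rewrite big_cons; case Pi: (P i) => //.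
by apply: contK_add => //; exact: cF.
Qed.

Definition contmx p q (F : R -> 'M[R]_(p, q)) := forall i j, contK K (fun t => F t i j).

Lemma contmx_mul p q r (F : R -> 'M[R]_(p, q)) (G : R -> 'M[R]_(q, r)) :
  contmx F -> contmx G -> contmx (fun t => F t *m G t).
Proof.
move=> cF cG i j; under eq_fun do rewrite mxE.
by apply: contK_sum => k _; exact: contK_mul.
Qed.

Lemma contmx_trmx p q (F : R -> 'M[R]_(p, q)) : contmx F -> contmx (fun t => (F t)^T).
Proof. by move=> cF i j; under eq_fun do rewrite mxE; exact: cF. Qed.

Lemma contmx_add p q (F G : R -> 'M[R]_(p, q)) :
  contmx F -> contmx G -> contmx (fun t => F t + G t).
Proof. by move=> cF cG i j; under eq_fun do rewrite mxE; exact: contK_add. Qed.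

Lemma contmx_cst p q (A : 'M[R]_(p, q)) : contmx (fun=> A).
Proof. by move=> i j; exact: contK_cst. Qed.

Lemma contmx_scale p q (F : R -> 'M[R]_(p, q)) (c : R) :
  contmx F -> contmx (fun t => c *: F t).
Proof.
move=> cF i j; under eq_fun do rewrite mxE.
by apply: contK_mul => //; exact: contK_cst.
Qed.

Lemma contmx_opp p q (F : R -> 'M[R]_(p, q)) : contmx F -> contmx (fun t => - F t).
Proof. by move=> cF; under eq_fun do rewrite -scaleN1r; exact: contmx_scale. Qed.

Lemma contmx_sum p q (J : Type) (r : seq J) (P : pred J) (F : J -> R -> 'M[R]_(p, q)) :
  (forall i, P i -> contmx (F i)) -> contmx (fun t => \sum_(i <- r | P i) F i t).
Proof.
move=> cF i j; under eq_fun do rewrite summxE.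
by apply: contK_sum => k Pk; exact: cF.
Qed.

Lemma is_derive_contmx p q (F : R -> 'M[R]_(p, q)) dF :
  (forall t, K t -> is_derive t 1 F (dF t)) -> contmx F.
Proof.
move=> dFt i j t Kt; apply: is_derive_continuous.
by have /is_derive_mxP/(_ i j) := dFt t Kt; apply.
Qed.

Lemma entry_le_sum p q (X : 'M[R]_(p, q)) k l : `|X k l| <= \sum_k \sum_l `|X k l|.
Proof.
rewrite (bigD1 k)//= (bigD1 l)//= -addrA lerDl addr_ge0 ?sumr_ge0// => i _.
exact: sumr_ge0.
Qed.

Lemma contmx_bounded p q (F : R -> 'M[R]_(p, q)) a b :
  contmx F -> K a -> K b -> a <= b ->
  exists2 C, 0 <= C & forall t, a <= t <= b -> forall i j, `|F t i j| <= C.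
Proof.
move=> cF Ka Kb ab.
have cS : contK K (fun t => \sum_i \sum_j `|F t i j|).
  apply: contK_sum => i _; apply: contK_sum => j _ t Kt.
  by apply: continuous_comp; [exact: cF|exact: norm_continuous].
have [C FC] := contK_bounded timeK cS Ka Kb ab.
exists `|C| => // t /FC tC i j; apply: le_trans (ler_norm C).
apply: (le_trans (entry_le_sum _ _ _)); exact: le_trans (ler_norm _) tC.
Qed.

Section Picard.
Variable B : R -> M.
Hypothesis contB : contmx B.

(** A chosen primitive vanishing at 0; the default is taken only when there is none, which
    [primitive] excludes for continuous [f]. *)
Definition prim (f : R -> R) : R -> R :=
  xget (fun=> 0) [set F | F 0 = 0 /\ forall t, K t -> is_derive t 1 F (f t)].

Lemma primP f : contK K f ->
  prim f 0 = 0 /\ forall t, K t -> is_derive t 1 (prim f) (f t).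
Proof.
by move=> /(primitive timeK)[F HF]; rewrite /prim; case: xgetP => [//|/(_ F)].
Qed.

Definition primmx (F : R -> M) t : M := \matrix_(i, j) prim (fun s => F s i j) t.

Lemma primmxP (F : R -> M) : contmx F ->
  primmx F 0 = 0 /\ forall t, K t -> is_derive t 1 (primmx F) (F t).
Proof.
move=> cF; split=> [|t Kt].
  by apply/matrixP => i j; rewrite !mxE; case: (primP (cF i j)).
apply/is_derive_mxP => i j; under eq_fun do rewrite mxE.
by case: (primP (cF i j)) => _; apply.
Qed.

(** The terms of the Peano-Baker series: iterated integrals of [B], whose sum solves
    [H' = H *m B]. *)
Fixpoint picard k : R -> M :=
  if k is k'.+1 then primmx (fun t => picard k' t *m B t) else fun=> 1%:M.

Lemma picard_cont k : contmx (picard k).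
Proof.
elim: k => [|k IHk]; first exact: contmx_cst.
by apply: (is_derive_contmx (primmxP (contmx_mul IHk contB)).2).
Qed.

Lemma picard_derive k t : K t -> is_derive t 1 (picard k.+1) (picard k t *m B t).
Proof. by have [_] := primmxP (contmx_mul (@picard_cont k) contB); apply. Qed.

Lemma picard0 k : picard k.+1 0 = 0.
Proof. by have [] := primmxP (contmx_mul (@picard_cont k) contB). Qed.

Lemma mulmx_bound (X Y : M) (x y : R) i j :
  (forall i j, `|X i j| <= x) -> (forall i j, `|Y i j| <= y) ->
  `|(X *m Y) i j| <= n%:R * (x * y).
Proof.
move=> Xx Yy; rewrite mxE; apply: (le_trans (ler_norm_sum _ _ _)).
apply: (@le_trans _ _ (\sum_(k < n) x * y)).
  by apply: ler_sum => k _; rewrite normrM ler_pM.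
by rewrite sumr_const card_ord mulr_natl.
Qed.

Section Bounds.
Variables (a b beta : R).
Hypotheses (Ka : K a) (Kb : K b) (a0 : a <= 0) (b0 : 0 <= b) (beta0 : 0 <= beta).
Hypothesis Bbeta : forall t, a <= t <= b -> forall i j, `|B t i j| <= beta.
(** The weight [expR (c * |t|)] with [c] twice [n * beta] makes each integration against [B] gain a
    factor one half, so the series is dominated by a geometric one of ratio [h]. *)
Let c := 2 * (n%:R * beta).
Let E := expR (c * (b - a)).
Let h : R := 2^-1.

Let c0 : 0 <= c. Proof. by rewrite !mulr_ge0. Qed.

Lemma between0 s t : a <= t <= b -> `|s| <= `|t| -> 0 <= s * t -> a <= s <= b.
Proof.
move=> /andP[at_ tb] st s0; have [t0|t0] := leP 0 t.
  have := le_trans (ler_norm s) st; rewrite ger0_norm// => st'.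
  rewrite (le_trans st' tb) andbT.
  have [t00|tn0] := eqVneq t 0.
    by move: st; rewrite t00 normr0 normr_le0 => /eqP ->.
  by apply: (le_trans a0); rewrite -(pmulr_lge0 s (x := t))// lt_def tn0.
have s0' : s <= 0 by rewrite -(nmulr_lge0 s t0).
rewrite (le_trans s0' b0) andbT.
by move: st; rewrite ler0_norm// ltr0_norm// lerN2; exact: le_trans.
Qed.

Lemma picard_bound k t : a <= t <= b ->
  forall i j, `|picard k t i j| <= h ^+ k * expR (c * `|t|).
Proof.
elim: k t => [|k IHk] t tab i j.
  rewrite expr0 mul1r mxE; apply: (@le_trans _ _ 1).
    by case: (i == j); rewrite ?normr1 ?normr0.
  by rewrite -expR0 ler_expR mulr_ge0.
have Ks (s : R) : `|s| <= `|t| -> 0 <= s * t -> K s.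
  by move=> st s0; apply: (time_interval_itv timeK Ka Kb); exact: between0 tab st s0.
have P0 : picard k.+1 0 i j = 0 by rewrite picard0 mxE.
have dP (s : R) : `|s| <= `|t| -> 0 <= s * t ->
    is_derive s 1 (fun s => picard k.+1 s i j) ((picard k s *m B s) i j).
  by move=> st s0; have /is_derive_mxP := picard_derive k (Ks _ st s0); exact.
have dPsi (s : R) : is_derive s 1 (fun s => h ^+ k.+1 * expR (c * s))
    (h ^+ k.+1 * (c * expR (c * s))).
  exact: is_derive_scale (is_derive_expRM c s).
have bnd (s : R) : `|s| <= `|t| -> 0 <= s * t -> `|(picard k s *m B s) i j| <=
    h ^+ k.+1 * (c * expR (c * `|s|)).
  move=> st s0; have sab := between0 tab st s0.
  apply: (le_trans (mulmx_bound i j (IHk s sab) (Bbeta sab))).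
  by rewrite exprS /c le_eqVlt; apply/orP; left; apply/eqP; rewrite /h; field.
have := derive_bound0 P0 dP dPsi bnd; move/le_trans; apply.
by rewrite lerBlDr lerDl mulr_ge0 ?expR_ge0// exprn_ge0// invr_ge0.
Qed.

Lemma picard_unif k t i j : a <= t <= b -> `|picard k t i j| <= h ^+ k * E.
Proof.
move=> tab; apply: (le_trans (picard_bound k tab i j)).
rewrite ler_wpM2l ?exprn_ge0 ?invr_ge0// ler_expR ler_wpM2l//.
case/andP: tab => at_ tb; rewrite ler_norml; apply/andP; split.
  by rewrite opprB; apply: le_trans at_; rewrite gerBl.
by apply: (le_trans tb); rewrite lerDl oppr_ge0.
Qed.

Definition picard_sum m t : M := \sum_(0 <= k < m) picard k t.

Lemma picard_sumE m t i j : picard_sum m t i j = series (fun k => picard k t i j) m.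
Proof. by rewrite summxE. Qed.

Lemma picard_sum_cauchy m p t i j : a <= t <= b ->
  `|picard_sum (m + p) t i j - picard_sum m t i j| <= 2 * E * (h ^+ m - h ^+ (m + p)).
Proof.
move=> tab; elim: p => [|p IHp]; first by rewrite addn0 !subrr normr0 mulr0.
rewrite addnS /picard_sum big_nat_recr//= mxE addrAC.
apply: (le_trans (ler_normD _ _)); have := picard_unif (m + p) i j tab.
move: IHp; rewrite -/(picard_sum _ _) exprS /h => H1 H2; lra.
Qed.

Definition picard_lim t : M :=
  \matrix_(i, j) limn (series (fun k => picard k t i j)).

Lemma h_ge0 m : 0 <= h ^+ m. Proof. by rewrite exprn_ge0// invr_ge0. Qed.

Lemma picard_cvg t i j : a <= t <= b ->
  picard_sum m t i j @[m --> \oo] --> picard_lim t i j.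
Proof.
move=> tab; under eq_fun do rewrite picard_sumE.
rewrite mxE; apply: normed_cvg.
apply: (@series_le_cvg _ _ (geometric E h)) => [k|k|k|].
- exact: normr_ge0.
- by rewrite /geometric/= mulr_ge0 ?expR_ge0 ?h_ge0.
- by rewrite /geometric/= mulrC picard_unif.
- by apply: is_cvg_geometric_series; rewrite ger0_norm ?invr_ge0// invf_lt1// ltr1n.
Qed.

(** The Cauchy estimate passed to the limit. Its uniformity in [t] gives continuity of the limit and
    allows the limit under the primitive. *)
Lemma picard_tail m t i j : a <= t <= b ->
  `|picard_lim t i j - picard_sum m t i j| <= 2 * E * h ^+ m.
Proof.
move=> tab; apply/ler_addgt0Pr => e e0.
have /cvgrPdist_le/(_ e e0)[N _ HN] := @picard_cvg t i j tab.
have := HN (m + N)%N (leq_addl _ _) => /= H1.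
have H2 := picard_sum_cauchy m N i j tab.
rewrite -(subrKA (picard_sum (m + N) t i j)).
apply: (le_trans (ler_normD _ _)).
have H3 : 0 <= 2 * E * h ^+ (m + N) by rewrite mulr_ge0 ?h_ge0// mulr_ge0// expR_ge0.
lra.
Qed.

End Bounds.

Lemma time_bracket t : K t -> exists a b beta : R,
  [/\ K a, K b, a <= 0, 0 <= b & a < t < b] /\
  (0 <= beta /\ forall s, a <= s <= b -> forall i j, `|B s i j| <= beta).
Proof.
move=> Kt; have K0 := time_interval0 timeK.
have [a Ka] : exists2 a, K a & a < Num.min t 0.
  by apply: (time_interval_lt timeK); rewrite /Num.min; case: ifP.
have [b Kb] : exists2 b, K b & Num.max t 0 < b.
  by apply: (time_interval_gt timeK); rewrite /Num.max; case: ifP.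
rewrite gt_max lt_min => /andP[tb b0] /andP[at_ a0].
have [beta beta0 Bbeta] := contmx_bounded contB Ka Kb (ltW (lt_trans a0 b0)).
by exists a, b, beta; rewrite at_ tb; split; split => //; exact: ltW.
Qed.

Lemma half_pow_small (C e : R) : 0 <= C -> 0 < e -> exists m, C * 2^-1 ^+ m <= e.
Proof.
move=> C0 e0.
have h1 : `|2^-1 : R| < 1 by rewrite ger0_norm ?invr_ge0// invf_lt1// ltr1n.
have /cvgrPdist_le := cvg_geometric C h1; move/(_ e e0) => [m _ /(_ m (leqnn m))].
rewrite /geometric/= sub0r normrN ger0_norm; first by exists m.
by rewrite mulr_ge0// exprn_ge0// invr_ge0.
Qed.

Lemma picard_sum_contmx m : contmx (picard_sum m).
Proof. by apply: contmx_sum => k _; exact: picard_cont. Qed.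

Lemma picard_lim_contmx : contmx picard_lim.
Proof.
move=> i j t Kt; have [a [b [beta [[Ka Kb a0 b0 tab] [beta0 Bbeta]]]]] := time_bracket Kt.
apply/cvgrPdist_le => e e0.
have C0 : 0 <= 2 * expR (2 * (n%:R * beta) * (b - a)) by rewrite mulr_ge0// expR_ge0.
have [m Cm] := half_pow_small C0 (divr_gt0 e0 (ltr0n _ 3)).
have tail s : a <= s <= b -> `|picard_lim s i j - picard_sum m s i j| <= e / 3.
  by move=> sab; apply: le_trans Cm; exact: (picard_tail Ka Kb a0 b0 beta0 Bbeta).
have := @picard_sum_contmx m i j t Kt => /cvgrPdist_le/(_ _ (divr_gt0 e0 (ltr0n _ 3))) cS.
have /andP[at_ tb] := tab.
near=> s.
have sab : a <= s <= b.
  apply/andP; split; apply: ltW; near: s; [exact: lt_nbhsr|exact: lt_nbhsl].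
have tab' : a <= t <= b by have /andP[? ?] := tab; rewrite !ltW.
have H1 := tail t tab'; have H2 := tail s sab.
have H3 : `|picard_sum m t i j - picard_sum m s i j| <= e / 3 by near: s.
rewrite distrC in H2.
rewrite -(subrKA (picard_sum m t i j)).
apply: (le_trans (ler_normD _ _)).
rewrite -[X in _ + `|X|](subrKA (picard_sum m s i j)).
have := ler_normD (picard_sum m t i j - picard_sum m s i j)
  (picard_sum m s i j - picard_lim s i j); lra.
Unshelve. all: by end_near. Qed.

Lemma picard_sum_derive m t : K t ->
  is_derive t 1 (picard_sum m.+1) (picard_sum m t *m B t).
Proof.
move=> Kt; rewrite /picard_sum.
under eq_fun do rewrite big_nat_recl//=.
rewrite mulmx_suml -[X in is_derive _ _ _ X]add0r; apply: is_derive_add.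
by apply: is_derive_bigsum => k _; exact: picard_derive.
Qed.

(** The partial sum of order [m.+1], minus the identity, is the primitive of the partial sum of
    order [m] times [B]; both sides are within a multiple of [2^-m] of these. *)
Lemma picard_lim_fix t : K t ->
  picard_lim t = 1%:M + primmx (fun s => picard_lim s *m B s) t.
Proof.
move=> Kt; have [a [b [beta [[Ka Kb a0 b0 tab] [beta0 Bbeta]]]]] := time_bracket Kt.
have [P0 dP] := primmxP (contmx_mul picard_lim_contmx contB).
set P := primmx _ in P0 dP *.
set E := expR (2 * (n%:R * beta) * (b - a)).
have E0 : 0 <= 2 * E by rewrite mulr_ge0// expR_ge0.
have tab' : a <= t <= b by have /andP[? ?] := tab; rewrite !ltW.
apply/matrixP => i j; rewrite [RHS]mxE; apply/eqP; rewrite -subr_eq0 -normr_le0.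
apply/ler_addgt0Pr => e e0; rewrite add0r.
(* The first summand bounds the distance between the primitives over a length at most [b - a], the
   second the tail of the series at [t], both in units of [2^-m]. *)
pose C := n%:R * (2 * E * beta) * (b - a) + 2 * E.
have ab0 : 0 <= b - a by rewrite subr_ge0 (le_trans a0).
have C0 : 0 <= C by rewrite addr_ge0// !mulr_ge0// expR_ge0.
have [m Cm] := half_pow_small C0 e0.
apply: le_trans Cm; set h := 2^-1 ^+ m.
have h0 : 0 <= h by rewrite exprn_ge0// invr_ge0.
pose F s := P s i j - (picard_sum m.+1 s - 1%:M) i j.
have F0 : F 0 = 0.
  rewrite /F P0 /picard_sum big_nat_recl//= big1 ?addr0 ?subrr ?mxE ?subr0// => k _.
  exact: picard0.
have dF s : `|s| <= `|t| -> 0 <= s * t ->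
    is_derive s 1 F (((picard_lim s - picard_sum m s) *m B s) i j).
  move=> st s0.
  have Ks : K s by apply: (time_interval_itv timeK Ka Kb); exact: between0 tab' st s0.
  rewrite mulmxBl -[X in _ - X]subr0.
  have := is_derive_add (dP s Ks) (is_derive_opp (is_derive_add (picard_sum_derive m Ks)
    (is_derive_cst (- 1%:M : M) s 1))).
  move=> /is_derive_mxP/(_ i j); rewrite subr0 addr0 => d.
  rewrite (_ : F = fun y => (P y + - (picard_sum m.+1 y + cst (- 1%:M) y)) i j)//.
  by apply/funext => y; rewrite /F [RHS]mxE; congr (_ + _); rewrite [RHS]mxE.
pose k := n%:R * (2 * E * h * beta).
have bnd s : `|s| <= `|t| -> 0 <= s * t ->
    `|((picard_lim s - picard_sum m s) *m B s) i j| <= k.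
  move=> st s0; have sab := between0 a0 b0 tab' st s0.
  apply: mulmx_bound => [i' j'|i' j']; last exact: Bbeta.
  by rewrite mxE [X in _ + X]mxE; exact: (picard_tail Ka Kb a0 b0 beta0 Bbeta).
have dk (s : R) : is_derive s 1 (fun s => k * s) k.
  by have := is_deriveZ k (is_derive_id s 1); rewrite /GRing.scale/= mulr1.
have := derive_bound0 F0 dF dk bnd; rewrite mulr0 subr0 => Fk.
have k0 : 0 <= k by rewrite !mulr_ge0// expR_ge0.
have tba : `|t| <= b - a.
  have /andP[at_ tb] := tab'; rewrite ler_norml; apply/andP; split.
    by rewrite opprB; apply: le_trans at_; rewrite gerBl.
  by apply: (le_trans tb); rewrite lerDl oppr_ge0.
have T := picard_tail Ka Kb a0 b0 beta0 Bbeta m.+1 i j tab'.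
rewrite -/E exprS -/h in T.
have -> : picard_lim t i j - (1%:M i j + P t i j) =
    (picard_lim t i j - picard_sum m.+1 t i j) - F t.
  have SE : (picard_sum m.+1 t - 1%:M) i j = picard_sum m.+1 t i j - (1%:M : M) i j.
    by rewrite [LHS]mxE; congr (_ + _); rewrite [LHS]mxE.
  by rewrite /F SE; ring.
apply: (le_trans (ler_normB _ _)).
have H1 : k * `|t| <= k * (b - a) by rewrite ler_wpM2l.
have H2 : 2 * E * (2^-1 * h) <= 2 * E * h.
  by rewrite ler_wpM2l// ler_piMl// invf_le1// ler1n.
rewrite /C mulrDl.
have -> : n%:R * (2 * E * beta) * (b - a) * h = k * (b - a) by rewrite /k; ring.
by rewrite addrC; apply: lerD; [exact: le_trans Fk H1|exact: le_trans T H2].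
Qed.

Lemma linear_ode_exists : exists H, H 0 = 1%:M /\
  forall t, K t -> is_derive t 1 H (H t *m B t).
Proof.
have [P0 dP] := primmxP (contmx_mul picard_lim_contmx contB).
exists picard_lim; split=> [|t Kt].
  by rewrite picard_lim_fix ?P0 ?addr0//; exact: time_interval0.
have d1 := is_derive_add (is_derive_cst (1%:M : M) t 1) (dP t Kt).
rewrite add0r in d1; apply: near_eq_is_derive d1; near=> s.
by rewrite picard_lim_fix//; near: s; exact: time_interval_nbhs.
Unshelve. all: by end_near. Qed.

End Picard.

Lemma linear_ode_exists_left (B : R -> M) : contmx B ->
  exists H, H 0 = 1%:M /\ forall t, K t -> is_derive t 1 H (B t *m H t).
Proof.
move=> /contmx_trmx/linear_ode_exists[H [H0 dH]].
exists (fun t => (H t)^T); split=> [|t Kt]; first by rewrite H0 trmx1.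
by have := is_derive_trmx (dH t Kt); rewrite trmx_mul trmxK.
Qed.

Lemma ode_unique p q (D dD : R -> 'M[R]_(p, q)) :
  (forall t, K t -> is_derive t 1 D (dD t)) -> D 0 = 0 ->
  (forall a b, K a -> K b -> a <= b -> exists C, forall t, a <= t <= b ->
     forall i j, `|dD t i j| <= C * \sum_k \sum_l `|D t k l|) ->
  forall t, K t -> D t = 0.
Proof.
move=> dDD D0 lip t Kt; apply/matrixP => i j; rewrite [RHS]mxE.
apply: (@gronwall_zero R K timeK ('I_p * 'I_q)%type (fun r s => D s r.1 r.2)
  (fun r s => dD s r.1 r.2) _ _ _ t Kt (i, j)).
- by move=> r s Ks; have /is_derive_mxP := dDD s Ks; exact.
- by move=> r; rewrite D0 mxE.
- move=> a b Ka Kb ab; have [C HC] := lip a b Ka Kb ab; exists C => s sab r.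
  by apply: (le_trans (HC s sab r.1 r.2)); rewrite pair_bigA.
Qed.

Lemma derive0_const p q (D : R -> 'M[R]_(p, q)) :
  (forall t, K t -> is_derive t 1 D 0) -> forall t, K t -> D t = D 0.
Proof.
move=> dD t Kt; apply/eqP; rewrite -subr_eq0; apply/eqP.
apply: (@ode_unique p q (fun s => D s - D 0) (fun=> 0)) => // [s Ks||a b _ _ _].
- by have := is_deriveB (dD s Ks) (is_derive_cst (D 0) s 1); rewrite subr0.
- by rewrite subrr.
- by exists 0 => s _ i j; rewrite mul0r mxE normr0.
Qed.

Lemma mulmx_bound_suml (X Y : M) y i j : (forall i j, `|Y i j| <= y) ->
  `|(X *m Y) i j| <= n%:R * y * \sum_k \sum_l `|X k l|.
Proof.
move=> Yy; rewrite -mulrA [y * _]mulrC; apply: mulmx_bound => // i' j'.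
exact: entry_le_sum.
Qed.

Lemma mulmx_bound_sumr (X Y : M) y i j : (forall i j, `|Y i j| <= y) ->
  `|(Y *m X) i j| <= n%:R * y * \sum_k \sum_l `|X k l|.
Proof.
move=> Yy; rewrite -mulrA; apply: mulmx_bound => // i' j'.
exact: entry_le_sum.
Qed.

Lemma linear_ode_unique (B1 B2 : R -> M) (X Y : R -> M) :
  contmx B1 -> contmx B2 -> X 0 = Y 0 ->
  (forall t, K t -> is_derive t 1 X (B1 t *m X t + X t *m B2 t)) ->
  (forall t, K t -> is_derive t 1 Y (B1 t *m Y t + Y t *m B2 t)) ->
  forall t, K t -> X t = Y t.
Proof.
move=> c1 c2 XY0 dX dY t Kt; apply/eqP; rewrite -subr_eq0; apply/eqP.
apply: (@ode_unique n n (fun s => X s - Y s)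
  (fun s => B1 s *m (X s - Y s) + (X s - Y s) *m B2 s)) => //.
- move=> s Ks; have := is_deriveB (dX s Ks) (dY s Ks).
  by rewrite mulmxBr mulmxBl opprD addrACA.
- by rewrite XY0 subrr.
move=> a b Ka Kb ab.
have [C1 _ HC1] := contmx_bounded c1 Ka Kb ab.
have [C2 _ HC2] := contmx_bounded c2 Ka Kb ab.
exists (n%:R * C1 + n%:R * C2) => s sab i j; rewrite mxE mulrDl.
apply: (le_trans (ler_normD _ _)); apply: lerD.
  exact: mulmx_bound_sumr (HC1 s sab).
exact: mulmx_bound_suml (HC2 s sab).
Qed.

(** If [G' = - B *m G] with [G 0 = 1], then [H *m G] has zero derivative, so [G] is an inverse of
    [H]. *)
Lemma linear_ode_unit (B H : R -> M) : contmx B -> H 0 = 1%:M ->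
  (forall t, K t -> is_derive t 1 H (H t *m B t)) ->
  forall t, K t -> H t \in unitmx.
Proof.
move=> cB H0 dH t Kt.
have [G [G0 dG]] := linear_ode_exists_left (contmx_opp cB).
have HG : H t *m G t = 1%:M.
  have dHG s : K s -> is_derive s 1 (fun s => H s *m G s) 0.
    move=> Ks; have := is_derive_mulmx (dH s Ks) (dG s Ks).
    by rewrite mulNmx mulmxN mulmxA subrr.
  by rewrite (derive0_const dHG Kt) H0 G0 mulmx1.
by have [] := mulmx1_unit HG.
Qed.

End LinearODE.

(** * Differentiating the inverse of a matrix curve *)

Section MatrixCurves.
Variables (R : realType) (n : nat) (K : set R).
Hypothesis timeK : time_interval K.
Implicit Types (t : R).

Lemma derivable_bigprod (J : Type) (r : seq J) (F : J -> R -> R) t :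
  (forall i, derivable (F i) t 1) -> derivable (fun s => \prod_(i <- r) F i s) t 1.
Proof.
move=> dF; elim: r => [|i r IHr].
  by under eq_fun do rewrite big_nil; exact: derivable_cst.
by have := derivableM (dF i) IHr; under [in X in _ -> X]eq_fun do rewrite big_cons.
Qed.

Lemma derivable_det m (F : R -> 'M[R]_m) t :
  (forall i j, derivable (fun s => F s i j) t 1) -> derivable (fun s => \det (F s)) t 1.
Proof.
move=> dF; have dS (p : 'S_m) : derivable (fun s => (-1) ^+ p * \prod_i F s i (p i)) t 1.
  apply: derivableM; first exact: derivable_cst.
  exact: derivable_bigprod.
suff : is_derive t 1 (fun s => \det (F s)) (\sum_(p : 'S_m) 'D_1
    (fun s => (-1) ^+ p * \prod_i F s i (p i)) t) by case.
by apply: is_derive_bigsum => p _; exact: derivableP.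
Qed.

(** The cofactor formula [G] is differentiable and agrees with [invmx] near [t], where [F] stays
    invertible; the value of the derivative then comes from [invmx F *m F = 1]. *)
Lemma is_derive_invmx (F dF : R -> 'M[R]_n) :
  (forall t, K t -> F t \in unitmx) -> (forall t, K t -> is_derive t 1 F (dF t)) ->
  forall t, K t ->
    is_derive t 1 (fun s => invmx (F s)) (- (invmx (F t) *m dF t *m invmx (F t))).
Proof.
move=> Fu dFK t Kt.
have dFij i j : derivable (fun s => F s i j) t 1.
  by have /is_derive_mxP/(_ i j)[] := dFK t Kt.
pose G s := (\det (F s))^-1 *: \adj (F s).
have FG : \forall s \near t, G s = invmx (F s).
  near=> s; rewrite /invmx Fu//; near: s; exact: time_interval_nbhs.
have dG : derivable G t 1.
  apply/derivable_mxP => i j; under eq_fun do rewrite mxE mxE.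
  apply: derivableM.
    apply: derivableV; last exact: derivable_det.
    by have := Fu t Kt; rewrite unitmxE unitfE.
  apply: derivableM; first exact: derivable_cst.
  by apply: derivable_det => k l; under eq_fun do rewrite !mxE; exact: dFij.
have dI := near_eq_is_derive FG (derivableP dG).
suff <- : 'D_1 G t = - (invmx (F t) *m dF t *m invmx (F t)) by [].
have d1 := is_derive_mulmx dI (dFK t Kt).
have d0 : is_derive t 1 (fun s => invmx (F s) *m F s) 0.
  apply: near_eq_is_derive (is_derive_cst (1%:M : 'M[R]_n) t 1).
  near=> s; rewrite mulVmx// Fu//; near: s; exact: time_interval_nbhs.
have /eqP := is_derive_uniq d1 d0; rewrite addr_eq0 => /eqP E.
by rewrite -[LHS]mulmx1 -(mulmxV (Fu t Kt)) mulmxA E mulNmx.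
Unshelve. all: by end_near. Qed.

Lemma contmx_invmx (F dF : R -> 'M[R]_n) :
  (forall t, K t -> F t \in unitmx) -> (forall t, K t -> is_derive t 1 F (dF t)) ->
  contmx K (fun t => invmx (F t)).
Proof. by move=> Fu dFK; exact: is_derive_contmx (is_derive_invmx Fu dFK). Qed.

End MatrixCurves.

(** * Curves of brackets *)

Section BracketCurves.
Variables (R : realType) (n : nat) (K : set R).
Local Notation V := 'cV[R]_n.
Local Notation e := (basis_vec R).
Hypothesis timeK : time_interval K.
Variable mu : R -> V -> V -> V.
Hypothesis skew_mu : forall t, K t -> skew_bilinear (mu t).
Implicit Types (t : R) (x y : V).

(** Only evaluations at fixed vectors are known to be differentiable, so the moving arguments are
    expanded in the basis; this is legitimate near [t], where [mu s] is bilinear. *)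
Lemma is_derive_bracket_curve dmu (X Y : R -> V) dX dY t : K t ->
  (forall x y, is_derive t 1 (fun s => mu s x y) (dmu x y)) ->
  skew_bilinear dmu ->
  is_derive t 1 X dX -> is_derive t 1 Y dY ->
  is_derive t 1 (fun s => mu s (X s) (Y s))
    (dmu (X t) (Y t) + (mu t dX (Y t) + mu t (X t) dY)).
Proof.
move=> Kt dmut skew_d dXt dYt.
have E : \forall s \near t, \sum_i \sum_j (X s i 0 * Y s j 0) *: mu s (e i) (e j) =
    mu s (X s) (Y s).
  near=> s; rewrite -bracket_expand//; apply: skew_mu; near: s.
  exact: time_interval_nbhs.
apply: near_eq_is_derive E _.
rewrite (bracket_expand skew_d) (bracket_expand (skew_mu Kt) dX).
rewrite (bracket_expand (skew_mu Kt) (X t)) -!big_split.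
apply: is_derive_bigsum => i _; rewrite -!big_split.
apply: is_derive_bigsum => j _.
have /is_derive_mxP/(_ i 0) dXi := dXt; have /is_derive_mxP/(_ j 0) dYj := dYt.
have dXY : is_derive t 1 (fun s => X s i 0 * Y s j 0)
  (X t i 0 * dY j 0 + Y t j 0 * dX i 0) := is_deriveM dXi dYj.
apply/is_derive_mxP => k l; under eq_fun do rewrite mxE.
have /is_derive_mxP/(_ k l) dm := dmut (e i) (e j).
have := is_deriveM dXY dm; rewrite /GRing.scale/=; congr is_derive.
by rewrite !mxE; ring.
Unshelve. all: by end_near. Qed.

Lemma skew_bracket_delta t a : K t -> skew_bilinear (bracket_delta (mu t) a).
Proof.
move=> /skew_mu sk; split=> [x c u v|y c u v|x y]; rewrite /bracket_delta.
- rewrite !mulmxDr -!scalemxAr !(bracket_linearr sk) mulmxDr -scalemxAr.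
  by apply/matrixP => i j; rewrite ![in LHS]mxE ![in RHS]mxE; ring.
- rewrite !mulmxDr -!scalemxAr !(bracket_linearl sk) mulmxDr -scalemxAr.
  by apply/matrixP => i j; rewrite ![in LHS]mxE ![in RHS]mxE; ring.
- rewrite (bracketC sk x y) (bracketC sk x (a *m y)) (bracketC sk (a *m x) y) mulmxN.
  by apply/matrixP => i j; rewrite ![in LHS]mxE ![in RHS]mxE; ring.
Qed.

Lemma contmx_bracket_ric :
  (forall x y, contmx K (fun t => mu t x y)) -> contmx K (fun t => bracket_ric (mu t)).
Proof.
move=> cmu; have cad x : contmx K (fun t => ad (mu t) x).
  by move=> i j; under eq_fun do rewrite mxE; exact: cmu.
by apply: contmx_add; apply: contmx_scale; apply: contmx_sum => i _;
  apply: contmx_mul => //; exact: contmx_trmx.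
Qed.

End BracketCurves.

(** * The flows *)

Section LipschitzPairs.
Variables (R : realType) (a b : R) (d : R -> R).
Hypothesis d_ge0 : forall t, 0 <= d t.

(** Bounded pairs of functions whose distance is controlled by [d]; they are
    closed under all polynomial operations. *)
Definition lip_pair (f1 f2 : R -> R) := exists2 C, 0 <= C &
  forall t, a <= t <= b -> [/\ `|f1 t| <= C, `|f2 t| <= C & `|f1 t - f2 t| <= C * d t].

Lemma lip_pair_cst c : lip_pair (fun=> c) (fun=> c).
Proof. by exists `|c| => // t _; rewrite subrr normr0 mulr_ge0. Qed.

Lemma lip_pairD f1 f2 g1 g2 : lip_pair f1 f2 -> lip_pair g1 g2 ->
  lip_pair (fun t => f1 t + g1 t) (fun t => f2 t + g2 t).
Proof.
move=> [C C0 fC] [D D0 gD]; exists (C + D); first exact: addr_ge0.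
move=> t tab; have [f1C f2C fd] := fC t tab; have [g1D g2D gd] := gD t tab.
split; try by apply: (le_trans (ler_normD _ _)); exact: lerD.
rewrite opprD addrACA [leRHS]mulrDl; apply: (le_trans (ler_normD _ _)); exact: lerD.
Qed.

Lemma lip_pairM f1 f2 g1 g2 : lip_pair f1 f2 -> lip_pair g1 g2 ->
  lip_pair (fun t => f1 t * g1 t) (fun t => f2 t * g2 t).
Proof.
move=> [C C0 fC] [D D0 gD]; exists (C * D + C * D); first by rewrite addr_ge0 ?mulr_ge0.
move=> t tab; have [f1C f2C fd] := fC t tab; have [g1D g2D gd] := gD t tab.
have CD : 0 <= C * D by rewrite mulr_ge0.
split; try by rewrite normrM; apply: (@le_trans _ _ (C * D)); [exact: ler_pM|rewrite lerDl].
rewrite (_ : _ - _ = f1 t * (g1 t - g2 t) + (f1 t - f2 t) * g2 t); last by ring.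
rewrite [leRHS]mulrDl; apply: (le_trans (ler_normD _ _)); rewrite !normrM.
apply: lerD; first by rewrite -mulrA; exact: ler_pM.
by rewrite mulrAC; exact: ler_pM.
Qed.

Lemma lip_pair_sum (J : Type) (r : seq J) (F1 F2 : J -> R -> R) :
  (forall i, lip_pair (F1 i) (F2 i)) ->
  lip_pair (fun t => \sum_(i <- r) F1 i t) (fun t => \sum_(i <- r) F2 i t).
Proof.
move=> lF; elim: r => [|i r IHr].
  by under eq_fun do rewrite big_nil; under [X in lip_pair _ X]eq_fun do rewrite big_nil;
     exact: lip_pair_cst.
under eq_fun do rewrite big_cons; under [X in lip_pair _ X]eq_fun do rewrite big_cons.
exact: lip_pairD.
Qed.

Definition lip_mx p q (F1 F2 : R -> 'M[R]_(p, q)) :=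
  forall i j, lip_pair (fun t => F1 t i j) (fun t => F2 t i j).

Lemma lip_mxD p q (F1 F2 G1 G2 : R -> 'M[R]_(p, q)) : lip_mx F1 F2 -> lip_mx G1 G2 ->
  lip_mx (fun t => F1 t + G1 t) (fun t => F2 t + G2 t).
Proof.
move=> lF lG i j; under eq_fun do rewrite mxE.
by under [X in lip_pair _ X]eq_fun do rewrite mxE; exact: lip_pairD.
Qed.

Lemma lip_mxZ p q (f1 f2 : R -> R) (F1 F2 : R -> 'M[R]_(p, q)) :
  lip_pair f1 f2 -> lip_mx F1 F2 ->
  lip_mx (fun t => f1 t *: F1 t) (fun t => f2 t *: F2 t).
Proof.
move=> lf lF i j; under eq_fun do rewrite mxE.
by under [X in lip_pair _ X]eq_fun do rewrite mxE; exact: lip_pairM.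
Qed.

Lemma lip_mxN p q (F1 F2 : R -> 'M[R]_(p, q)) : lip_mx F1 F2 ->
  lip_mx (fun t => - F1 t) (fun t => - F2 t).
Proof.
have E (F : R -> 'M[R]_(p, q)) : (fun t => - F t) = (fun t => -1 *: F t).
  by apply/funext => t; rewrite scaleN1r.
by move=> lF; rewrite (E F1) (E F2); apply: lip_mxZ => //; exact: lip_pair_cst.
Qed.

Lemma lip_mxM p q r (F1 F2 : R -> 'M[R]_(p, q)) (G1 G2 : R -> 'M[R]_(q, r)) :
  lip_mx F1 F2 -> lip_mx G1 G2 ->
  lip_mx (fun t => F1 t *m G1 t) (fun t => F2 t *m G2 t).
Proof.
move=> lF lG i j; under eq_fun do rewrite mxE.
under [X in lip_pair _ X]eq_fun do rewrite mxE.
by apply: lip_pair_sum => k; exact: lip_pairM.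
Qed.

Lemma lip_mxT p q (F1 F2 : R -> 'M[R]_(p, q)) : lip_mx F1 F2 ->
  lip_mx (fun t => (F1 t)^T) (fun t => (F2 t)^T).
Proof.
move=> lF i j; under eq_fun do rewrite mxE.
by under [X in lip_pair _ X]eq_fun do rewrite mxE; exact: lF.
Qed.

Lemma lip_mx_sum p q (J : Type) (r : seq J) (F1 F2 : J -> R -> 'M[R]_(p, q)) :
  (forall i, lip_mx (F1 i) (F2 i)) ->
  lip_mx (fun t => \sum_(i <- r) F1 i t) (fun t => \sum_(i <- r) F2 i t).
Proof.
move=> lF i j; under eq_fun do rewrite summxE.
under [X in lip_pair _ X]eq_fun do rewrite summxE.
by apply: lip_pair_sum => k; exact: lF.
Qed.

Lemma lip_pair_eq f1 f2 g1 g2 : (forall t, a <= t <= b -> f1 t = g1 t) ->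
  (forall t, a <= t <= b -> f2 t = g2 t) -> lip_pair f1 f2 -> lip_pair g1 g2.
Proof.
by move=> fg1 fg2 [C C0 fC]; exists C => // t tab; rewrite -fg1// -fg2//; exact: fC.
Qed.

End LipschitzPairs.

(** * Uniqueness for the bracket flow *)

Section BracketFlowUniqueness.
Variables (R : realType) (n : nat) (mu0 : 'cV[R]_n -> 'cV[R]_n -> 'cV[R]_n).
Local Notation V := 'cV[R]_n.
Local Notation e := (basis_vec R).

(** Makes the velocity of the structure constants visibly polynomial, the form to which the closure
    properties of [lip_pair] apply. *)
Lemma bracket_delta_basis (mu : V -> V -> V) (A : 'M[R]_n) i j :
  skew_bilinear mu -> bracket_delta mu A (e i) (e j) =
  \sum_l A l i *: mu (e l) (e j) + \sum_l A l j *: mu (e i) (e l) - A *m mu (e i) (e j).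
Proof.
move=> sk; rewrite /bracket_delta; congr (_ + _ - _).
- rewrite {1}(col_sum_basis (A *m e i)) (bracket_suml sk); apply: eq_bigr => l _.
  by rewrite (bracketZl sk) -colE mxE.
- rewrite {1}(col_sum_basis (A *m e j)) (bracket_sumr sk); apply: eq_bigr => l _.
  by rewrite (bracketZr sk) -colE mxE.
Qed.

Lemma bracket_flow_unique (K : set R) (mu nu : R -> V -> V -> V) :
  bracket_flow mu0 K mu -> bracket_flow mu0 K nu ->
  forall t, K t -> mu t = nu t.
Proof.
move=> [timeK mu00 skew_mu dmu] [_ nu00 skew_nu dnu] t Kt.
pose J := ('I_n * 'I_n * 'I_n)%type.
pose c (la : R -> V -> V -> V) (p : J) (s : R) : R := la s (e p.1.1) (e p.1.2) p.2 0.
pose dc (la : R -> V -> V -> V) (p : J) (s : R) : R :=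
  bracket_delta (la s) (bracket_ric (la s)) (e p.1.1) (e p.1.2) p.2 0.
suff cc (p : J) : c mu p t = c nu p t.
  apply/funext => x; apply/funext => y.
  rewrite (bracket_expand (skew_mu t Kt)) (bracket_expand (skew_nu t Kt)).
  apply: eq_bigr => i _; apply: eq_bigr => j _; congr (_ *: _).
  by apply/matrixP => k l; rewrite (ord1 l); exact: (cc (i, j, k)).
have dcE (la : R -> V -> V -> V) q (s : R) : (forall x y, is_derive s 1 (fun s => la s x y)
    (bracket_delta (la s) (bracket_ric (la s)) x y)) -> is_derive s 1 (c la q) (dc la q s).
  by move=> /(_ (e q.1.1) (e q.1.2))/is_derive_mxP; exact.
apply/eqP; rewrite -subr_eq0; apply/eqP.
apply: (@gronwall_zero R K timeK J (fun p s => c mu p s - c nu p s)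
  (fun p s => dc mu p s - dc nu p s) _ _ _ t Kt p).
- by move=> {}p s Ks; apply: is_derive_add; [|apply: is_derive_opp]; apply: dcE => x y;
    [exact: dmu|exact: dnu].
- by move=> {}p; rewrite /c mu00 nu00 subrr.
move=> a b Ka Kb ab.
pose d s := \sum_(q : J) `|c mu q s - c nu q s|.
have d0 s : 0 <= d s by exact: sumr_ge0.
have Kab s : a <= s <= b -> K s by exact: time_interval_itv.
have lc i j k : lip_pair a b d (fun s => mu s (e i) (e j) k 0) (fun s => nu s (e i) (e j) k 0).
  have cont (la : R -> V -> V -> V) : (forall s : R, K s ->
      forall x y, is_derive s 1 (fun s => la s x y)
      (bracket_delta (la s) (bracket_ric (la s)) x y)) -> contK K (c la (i, j, k)).
    by move=> dla s Ks; apply: is_derive_continuous; apply: dcE; exact: dla.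
  have [C1 H1] := contK_bounded timeK (cont mu dmu) Ka Kb ab.
  have [C2 H2] := contK_bounded timeK (cont nu dnu) Ka Kb ab.
  (* The added 1 makes the constant at least one, so that it also controls a single difference of
     coordinates by their total distance [d]. *)
  exists (`|C1| + `|C2| + 1) => [|s sab]; first by rewrite !addr_ge0.
  split.
  - apply: (le_trans (H1 s sab)); apply: (le_trans (ler_norm _)).
    by rewrite -addrA lerDl addr_ge0.
  - apply: (le_trans (H2 s sab)); apply: (le_trans (ler_norm _)).
    by rewrite addrAC addrC lerDl addr_ge0.
  - rewrite (@le_trans _ _ (d s))//.
      by rewrite /d (bigD1 (i, j, k))//= lerDl sumr_ge0.
    by rewrite ler_peMl// lerDr addr_ge0.
have lmu i j : lip_mx a b d (fun s => mu s (e i) (e j)) (fun s => nu s (e i) (e j)).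
  by move=> k l; rewrite (ord1 l); exact: lc.
have lad i : lip_mx a b d (fun s => ad (mu s) (e i)) (fun s => ad (nu s) (e i)).
  move=> k l; under eq_fun do rewrite mxE.
  by under [X in lip_pair _ _ _ _ X]eq_fun do rewrite mxE; exact: lc.
have lric : lip_mx a b d (fun s => bracket_ric (mu s)) (fun s => bracket_ric (nu s)).
  apply: lip_mxD; apply: lip_mxZ; try exact: lip_pair_cst.
    by apply: lip_mx_sum => // i; apply: lip_mxM => //; exact: lip_mxT.
  by apply: lip_mx_sum => // i; apply: lip_mxM => //; exact: lip_mxT.
have ldc q : lip_pair a b d (dc mu q) (dc nu q).
  case: q => [[i j] k].
  have L : lip_mx a b d
     (fun s => \sum_l bracket_ric (mu s) l i *: mu s (e l) (e j) +
       \sum_l bracket_ric (mu s) l j *: mu s (e i) (e l)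
       - bracket_ric (mu s) *m mu s (e i) (e j))
     (fun s => \sum_l bracket_ric (nu s) l i *: nu s (e l) (e j) +
       \sum_l bracket_ric (nu s) l j *: nu s (e i) (e l)
       - bracket_ric (nu s) *m nu s (e i) (e j)).
    apply: lip_mxD; [|by apply: lip_mxN => //; exact: lip_mxM].
    by apply: lip_mxD; apply: lip_mx_sum => // l; apply: lip_mxZ => //; exact: lric.
  apply: lip_pair_eq (L k 0) => s sab.
    by rewrite /dc bracket_delta_basis//; apply/skew_mu/Kab.
  by rewrite /dc bracket_delta_basis//; apply/skew_nu/Kab.
have bC q : exists C, forall s, a <= s <= b -> `|dc mu q s - dc nu q s| <= C * d s.
  by have [C _ H] := ldc q; exists C => s /H[].
exists (\sum_q `|sval (cid (bC q))|) => s sab q.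
apply: (le_trans (svalP (cid (bC q)) s sab)); rewrite ler_wpM2r//.
apply: (le_trans (ler_norm _)).
by rewrite (bigD1 q)//= lerDl sumr_ge0.
Qed.

End BracketFlowUniqueness.

(** * Glueing solutions *)

Section TimeIntervalOps.
Variables (R : realType) (K L : set R).
Hypotheses (timeK : time_interval K) (timeL : time_interval L).

Lemma time_intervalI : time_interval (K `&` L).
Proof.
have [oK iK K0] := timeK; have [oL iL L0] := timeL; split=> //; first exact: openI.
by move=> x y [Kx Lx] [Ky Ly] z xyz; split; [exact: iK xyz|exact: iL xyz].
Qed.

(** Both intervals contain 0, so a point between [x] and [y] lies between 0 and one of them. *)
Lemma time_intervalU : time_interval (K `|` L).
Proof.
have [oK iK K0] := timeK; have [oL iL L0] := timeL; split; [exact: openU| |by left].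
move=> x y KLx KLy z /andP[xz zy]; have [z0|z0] := leP 0 z.
  have z0y : 0 <= z <= y by rewrite z0.
  by case: KLy => [Ky|Ly]; [left; exact: iK z0y|right; exact: iL z0y].
have xz0 : x <= z <= 0 by rewrite xz ltW.
by case: KLx => [Kx|Lx]; [left; exact: iK xz0|right; exact: iL xz0].
Qed.

Definition glue (X : Type) (u v : R -> X) t : X := if pselect (K t) then u t else v t.

Lemma glueL X (u v : R -> X) t : K t -> glue u v t = u t.
Proof. by rewrite /glue; case: pselect. Qed.

Lemma glueR X (u v : R -> X) t : (forall s, K s -> L s -> u s = v s) ->
  L t -> glue u v t = v t.
Proof. by move=> uv Lt; rewrite /glue; case: pselect => // Kt; exact: uv. Qed.

(** [F] is the quantity differentiated: evaluation at two vectors for brackets, the identity for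
    matrices. *)
Lemma glue_derive (X : Type) (W : normedModType R) (F : X -> W) (dF : X -> W)
    (u v : R -> X) : (forall s, K s -> L s -> u s = v s) ->
  (forall t, K t -> is_derive t 1 (fun s => F (u s)) (dF (u t))) ->
  (forall t, L t -> is_derive t 1 (fun s => F (v s)) (dF (v t))) ->
  forall t, (K `|` L) t -> is_derive t 1 (fun s => F (glue u v s)) (dF (glue u v t)).
Proof.
move=> uv du dv t [Kt|Lt].
  rewrite glueL//; apply: near_eq_is_derive (du t Kt); near=> s; rewrite glueL//.
  by near: s; exact: time_interval_nbhs.
rewrite glueR//; apply: near_eq_is_derive (dv t Lt); near=> s; rewrite glueR//.
by near: s; exact: time_interval_nbhs.
Unshelve. all: by end_near. Qed.

End TimeIntervalOps.

(** * Passing between Ricci flow, inner products and brackets *)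

Section Flows.
Variables (R : realType) (n : nat) (mu0 : 'cV[R]_n -> 'cV[R]_n -> 'cV[R]_n).
Local Notation V := 'cV[R]_n.
Hypothesis skew_mu0 : skew_bilinear mu0.
Hypothesis nilp_mu0 : nilpotent_bracket mu0.
Hypothesis inv_mu0 : left_invariant mu0 (bracket_metric mu0).
Implicit Types (K L : set R) (P Q h : R -> 'M[R]_n).

Lemma bracket_flow_restrict K L mu : time_interval L -> L `<=` K ->
  bracket_flow mu0 K mu -> bracket_flow mu0 L mu.
Proof. by move=> tL LK [_ ? sk d]; split=> // t /LK; [exact: sk|exact: d]. Qed.

Lemma bracket_flow_glue K L mu nu : bracket_flow mu0 K mu -> bracket_flow mu0 L nu ->
  bracket_flow mu0 (K `|` L) (glue K mu nu).
Proof.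
move=> fm fn; have [tK mu00 skm dm] := fm; have [tL nu00 skn dn] := fn.
have tKL := time_intervalI tK tL.
have uv s : K s -> L s -> mu s = nu s.
  move=> Ks Ls; apply: (bracket_flow_unique (K := K `&` L)) => //.
  - by apply: bracket_flow_restrict fm => // ? [].
  - by apply: bracket_flow_restrict fn => // ? [].
split.
- exact: time_intervalU.
- by rewrite glueL//; exact: time_interval0.
- by move=> t [Kt|Lt]; [rewrite glueL//; exact: skm|rewrite (glueR uv)//; exact: skn].
- move=> t KLt x y; apply: (glue_derive tK tL (F := fun m : V -> V -> V => m x y)
    (dF := fun m : V -> V -> V => bracket_delta m (bracket_ric m) x y)) => // s Ks.
    exact: dm.
  exact: dn.
Qed.

Lemma bracket_act1 : bracket_act 1%:M mu0 = mu0.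
Proof.
by apply/funext => x; apply/funext => y; rewrite /bracket_act invmx1 !mul1mx.
Qed.

Lemma bracket_act_flow K h : time_interval K -> h 0 = 1%:M ->
  (forall t, K t -> h t \in unitmx) ->
  (forall t, K t -> is_derive t 1 h (- (bracket_ric (bracket_act (h t) mu0) *m h t))) ->
  bracket_flow mu0 K (fun t => bracket_act (h t) mu0).
Proof.
move=> tK h0 hu dh; split=> //; first by rewrite h0 bracket_act1.
  by move=> t Kt; exact: skew_bilinear_act.
move=> t Kt x y; have htu := hu t Kt.
have di := is_derive_invmx tK hu dh Kt.
have dm := is_derive_bracket skew_mu0 (is_derive_mulmxr x di) (is_derive_mulmxr y di).
have := is_derive_mulmx (dh t Kt) dm; congr is_derive.
rewrite /bracket_delta; set r := bracket_ric _.
(* As [h' = - r *m h], the inverse has derivative [invmx h *m r]: the two arguments give the first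
   two terms of [bracket_delta] and the outer factor [h] the third. *)
have E z : - (invmx (h t) *m - (r *m h t) *m invmx (h t)) *m z = invmx (h t) *m (r *m z).
  by rewrite !(mulmxN, mulNmx) opprK -!mulmxA mulKVmx.
rewrite !E /bracket_act mulNmx -!mulmxA mulmxDr.
by rewrite addrC.
Qed.

(** [left_ricci] involves coordinate derivatives at 0, while [frame_ricci] is rational in the
    entries of [P]; continuity of the gauge coefficient is checked on the latter. *)
Lemma left_ricci_contmx K P : time_interval K ->
  (forall t, K t -> inner_product (P t)) ->
  (forall t, K t -> is_derive t 1 P (- 2 *: left_ricci mu0 (P t))) ->
  contmx K (fun t => - (invmx (P t) *m frame_ricci mu0 (P t))).
Proof.
move=> tK iP dP.
have cP : contmx K P := is_derive_contmx dP.
have cI : contmx K (fun t => invmx (P t)).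
  by apply: (contmx_invmx tK _ dP) => t Kt; apply/inner_product_unit/iP.
have cnabla u v : contmx K (fun t => nabla mu0 (P t) u v).
  apply: contmx_scale; apply: contmx_add; first exact: contmx_cst.
  apply: contmx_opp; apply: contmx_mul => //; apply: contmx_add;
    apply: contmx_mul; try exact: contmx_cst; apply: contmx_mul => //; exact: contmx_cst.
have cconn u : contmx K (fun t => conn mu0 (P t) u).
  by move=> i j; under eq_fun do rewrite mxE; exact: cnabla.
have ccurv u v : contmx K (fun t => curv mu0 (P t) u v).
  apply: contmx_add; last exact: contmx_opp.
  by apply: contmx_add; [exact: contmx_mul|apply: contmx_opp; exact: contmx_mul].
apply: contmx_opp; apply: contmx_mul => // i j; under eq_fun do rewrite mxE.
by apply: contK_sum => a _; exact: ccurv.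
Qed.

Lemma inner_flow_gauge K P : inner_product_flow mu0 K P -> exists h,
  [/\ h 0 = 1%:M, forall t, K t -> h t \in unitmx,
      forall t, K t -> P t = (h t)^T *m h t,
      forall t, K t -> is_derive t 1 h (- (h t *m (invmx (P t) *m left_ricci mu0 (P t))))
    & forall t, K t -> is_derive t 1 h (- (bracket_ric (bracket_act (h t) mu0) *m h t))].
Proof.
move=> [tK P0 iP dP].
pose B t := - (invmx (P t) *m frame_ricci mu0 (P t)).
have cB : contmx K B := left_ricci_contmx tK iP dP.
have [h [h0 dh]] := linear_ode_exists tK cB.
have hu := linear_ode_unit tK cB h0 dh.
have PB t : K t -> P t *m B t = - left_ricci mu0 (P t).
  move=> Kt; rewrite mulmxN mulKVmx ?inner_product_unit//; last exact: iP.
  by rewrite left_ricciE//; exact: iP.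
(* Symmetry of the Ricci tensor is obtained from the flow: it is, up to a factor, the derivative of
   a curve of symmetric matrices. *)
have ricT t : K t -> (left_ricci mu0 (P t))^T = left_ricci mu0 (P t).
  move=> Kt; have d1 := is_derive_trmx (dP t Kt).
  have d2 : is_derive t 1 (fun s => (P s)^T) (- 2 *: left_ricci mu0 (P t)).
    apply: near_eq_is_derive (dP t Kt); near=> s.
    have Ks : K s by near: s; exact: time_interval_nbhs.
    by have [-> _] := iP s Ks.
  have := is_derive_uniq d1 d2; rewrite linearZ/= => /(congr1 (fun M => (- 2)^-1 *: M)).
  by rewrite !scalerA mulVf ?scale1r// oppr_eq0 pnatr_eq0.
(* Both curves solve the linear equation [X' = B^T *m X + X *m B] with initial value the
   identity. *)
have Ph t : K t -> P t = (h t)^T *m h t.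
  move=> Kt; apply: (linear_ode_unique tK (contmx_trmx cB) cB (X := P)
    (Y := fun s => (h s)^T *m h s)) => //; first by rewrite P0 h0 trmx1 mulmx1.
    move=> s Ks; have -> : (B s)^T *m P s = - left_ricci mu0 (P s).
      have [PT _] := iP s Ks.
      by rewrite -[P s in LHS]PT -trmx_mul PB// linearN/= ricT.
    rewrite PB// -opprD -mulr2n -scaler_nat -scaleNr; exact: dP.
  move=> s Ks; have := is_derive_mulmx (is_derive_trmx (dh s Ks)) (dh s Ks).
  by rewrite trmx_mul !mulmxA.
have hB t : K t -> h t *m B t = - (h t *m (invmx (P t) *m left_ricci mu0 (P t))).
  by move=> Kt; rewrite mulmxN left_ricciE//; exact: iP.
have dh1 t : K t -> is_derive t 1 h (- (h t *m (invmx (P t) *m left_ricci mu0 (P t)))).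
  by move=> Kt; rewrite -hB//; exact: dh.
exists h; split=> // t Kt.
(* With [P = h^T *m h] and Ricci tensor [h^T *m Ric *m h], the Ricci operator of [P] is [Ric]
   conjugated by [h]. *)
have hB' : h t *m (invmx (P t) *m left_ricci mu0 (P t)) =
    bracket_ric (bracket_act (h t) mu0) *m h t.
  have htu := hu t Kt; have hTu : (h t)^T \in unitmx by rewrite unitmx_tr.
  rewrite Ph// left_ricci_gram// -(mulmxA (h t)^T).
  apply: (can_inj (mulKmx hTu)); rewrite !mulmxA mulmxV ?mul1mx//.
  by rewrite unitmx_mul hTu.
by rewrite -hB'; exact: dh1.
Unshelve. all: by end_near. Qed.

Lemma bracket_flow_gauge K mu : bracket_flow mu0 K mu -> exists k : R -> 'M[R]_n,
  inner_product_flow mu0 K (fun t => (k t)^T *m k t).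
Proof.
move=> [tK mu00 skm dm].
have cr : contmx K (fun t => - bracket_ric (mu t)).
  apply/contmx_opp/contmx_bracket_ric => x y.
  exact: is_derive_contmx (fun t Kt => dm t Kt x y).
have [k [k0 dk]] := linear_ode_exists_left tK cr.
have ku t : K t -> k t \in unitmx.
  move=> Kt; rewrite -unitmx_tr; apply: (linear_ode_unit tK (contmx_trmx cr)
    (H := fun s => (k s)^T)) Kt; first by rewrite k0 trmx1.
  by move=> s Ks; have := is_derive_trmx (dk s Ks); rewrite trmx_mul.
have muE t : K t -> mu t = bracket_act (k t) mu0.
  move=> Kt; apply/funext => x; apply/funext => y.
  (* The bracket pulled back by [k]: the terms of the bracket flow cancel those of
     [k' = - Ric *m k], so [F z w] is constant. *)
  pose F z w s := invmx (k s) *m mu s (k s *m z) (k s *m w).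
  have F0 z w : F z w t = mu0 z w.
    have -> : mu0 z w = F z w 0 by rewrite /F k0 invmx1 !mul1mx mu00.
    apply: (derive0_const tK) => // s Ks.
    have sks := skm s Ks; have ksu := ku s Ks.
    have di := is_derive_invmx tK ku dk Ks.
    have db := is_derive_bracket_curve tK skm Ks (dm s Ks)
      (skew_bracket_delta skm (bracket_ric (mu s)) Ks)
      (is_derive_mulmxr z (dk s Ks)) (is_derive_mulmxr w (dk s Ks)).
    have := is_derive_mulmx di db; congr is_derive.
    rewrite /bracket_delta; set r := bracket_ric _.
    have -> : - (invmx (k s) *m (- r *m k s) *m invmx (k s)) = invmx (k s) *m r.
      by rewrite !(mulNmx, mulmxN) opprK -!mulmxA mulmxV// mulmx1.
    rewrite -!mulmxA -mulmxDr !mulNmx.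
    have bN u v : mu s (- u) v = - mu s u v by rewrite -scaleN1r (bracketZl sks) scaleN1r.
    have bN' u v : mu s u (- v) = - mu s u v by rewrite -scaleN1r (bracketZr sks) scaleN1r.
    rewrite bN bN' (_ : _ + _ = 0) ?mulmx0//.
    by apply/matrixP => i j; rewrite ![in LHS]mxE ![in RHS]mxE; ring.
  by rewrite /bracket_act -F0 /F mulKVmx ?ku// !mulKVmx ?ku.
exists k; split=> //.
- by rewrite k0 trmx1 mulmx1.
- by move=> t Kt; apply/inner_product_gram/ku.
- move=> t Kt; rewrite left_ricci_gram ?ku// -muE//.
  have := is_derive_mulmx (is_derive_trmx (dk t Kt)) (dk t Kt); congr is_derive.
  have ricT : (bracket_ric (mu t))^T = bracket_ric (mu t).
    rewrite /bracket_ric linearD/=; congr (_ + _); rewrite linearZ/= linear_sum/=;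
      by apply: congr1; apply: eq_bigr => i _; rewrite trmx_mul trmxK.
  rewrite trmx_mul linearN/= ricT mulmxN !mulNmx mulmxN -opprD scaleNr scaler_nat mulr2n.
  by rewrite !mulmxA.
Qed.

Lemma inner_flow_restrict K L P : time_interval L -> L `<=` K ->
  inner_product_flow mu0 K P -> inner_product_flow mu0 L P.
Proof. by move=> tL LK [_ ? iP d]; split=> // t /LK; [exact: iP|exact: d]. Qed.

Lemma inner_flow_unique K P Q : inner_product_flow mu0 K P -> inner_product_flow mu0 K Q ->
  forall t, K t -> P t = Q t.
Proof.
move=> fP fQ; have [tK _ _ _] := fP.
have [h [h0 hu Ph _ dh]] := inner_flow_gauge fP.
have [k [k0 ku Qk _ dk]] := inner_flow_gauge fQ.
have fh := bracket_act_flow tK h0 hu dh; have fk := bracket_act_flow tK k0 ku dk.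
have hk := bracket_flow_unique fh fk.
have cr : contmx K (fun t => - bracket_ric (bracket_act (h t) mu0)).
  have [_ _ _ dm] := fh; apply/contmx_opp/contmx_bracket_ric => x y.
  exact: is_derive_contmx (fun t Kt => dm t Kt x y).
move=> t Kt; rewrite Ph// Qk//.
(* Equal brackets determine [h] only up to automorphisms of [mu0]; equality of [h] and [k] comes
   from the linear equation that both satisfy once the Ricci operators agree. *)
suff -> : h t = k t by [].
apply: (linear_ode_unique tK cr (@contmx_cst R K n n 0) (X := h) (Y := k)) Kt.
- by rewrite h0 k0.
- by move=> s Ks; rewrite mulmx0 addr0 mulNmx; exact: dh.
- by move=> s Ks; rewrite mulmx0 addr0 mulNmx hk//; exact: dk.
Qed.

Lemma inner_flow_glue K L P Q : inner_product_flow mu0 K P -> inner_product_flow mu0 L Q ->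
  inner_product_flow mu0 (K `|` L) (glue K P Q).
Proof.
move=> fP fQ; have [tK P0 iP dP] := fP; have [tL Q0 iQ dQ] := fQ.
have tKL := time_intervalI tK tL.
have PQ s : K s -> L s -> P s = Q s.
  move=> Ks Ls; apply: (inner_flow_unique (K := K `&` L)) => //.
  - by apply: inner_flow_restrict fP => // ? [].
  - by apply: inner_flow_restrict fQ => // ? [].
split.
- exact: time_intervalU.
- by rewrite glueL//; exact: time_interval0.
- by move=> t [Kt|Lt]; [rewrite glueL//; exact: iP|rewrite (glueR PQ)//; exact: iQ].
- move=> t KLt; exact: (@glue_derive R K L tK tL _ _ (fun M : 'M[R]_n => M)
    (fun M => - 2 *: left_ricci mu0 M) P Q PQ dP dQ t KLt).
Qed.

Lemma inner_flow_ricci_flow K P : inner_product_flow mu0 K P ->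
  invariant_ricci_flow mu0 K (fun t => left_metric mu0 (P t)).
Proof.
move=> [tK P0 iP dP]; split=> //; first by rewrite P0.
- move=> t Kt; split; first exact/riemannian_left_metric/iP.
  exact: left_invariant_left_metric.
- move=> t Kt x; rewrite ricci_left_metric//; last exact: iP.
  have := is_derive_mulmxr (coframe mu0 x) (is_derive_mulmxl (coframe mu0 x)^T (dP t Kt)).
  by rewrite -scalemxAr -scalemxAl left_ricciE//; exact: iP.
Qed.

Lemma ricci_flow_inner_flow K g : invariant_ricci_flow mu0 K g ->
  (forall t, K t -> g t = left_metric mu0 (g t 0)) /\
  inner_product_flow mu0 K (fun t => g t 0).
Proof.
move=> [tK g0 ig dg].
have gE t : K t -> g t = left_metric mu0 (g t 0).
  by move=> /ig[_ inv]; exact: left_invariantE.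
split=> //; split=> //; first by rewrite g0 [bracket_metric _ _]left_metric0.
- by move=> t /ig[[_ ip] _]; exact: ip.
- by move=> t Kt; rewrite /left_ricci -gE//; exact: dg.
Qed.

(** By [frame_act], [h] carries the Maurer-Cartan form of [mu0] to that of the transported
    bracket. *)
Lemma pullback_bracket_metric (h : 'M[R]_n) : h \in unitmx ->
  pullback (mulmx h) (bracket_metric (bracket_act h mu0)) =
  left_metric mu0 (h^T *m h).
Proof.
move=> hu; apply/funext => x.
have J : jacobian_mx (mulmx h) x = h.
  apply: mx_ext => v; rewrite jacobian_mxE; last first.
    by apply: polymx_differentiable; apply: polymxM; [exact: polymx_cst|exact: polymx_id].
  by case: (is_derive_mulmxl h (is_derive_id x v)).
have Au := frame_unit skew_mu0 nilp_mu0 x.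
have I : invmx (frame (bracket_act h mu0) (h *m x)) *m h = h *m coframe mu0 x.
  rewrite frame_act//; set A := frame mu0 x in Au *.
  have u1 : h *m A *m invmx h \in unitmx by rewrite !unitmx_mul hu Au unitmx_inv.
  apply: (can_inj (mulKmx u1)); rewrite mulKVmx// -!mulmxA mulKmx//.
  by rewrite /A mul_frame_coframe// mulmx1.
rewrite /pullback J left_metricE.
change (bracket_metric (bracket_act h mu0) (h *m x)) with
  ((invmx (frame (bracket_act h mu0) (h *m x)))^T *m 1%:M *m
    invmx (frame (bracket_act h mu0) (h *m x))).
rewrite mulmx1 -!mulmxA I mulmxA -trmx_mul I trmx_mul.
by rewrite !mulmxA.
Qed.

End Flows.

Theorem theorem5p1 (R : realType) (n : nat)
    (mu0 : 'cV[R]_n -> 'cV[R]_n -> 'cV[R]_n)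
    (hmu0 : nilpotent_lie_bracket mu0)
    (I : set R) (g : R -> 'cV[R]_n -> 'M[R]_n)
    (hg : maximal_solution (invariant_ricci_flow mu0) I g)
    (J : set R) (mu : R -> 'cV[R]_n -> 'cV[R]_n -> 'cV[R]_n)
    (hmu : maximal_solution (bracket_flow mu0) J mu) :
  I = J /\
  exists h : R -> 'M[R]_n,
    [/\ forall t, I t ->
          h t \in unitmx /\
          g t = pullback (mulmx (h t)) (bracket_metric (mu t)),
        h 0 = 1%:M /\
        (forall t, I t ->
          is_derive t 1 h (- (h t *m ricci_operator (g t) 0)) /\
          is_derive t 1 h (- (bracket_ric (mu t) *m h t))),
        (forall t, I t -> g t 0 = (h t)^T *m h t) /\
        the_solution (inner_product_flow mu0) I (fun t => (h t)^T *m h t)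
      & forall t, I t -> mu t = bracket_act (h t) mu0].
Proof.
have [sk _ nilp] := hmu0; have [fg maxI] := hg; have [fmu maxJ] := hmu.
have [tI g0 ig _] := fg; have [tJ _ _ _] := fmu.
(* The flow at time 0 is [bracket_metric mu0], and a solution is invariant at every time. *)
have inv : left_invariant mu0 (bracket_metric mu0).
  by rewrite -g0; case: (ig 0 (time_interval0 tI)).
have [gE fP] := ricci_flow_inner_flow sk nilp fg.
(* Glued to the inner products of [g], [Q] yields an invariant Ricci flow extending [g], which
   maximality confines to [I]. The same inclusion is needed for [the_solution]. *)
have sub (K : set R) (Q : R -> 'M[R]_n) : inner_product_flow mu0 K Q -> K `<=` I.
  move=> fQ; have fW := inner_flow_glue sk nilp inv fP fQ.
  apply: subset_trans (maxI _ _ (inner_flow_ricci_flow sk nilp inv fW) _ _).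
  - by move=> t Kt; right.
  - by move=> t It; left.
  - by move=> t It; rewrite glueL// -gE.
have [h [h0 hu Ph dh1 dh2]] := inner_flow_gauge sk nilp inv fP.
have fnu := bracket_act_flow sk tI h0 hu dh2.
(* The bracket flow obtained from [h], glued to [mu], extends [mu], so maximality of [J] applies. *)
have IJ : I `<=` J.
  have fW := bracket_flow_glue fmu fnu.
  apply: subset_trans (maxJ _ _ fW _ _).
  - by move=> t It; right.
  - by move=> t Jt; left.
  - by move=> t Jt; rewrite glueL.
(* The gauge of [mu] gives an inner product flow on the whole of [J]. *)
have JI : J `<=` I by have [k /sub] := bracket_flow_gauge sk nilp inv fmu.
have muE t : I t -> mu t = bracket_act (h t) mu0.
  exact: (bracket_flow_unique (bracket_flow_restrict tI IJ fmu) fnu).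
split; first exact/seteqP.
exists h; split.
- move=> t It; split; first exact: hu.
  by rewrite muE// (pullback_bracket_metric sk nilp (hu t It)) gE// Ph.
- split=> // t It; split; last by rewrite muE//; exact: dh2.
  have := dh1 t It; rewrite /left_ricci -gE//.
- split; first exact: Ph.
  split.
    have [_ _ iP dP] := fP; split.
    + exact: tI.
    + by rewrite h0 trmx1 mulmx1.
    + by move=> t It; rewrite -Ph//; exact: iP.
    + move=> t It; rewrite -Ph//; apply: near_eq_is_derive (dP t It).
      near=> s; apply: Ph; near: s; exact: time_interval_nbhs.
  move=> K Q fQ; have KI := sub K Q fQ; split; first exact: KI.
  have [tK _ _ _] := fQ; move=> t Kt; rewrite -(Ph t (KI t Kt)).
  exact: (inner_flow_unique sk nilp inv fQ (inner_flow_restrict tK KI fP) Kt).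
- exact: muE.
Unshelve. all: by end_near. Qed.
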